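(* Assume that the compartmental system (S) of the context is closed (i.e. $\tilde I_i\equiv0$ and $\tilde g_{0i}\equiv0$ for each $i\in\{1,\dots,m\}$), and that hypotheses (C1)–(C5), (C6)* and (C7) of the context hold. Then for each $c>0$ there is a unique minimal subset $K_c$ of $\Omega\times BU$ such that $M|_{K_c}=c$, where $M$ is the total mass. Moreover, $K_c\subset\Omega\times BU_D^+$, and $K_{c_1}<_DK_{c_2}$ whenever $c_1<c_2$.
   Context: Notation. $X=C((-\infty,0],\mathbb{R}^m)$ carries the compact-open topology. $BU\subset X$ is the Banach space of bounded uniformly continuous functions with the supremum norm $\|x\|_\infty$; $B_r=\{x\in BU:\|x\|_\infty\le r\}$. For continuous $x$ on $(-\infty,a]$ and $t\le a$, $x_t(s)=x(t+s)$, $s\le0$. $\mathbb{R}^+=[0,\infty)$. Compartmental system (compartments $C_1,\dots,C_m$, environment $C_0$, pipe $P_{ij}$ from $C_j$ to $C_i$). For $i\in\{0,\dots,m\}$, $j\in\{1,\dots,m\}$ let $\tilde g_{ij}\colon\mathbb{R}\times\mathbb{R}\to\mathbb{R}$, and for $i\in\{1,\dots,m\}$ let $\tilde I_i\colon\mathbb{R}\to[0,\infty)$; put $\tilde g_{i0}(t,v)=\tilde I_i(t)$ and $\tilde g=(\tilde g_{ij})\colon\mathbb{R}\times\mathbb{R}\to\mathbb{R}^{m(m+2)}$. For $i,j\in\{1,\dots,m\}$ let $\mu_{ij},\nu_{ij}$ be positive regular Borel measures on $(-\infty,0]$ with finite total variation. The system (S) is, for $i=1,\dots,m$, $t\ge0$,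 $$\tfrac{d}{dt}\Big[z_i(t)-\sum_{j=1}^m\int_{-\infty}^0z_j(t+s)\,d\nu_{ij}(s)\Big]=-\tilde g_{0i}(t,z_i(t))-\sum_{j=1}^m\tilde g_{ji}(t,z_i(t))+\sum_{j=1}^m\int_{-\infty}^0\tilde g_{ij}(t+s,z_j(t+s))\,d\mu_{ij}(s)+\tilde I_i(t).$$ Hypotheses: (C1) $\tilde g$ is $C^1$-admissible, i.e. $C^1$ in its second variable, with $\tilde g$ and $\frac{\partial\tilde g}{\partial v}$ uniformly continuous and bounded on $\mathbb{R}\times\{v_0\}$ for all $v_0\in\mathbb{R}$; all components are monotone (nondecreasing) in the second variable; and $\tilde g_{ij}(t,0)=0$ for all $t\in\mathbb{R}$, $i\in\{0,\dots,m\}$, $j\in\{1,\dots,m\}$. (C2) $\tilde g$ is recurrent, i.e. its hull is minimal. (C3) $\mu_{ij}(-\infty,0]=1$ and $\int_{-\infty}^0|s|\,d\mu_{ij}(s)<\infty$. (C4) $\nu_{ij}(\{0\})=0$ and $\sum_{j=1}^m\nu_{ij}(-\infty,0]<1$ for each $i$. Define $D\colon BU\to\mathbb{R}^m$ by $D_ix=x_i(0)-\sum_{j=1}^m\int_{-\infty}^0x_j(s)\,d\nu_{ij}(s)$. (C5) The measures $d\eta_{ij}=c_{ij}\,d\mu_{ij}-\sum_{k=0}^md_{ki}\,d\nu_{ij}$ ($1\le i,j\le m$) are positive, where $c_{ij}=\inf_{(t,v)\in\mathbb{R}^2}\frac{\partial\tilde g_{ij}}{\partial v}(t,v)$, $d_{ij}=\sup_{(t,v)\in\mathbb{R}^2}\frac{\partial\tilde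 g_{ij}}{\partial v}(t,v)$. (C6)* Given $i\in\{0,\dots,m\}$ and $j\in\{1,\dots,m\}$, either $\tilde g_{ij}\equiv0$ on $\mathbb{R}\times\mathbb{R}^+$, or for each $v\ge0$ there is a $\delta_v>0$ such that $\frac{\partial\tilde g_{ij}}{\partial v}(t,v)\ge\delta_v$ for each $t\in\mathbb{R}$. (C7) If $K_1=\{(\omega,x(\omega)):\omega\in\Omega\}$ and $K_2=\{(\omega,y(\omega)):\omega\in\Omega\}$ are two minimal subsets of $\Omega\times BU_D^+$ such that $x(\omega)\le_Dy(\omega)$ for each $\omega\in\Omega$ and $D_ix(\omega_0)=D_iy(\omega_0)$ for some $\omega_0\in\Omega$ and $i\in\{1,\dots,m\}$, then $x(\omega)=y(\omega)$ for each $\omega\in\Omega$, i.e. $K_1=K_2$. Orders. $BU_D^+=\{x\in BU:Dx_s\ge0\text{ for each }s\le0\}$; $x\le_Dy$ iff $Dx_s\le Dy_s$ (componentwise) for each $s\le0$; $x<_Dy$ iff $x\le_Dy$ and $x\ne y$. For minimal sets $K_1=\{(\omega,x(\omega))\}$, $K_2=\{(\omega,y(\omega))\}$: $K_1<_DK_2$ iff $x(\omega)<_Dy(\omega)$ for each $\omega\in\Omega$. Family over the hull. $\Omega$ is the hull of $\tilde g$: the closure of $\{\tilde g_t:t\in\mathbb{R}\}$, $\tilde g_t(s,v)=\tilde g(t+s,v)$, in the topology of uniform convergence on compact sets; it is a compact metric space with the translation flow $(\omega\cdot t)(s,v)=\omega(t+s,v)$, minimal by (C2). Put $g(\omega,v)=\omega(0,v)$,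 $g=(g_{ij})$, $I_i(\omega)=g_{i0}(\omega,\cdot)$, and $F_i(\omega,x)=-g_{0i}(\omega,x_i(0))-\sum_{j=1}^mg_{ji}(\omega,x_i(0))+\sum_{j=1}^m\int_{-\infty}^0g_{ij}(\omega\cdot s,x_j(s))\,d\mu_{ij}(s)+I_i(\omega)$ for $(\omega,x)\in\Omega\times BU$. The family is $\frac{d}{dt}Dz_t=F(\omega\cdot t,z_t)$, $t\ge0$, $\omega\in\Omega$; $z(t,\omega,x)$ is the unique solution with initial value $x\in BU$, $u(t,\omega,x)(s)=z(t+s,\omega,x)$, and $\tau(t,\omega,x)=(\omega\cdot t,u(t,\omega,x))$ is the induced skew-product semiflow. It is part of the setting that $F$ is continuous and locally Lipschitz in $x$ for $\|\cdot\|_\infty$, bounded on each $\Omega\times B_r$, and continuous on each $\Omega\times B_r$ for the compact-open topology on $B_r$. A minimal subset is a nonempty compact (for the product metric topology, compact-open on $BU$) positively $\tau$-invariant set containing no other nonempty compact positively invariant set; every such set is of the form $\{(\omega,x(\omega)):\omega\in\Omega\}$ with $x\colon\Omega\to BU$ continuous for the compact-open topology and $x(\omega\cdot t)=u(t,\omega,x(\omega))$. Total mass: $M(\omega,x)=\sum_{i=1}^mD_ix+\sum_{i=1}^m\sum_{j=1}^m\int_{-\infty}^0\Big(\int_s^0g_{ji}(\omega\cdot\tau,x_i(\tau))\,d\tau\Big)d\mu_{ji}(s)$. *)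

(* Defs.v *)
From HB Require Import structures.
From mathcomp Require Import all_boot all_order all_algebra.
From mathcomp Require Import all_classical all_reals all_analysis.

Set Implicit Arguments.
Unset Strict Implicit.
Unset Printing Implicit Defensive.

Import Order.TTheory GRing.Theory Num.Theory numFieldNormedType.Exports.

Local Open Scope classical_set_scope.
Local Open Scope ring_scope.

Notation neg R := `]-oo, (0 : R)]%classic.
Notation past R := (set_type (neg R)).

(* {family compact, U -> V} is the topology of uniform convergence on compact
   sets; on continuous functions it is the compact-open topology.  Unlike the
   latter, it keeps the continuous functions closed among all functions. *)
Notation hist R m := {family compact, past R -> 'rV[R]_m}.

(* R^(m(m+2)): the entry (i, j) of the matrix is g_ij and the row is I = g_i0. *)
Notation flux R m := ('M[R]_(m.+1, m) * 'rV[R]_m)%type.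
Notation vfield R m := {family compact, (R * R)%type -> flux R m}.

(* The index set {0, ..., m} is 'I_m.+1: the environment C_0 is ord0, and the
   compartment C_i is cpt i for i : 'I_m. *)
Definition cpt (m : nat) (i : 'I_m) : 'I_m.+1 := lift ord0 i.

(* A measure on (-oo, 0] is represented by a finite Borel measure on R of which
   only the trace on (-oo, 0] is ever used; finite Borel measures on (-oo, 0]
   are automatically regular. *)
Record compartmental (R : realType) (m : nat) := Compartmental {
  pipe : 'I_m.+1 -> 'I_m -> R -> R -> R ;
  inflow : 'I_m -> R -> R ;
  inflow_ge0 : forall i t, 0 <= inflow i t ;
  mu : 'I_m -> 'I_m -> {finite_measure set R -> \bar R} ;
  nu : 'I_m -> 'I_m -> {finite_measure set R -> \bar R}
}.

Section PhaseSpace.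
Variables (R : realType) (m : nat).
Implicit Types (x y : hist R m) (z : R -> 'rV[R]_m).

Fact clamp_subproof (s : R) : Num.min s 0 \in neg R.
Proof. by rewrite inE /= in_itv /= ge_min lexx orbT. Qed.

(* clamp s is s itself when s <= 0; it lets one evaluate a history at a real. *)
Definition clamp (s : R) : past R := exist _ (Num.min s 0) (clamp_subproof s).

Definition seg z (t : R) : hist R m := fun s : past R => z (t + val s).

(* x_s for s <= 0 *)
Definition shift_hist x (s : past R) : hist R m :=
  seg (fun r => x (clamp r)) (val s).

Definition BU : set (hist R m) :=
  [set x | unif_continuous (x : past R -> 'rV[R]_m) /\
           exists r : R, forall s, `|x s| <= r].

Definition BU_ball (r : R) : set (hist R m) :=
  [set x | BU x /\ forall s, `|x s| <= r].

Definition sup_norm x : R := sup (range (fun s => `|x s|)).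

End PhaseSpace.

Section Hull.
Variables (R : realType) (m : nat).

Definition translate (t : R) (w : vfield R m) : vfield R m :=
  fun p => w (t + p.1, p.2).

Definition hull (w : vfield R m) : set (vfield R m) :=
  closure (range (fun t => translate t w)).

Definition flow_invariant (A : set (vfield R m)) :=
  forall t w, A w -> A (translate t w).

Definition flow_minimal (A : set (vfield R m)) :=
  [/\ A !=set0, compact A, flow_invariant A &
      forall B, B `<=` A -> B !=set0 -> compact B -> flow_invariant B -> B = A].

Definition recurrent (w : vfield R m) := flow_minimal (hull w).

(* "Uniformly continuous and bounded on R x {v0}" is read as a property of the
   restriction t |-> f (t, v0). *)
Definition admissible (f : vfield R m) :=
  forall v0 : R, unif_continuous (fun t : R => f (t, v0)) /\
                 exists r : R, forall t, `|f (t, v0)| <= r.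

Definition dv (f : vfield R m) : vfield R m :=
  fun p => derive1 (fun v => f (p.1, v)) p.2.

Definition C1_admissible (f : vfield R m) :=
  [/\ forall t v, derivable (fun v => f (t, v)) v 1,
      forall t, continuous (fun v => dv f (t, v)),
      admissible f & admissible (dv f)].

End Hull.

Section System.
Variables (R : realType) (m : nat) (S : compartmental R m).
Implicit Types (x y : hist R m) (w : vfield R m).

Definition gtilde : vfield R m :=
  fun p => (\matrix_(i, j) pipe S i j p.1 p.2, \row_i inflow S i p.1).

Definition Omega : set (vfield R m) := hull gtilde.

Definition closed_system :=
  (forall i t, inflow S i t = 0) /\ (forall j t v, pipe S ord0 j t v = 0).

Definition dpipe (i : 'I_m.+1) (j : 'I_m) (t v : R) : R := derive1 (pipe S i j t) v.

Definition cinf (i : 'I_m.+1) (j : 'I_m) : \bar R :=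
  ereal_inf (range (fun p : R * R => (dpipe i j p.1 p.2)%:E)).

Definition dsup (i : 'I_m.+1) (j : 'I_m) : \bar R :=
  ereal_sup (range (fun p : R * R => (dpipe i j p.1 p.2)%:E)).

Definition D x : 'rV[R]_m :=
  \row_i (x (clamp 0) ord0 i
          - \sum_j \int[nu S i j]_(s in neg R) x (clamp s) ord0 j).

Definition leD x y :=
  forall (s : past R) i, D (shift_hist x s) ord0 i <= D (shift_hist y s) ord0 i.

Definition ltD x y := leD x y /\ x <> y.

Definition BUD : set (hist R m) :=
  [set x | BU x /\ forall (s : past R) i, 0 <= D (shift_hist x s) ord0 i].

(* g_ij(w, v) *)
Definition g (i : 'I_m.+1) (j : 'I_m) w (v : R) : R := (w (0, v)).1 i j.

(* I_i(w) = g_i0(w, v), which does not depend on v for w in the hull *)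
Definition inflow_at (i : 'I_m) w : R := (w (0, 0)).2 ord0 i.

Definition F w x : 'rV[R]_m :=
  \row_i (- g ord0 i w (x (clamp 0) ord0 i)
          - \sum_j g (cpt j) i w (x (clamp 0) ord0 i)
          + \sum_j \int[mu S i j]_(s in neg R)
                     g (cpt i) j (translate s w) (x (clamp s) ord0 j)
          + inflow_at i w).

Definition F_regular :=
  [/\ {within Omega `*` [set x : {uniform past R -> 'rV[R]_m} | BU x],
         continuous (fun p : vfield R m * {uniform past R -> 'rV[R]_m} =>
                       F p.1 p.2)},
      forall w0 x0, Omega w0 -> BU x0 -> exists L d : R, 0 < d /\
        \forall w \near within Omega (nbhs w0), forall x y, BU x -> BU y ->
          sup_norm (fun s => x s - x0 s) <= d ->
          sup_norm (fun s => y s - x0 s) <= d ->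
          `|F w x - F w y| <= L * sup_norm (fun s => x s - y s),
      forall r : R, exists C : R,
        forall w x, Omega w -> BU_ball r x -> `|F w x| <= C &
      forall r : R, {within Omega `*` BU_ball r,
         continuous (fun p : vfield R m * hist R m => F p.1 p.2)}].

(* z : R -> R^m is the solution on [0, +oo) of d/dt D z_t = F(w.t, z_t) with
   z_0 = x; at t = 0 the derivative is the right one. *)
Definition is_solution w x (z : R -> 'rV[R]_m) :=
  [/\ continuous z, seg z 0 = x &
      forall t : R, 0 <= t ->
        h^-1 *: (D (seg z (t + h)) - D (seg z t))
          @[h --> within [set h | 0 <= t + h] (0 : R)^'] -->
        F (translate t w) (seg z t)].

(* the graph of tau(t, ., .) *)
Definition tau (t : R) (p q : vfield R m * hist R m) :=
  exists2 z, is_solution p.1 p.2 z & q = (translate t p.1, seg z t).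

Definition positively_invariant (K : set (vfield R m * hist R m)) :=
  forall p t, K p -> 0 <= t ->
    (exists q, tau t p q) /\ (forall q, tau t p q -> K q).

Definition minimal (K : set (vfield R m * hist R m)) :=
  [/\ K `<=` Omega `*` @BU R m, K !=set0, compact K, positively_invariant K &
      forall K', K' `<=` K -> K' !=set0 -> compact K' ->
                 positively_invariant K' -> K' = K].

Definition graph (x : vfield R m -> hist R m) : set (vfield R m * hist R m) :=
  [set p | Omega p.1 /\ p.2 = x p.1].

Definition ltK (K1 K2 : set (vfield R m * hist R m)) :=
  exists x y : vfield R m -> hist R m, [/\ K1 = graph x, K2 = graph y &
                  forall w, Omega w -> ltD (x w) (y w)].

Definition M w x : R :=
  \sum_i D x ord0 i
  + \sum_i \sum_j \int[mu S j i]_(s in neg R)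
      (\int[lebesgue_measure]_(r in `[s, 0])
         g (cpt j) i (translate r w) (x (clamp r) ord0 i)).

Definition C1 :=
  [/\ C1_admissible gtilde,
      forall i j t, {homo pipe S i j t : v v' / v <= v'} &
      forall i j t, pipe S i j t 0 = 0].

Definition C2 := recurrent gtilde.

Definition C3 := forall i j,
  mu S i j (neg R) = 1%E /\
  (\int[mu S i j]_(s in neg R) `|s|%:E < +oo)%E.

Definition C4 :=
  (forall i j, nu S i j [set 0] = 0%E) /\
  (forall i, (\sum_j nu S i j (neg R) < 1)%E).

(* In \bar R with 0 * +oo = 0: a nonzero nu_ij forces the d_ki to be finite. *)
Definition C5 := forall i j (A : set R), measurable A -> A `<=` neg R ->
  (0 <= cinf (cpt i) j * mu S i j A - \sum_k dsup k i * nu S i j A)%E.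

Definition C6star := forall i j,
  (forall t v : R, 0 <= v -> pipe S i j t v = 0) \/
  (forall v : R, 0 <= v -> exists2 d : R, 0 < d & forall t, d <= dpipe i j t v).

Definition C7 := forall x y : vfield R m -> hist R m,
  minimal (graph x) -> minimal (graph y) ->
  graph x `<=` Omega `*` BUD -> graph y `<=` Omega `*` BUD ->
  (forall w, Omega w -> leD (x w) (y w)) ->
  (exists w0 i, Omega w0 /\ D (x w0) ord0 i = D (y w0) ord0 i) ->
  forall w, Omega w -> x w = y w.

End System.

(* Main.v *)
Require Import Defs.
From HB Require Import structures.
From mathcomp Require Import all_boot all_order all_algebra.
From mathcomp Require Import all_classical all_reals all_analysis.
From mathcomp Require Import measurable_realfun ring lra.

Set Implicit Arguments.
Unset Strict Implicit.
Unset Printing Implicit Defensive.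

Import Order.TTheory GRing.Theory Num.Theory numFieldNormedType.Exports.

Local Open Scope classical_set_scope.
Local Open Scope ring_scope.

(** The total mass [M] is conserved, because in a closed system whatever leaves a
    compartment enters a pipe and whatever leaves a pipe enters a compartment,
    and [M] is monotone for the order of [D]. The field is quasi-monotone for
    this order: at equal values of [D], a larger history increases the outflow of
    a compartment only through the neutral delays, and (C5) dominates this by the
    increase of the inflow ([quasi_monotone]). The rest follows from these facts
    and compactness.

    Comparison ([comparison]): the join, for the order of [D], of two solutions
    is a subsolution, that is, each of its coordinates is touched from below by a
    solution ([touched]). Its mass cannot increase. If one solution lies below
    another one at the start, the mass of their join exceeds that of the upper
    one by 0 initially, hence never by more; so the join is the upper solution.
    Uniqueness follows. The same argument shows that a subsolution of constant
    mass is a solution ([touched_solves]).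

    Structure: a minimal set [K] consists of entire orbits ([minimal_entire]).
    For a compact family of entire orbits over the hull, let the roof be the
    history whose [D]-values are the highest ones on each fibre. It is touched by
    solutions, so its mass decreases along the flow; the superlevel sets of this
    mass are closed, because the highest values are upper semicontinuous, and
    invariant in backward time, so that in a minimal hull they are empty or
    everything. Hence the mass of the roof is constant, the roof consists of solutions,
    and its graph is minimal ([roof_minimal]). If the family is itself a minimal
    set, then the points at which a given coordinate is highest are preserved in
    backward time, as a gap between ordered solutions never closes
    ([separation]); minimality makes them all of [K], and [K] is the graph of its
    roof ([minimal_roof]).

    Order: the roof of the union of two minimal sets is their join among minimal
    sets ([graph_sup]), and in each coordinate of [D] it agrees with one of the
    two. By (C7) it coincides with this one. Comparing masses yields the order
    ([minimal_ordered]), uniqueness, and, for the zero solution and a minimal set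
    of positive mass, positivity ([minimal_positive]).

    Existence: the nonnegative histories of mass [c] with Lipschitz [D]-values
    form a compact set. Solutions that start there exist for all positive times,
    as limits of Euler polygons for the field clipped to bounded [D]-values: the
    clipping is never active, because zero is a barrier by quasi-monotonicity and
    because the mass bounds nonnegative solutions ([global_solution]). So this
    set is positively invariant, and Zorn's lemma gives a minimal set in it
    ([minimal_exists]). *)

(** * Real functions and integrals over the past *)

Section RealLine.
Variable R : realType.

Lemma max_gap (u v a : R) : u <= v -> 0 <= a -> `|v - Num.max u (v - a)| <= a.
Proof. by move=> uv a0; case: (leP u (v - a)) => h; rewrite ger0_norm; lra. Qed.

Lemma max_dist (p q p' q' k : R) : `|p - p'| <= k -> `|q - q'| <= k ->
  `|Num.max p q - Num.max p' q'| <= k.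
Proof.
rewrite !ler_norml => /andP[? ?] /andP[? ?].
by case: (leP p q); case: (leP p' q') => ? ?; apply/andP; split; lra.
Qed.

Lemma dist3 (x1 x2 x3 x4 g k e : R) : `|x1 - x2 - g| <= k -> `|x1 - x3| <= e / 2 -> `|x2 - x4| <= e / 2 ->
  `|x3 - x4 - g| <= k + e.
Proof. by rewrite !ler_norml => /andP[? ?] /andP[? ?] /andP[? ?]; apply/andP; split; lra. Qed.

Lemma mul_divS_le (a e : R) : 0 <= a -> 0 <= e -> a * (e / (a + 1)) <= e.
Proof.
move=> a0 e0; rewrite mulrCA ler_piMr// ler_pdivrMr; last by rewrite ltr_wpDl.
by rewrite mul1r lerDl.
Qed.

Implicit Types (f : R -> R) (t u e eta d : R).

Lemma cont_epsP (T : normedModType R) (f : R -> T) t :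
  {for t, continuous f} <->
  forall e, 0 < e -> exists2 d, 0 < d & forall u, `|u - t| < d -> `|f u - f t| < e.
Proof.
split=> [cf e e0|H].
  have /cvgrPdist_lt/(_ e e0) := cf.
  move=> /nbhs_ballP[d /= d0 dP]; exists d => // u ud.
  by rewrite distrC; apply: dP; rewrite /ball /= distrC.
apply/cvgrPdist_lt => e /H[d d0 dP]; apply/nbhs_ballP; exists d => //= u.
by rewrite /ball /= => ut; rewrite distrC; apply: dP; rewrite distrC.
Qed.

(** Only the left difference quotients are controlled, so the argument runs
    leftwards from [b]: the set of points from which the bound with slack [eta]
    already holds is closed and can always be extended to the left. *)
Lemma dini_le f a b : a <= b -> continuous f ->
  (forall t, a < t <= b -> forall eta, 0 < eta -> exists2 d, 0 < d &
     forall e, 0 < e -> e < d -> f t - f (t - e) <= eta * e) ->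
  f b <= f a.
Proof.
move=> ab cf H; apply/ler_addgt0Pr => eta' eta'0.
have [eta eta0 etaP] : exists2 eta, 0 < eta & eta * (b - a) <= eta'.
  exists (eta' / (b - a + 1)); first by rewrite divr_gt0//; lra.
  by rewrite -mulrA ger_pMr// mulrC ler_pdivrMr; lra.
pose A := [set t | a <= t <= b /\ f b <= f t + eta * (b - t)].
have Ab : A b by split; [lra|rewrite subrr; lra].
have Alb : has_inf A by split; [exists b|exists a => t [/andP[]]].
set c := inf A.
have ac : a <= c by apply: lb_le_inf; [exists b|move=> t [/andP[]]].
have cb : c <= b by apply: ge_inf => //; case: Alb.
have Ac : f b <= f c + eta * (b - c).
  apply/ler_addgt0Pr => e e0.
  have e40 : 0 < e / 2 by lra.
  have [d d0 dP] := (cont_epsP f c).1 (cf c) _ e40.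
  have dd0 : 0 < Num.min d (e / (2 * eta)).
    by rewrite lt_min d0 divr_gt0// mulr_gt0//; lra.
  have [t [tab tP] tc] := inf_adherent dd0 Alb.
  have ct : c <= t by apply: ge_inf => //; case: Alb.
  move: tc; rewrite -/c -ltrBlDl lt_min => /andP[tcd tce].
  have := dP t; rewrite ger0_norm ?subr_ge0// => /(_ tcd).
  rewrite ltr_norml => /andP[_ h].
  have : eta * (b - t) <= eta * (b - c) by rewrite ler_pM2l//; lra.
  lra.
have [ca|ac'] := leP c a.
  have -> : a = c by apply/eqP; rewrite eq_le ac.
  by apply: (le_trans Ac); rewrite lerD2l; apply: le_trans etaP; rewrite ler_pM2l//; lra.
have [//|d d0 dP] := H c _ eta eta0; first by rewrite ac' cb.
pose e := Num.min (d / 2) (c - a).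
have e0 : 0 < e by rewrite /e lt_min; apply/andP; split; lra.
have ed : e < d by rewrite /e gt_min; apply/orP; left; lra.
have ea : e <= c - a by rewrite /e ge_min lexx orbT.
have := dP e e0 ed => h.
suff : A (c - e) by move=> /(ge_inf Alb.2); rewrite -/c; lra.
split; first by lra.
rewrite (_ : b - (c - e) = (b - c) + e); last by ring.
by rewrite mulrDr; lra.
Qed.

Lemma dini_ge f a b : a <= b -> continuous f ->
  (forall t, a < t <= b -> forall eta, 0 < eta -> exists2 d, 0 < d &
     forall e, 0 < e -> e < d -> f (t - e) - f t <= eta * e) ->
  f a <= f b.
Proof.
move=> ab cf H; rewrite -lerN2; apply: (@dini_le (fun t => - f t)) => //.
  by move=> t; apply: cvgN; exact: cf.
move=> t tab eta /(H _ tab)[d d0 dP]; exists d => // e e0 ed.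
by have := dP e e0 ed; lra.
Qed.

Lemma first_zero (a : R -> R) t0 t1 : continuous a -> (forall t, 0 <= a t) -> t0 <= t1 -> 0 < a t0 -> a t1 = 0 ->
  exists c, [/\ t0 < c, c <= t1, a c = 0 & forall t, t0 <= t -> t < c -> 0 < a t].
Proof.
move=> ca a0 t01 at0 at1.
pose A := [set t | t0 <= t <= t1 /\ a t <= 0].
have A1 : A t1 by split; [rewrite t01 lexx|rewrite at1].
have Alb : has_inf A by split; [exists t1|exists t0 => t [/andP[]]].
set c := inf A.
have c0 : t0 <= c by apply: lb_le_inf; [exists t1|move=> t [/andP[]]].
have c1 : c <= t1 by apply: ge_inf => //; case: Alb.
have ac : a c = 0.
  apply/eqP; rewrite eq_le a0 andbT; apply/ler_addgt0Pr => e e0; rewrite add0r.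
  have [d d0 dP] := (cont_epsP a c).1 (ca c) e e0.
  have [t [tab tP] tc] := inf_adherent d0 Alb.
  have ct : c <= t by apply: ge_inf; [case: Alb|split].
  have /dP : `|t - c| < d by rewrite ger0_norm ?subr_ge0// ltrBlDl.
  by rewrite ltr_distl => /andP[h1 _]; apply: ltW; rewrite -subr_lt0 (lt_le_trans h1).
exists c; split=> //.
  rewrite lt_neqAle c0 andbT; apply/eqP => E; by move: at0; rewrite E ac ltxx.
move=> t t0t tc; rewrite ltNge; apply/negP => at_.
have ct : c <= t by apply: ge_inf; [case: Alb|split=> //; rewrite t0t ltW// (lt_le_trans tc)].
by move: (le_lt_trans ct tc); rewrite ltxx.
Qed.

(** A gap that shrinks at most in proportion to itself does not close: on a
    short interval before [c], the loss after the maximum is at most [K] times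
    that maximum times the length, hence less than the maximum. *)
Lemma gap_persists (a : R -> R) t0 c (K d : R) : continuous a -> 0 <= K -> 0 < d -> t0 < c -> 0 <= a c ->
  (forall t, t0 <= t -> t < c -> 0 < a t) ->
  (forall t, t0 < t -> t <= c -> `|t - c| < d -> forall eta, 0 < eta -> exists2 e, 0 < e &
     forall k, 0 < k -> k < e -> a (t - k) - a t <= K * a t * k + eta * k) -> 0 < a c.
Proof.
move=> ca K0 d0 t0c ac0 pos slope.
pose ep := Num.min d (Num.min (c - t0) (1 / (K + 1))).
have ep0 : 0 < ep by rewrite /ep !lt_min d0 subr_gt0 t0c divr_gt0//; lra.
have [epd ept epK] : [/\ ep <= d, ep <= c - t0 & ep <= 1 / (K + 1)].
  by split; rewrite /ep !ge_min lexx ?orbT.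
pose s0 := c - ep / 2.
have s0c : s0 < c by rewrite /s0; lra.
have s0t : t0 <= s0 by rewrite /s0; lra.
have [s1] := @EVT_max R a s0 c (ltW s0c) (continuous_subspaceT ca).
rewrite in_itv /= => /andP[s01 s1c] amax.
have A0 : 0 < a s1.
  by apply: lt_le_trans (amax s0 _); [exact: pos|rewrite in_itv /= lexx ltW].
have : a s1 + K * a s1 * s1 <= a c + K * a s1 * c.
  apply: (@dini_ge (fun t => a t + K * a s1 * t)) => //.
    move=> u; apply: cvgD; first exact: ca.
    by apply: cvgM; [exact: cvg_cst|exact: cvg_id].
  move=> t /andP[s1t tc] eta eta0.
  have td : `|t - c| < d by rewrite ler0_norm ?subr_le0// opprB; move: s01; rewrite /s0; lra.
  have [e e0 eP] := slope t (le_lt_trans s0t (le_lt_trans s01 s1t)) tc td eta eta0.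
  exists e => // k k0 ke; have := eP k k0 ke.
  have amt : a t <= a s1 by apply: amax; rewrite in_itv /= tc andbT; lra.
  have : K * a t * k <= K * a s1 * k by rewrite ler_wpM2r ?(ltW k0)// ler_wpM2l.
  by rewrite mulrBr; lra.
have h1 : K * (c - s1) < 1.
  have : c - s1 <= 1 / (K + 1) by move: s01; rewrite /s0; lra.
  move=> /(ler_wpM2l K0)/le_lt_trans; apply.
  by rewrite mulrA mulr1 ltr_pdivrMr; lra.
have : K * a s1 * (c - s1) < a s1 by rewrite mulrAC gtr_pMl.
by rewrite mulrBr; lra.
Qed.

End RealLine.

Lemma cont_ballP (R : realType) (X : pseudoMetricType R) (V : normedModType R) (f : X -> V) :
  continuous f <-> forall x (e : R), 0 < e -> exists2 d : R, 0 < d & forall y, ball x d y -> `|f x - f y| < e.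
Proof.
split=> [cf x e e0|H x].
  by have /cvgrPdist_lt/(_ _ e0)/nbhs_ballP[d /= d0 dP] := cf x; exists d.
by apply/cvgrPdist_lt => e /(H x)[d d0 dP]; apply/nbhs_ballP; exists d.
Qed.

Lemma common_radius (R : realType) (J : finType) (P : J -> R -> Prop) :
  (forall j d d', 0 < d' -> d' <= d -> P j d -> P j d') ->
  (forall j, exists2 d, 0 < d & P j d) -> exists2 d, 0 < d & forall j, P j d.
Proof.
move=> Pd H; pose f j := s2val (cid2 (H j)).
have f0 j : 0 < f j by rewrite /f; case: cid2.
have fP j : P j (f j) by rewrite /f; case: cid2.
exists (\big[Num.min/1]_j f j) => [|j]; first by apply: lt_bigmin.
by apply: (Pd _ (f j)) => //; [apply: lt_bigmin|exact: bigmin_le].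
Qed.

Lemma heine_cantor (R : realType) (X : pseudoMetricType R) (V : normedModType R)
    (f : X -> V) (K : set X) : compact K -> continuous f ->
  forall e : R, 0 < e -> exists2 d : R, 0 < d & forall x y, K x -> ball x d y ->
  `|f x - f y| < e.
Proof.
move=> /compact_near_coveringP cK cf e e0.
have := cK R (0^'+)%R (fun d x => forall y, ball x d y -> `|f x - f y| < e) _.
case=> [x Kx|d /= d0 dP].
  have e20 : 0 < e / 2 by lra.
  have /cvgrPdist_lt/(_ _ e20)/nbhs_ballP[d /= d0 dP] := cf x.
  exists (ball x (d / 2), [set r | r < d / 2]) => /=.
    split; first by apply: nbhsx_ballx; lra.
    by apply: nbhs_right_lt; lra.
  case=> x' r /= [xx' rd] y x'y.
  have h1 := dP x' (le_ball _ xx'); have h2 := dP y (ball_splitr _ _).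
  have {h1} : `|f x - f x'| < e / 2 by apply: h1; lra.
  have {h2} : `|f x - f y| < e / 2.
    apply: dP; rewrite (_ : d = d / 2 + d / 2); last by field.
    by apply: (ball_triangle xx'); apply: le_ball x'y; lra.
  move=> h2 h1.
  rewrite (_ : f x' - f y = (f x - f y) - (f x - f x')); last by rewrite opprB [RHS]addrC addrA subrK.
  by rewrite (le_lt_trans (ler_normB _ _))//; lra.
exists (d / 2) => [|x y Kx xy]; first by lra.
by apply: (dP (d / 2)) => //=; [rewrite sub0r normrN ger0_norm; lra|lra].
Qed.

Section Integrals.
Variable R : realType.
Implicit Types (f g w : R -> R) (B : R).
Local Notation I := (neg R).

Definition bcont f B := continuous f /\ forall t, `|f t| <= B.

Lemma bcont_comp_min f B c : bcont f B -> bcont (fun t => f (Num.min t c)) B.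
Proof.
case=> cf bf; split=> // t; apply: (@continuous_comp _ _ _ (fun t => Num.min t c) f).
  by apply: continuous_min; [exact: cvg_id|exact: cvg_cst].
exact: cf.
Qed.

Lemma measurable_neg : measurable (I : set R).
Proof. exact: measurable_itv. Qed.
Hint Resolve measurable_neg : core.

Lemma in_negP (s : R) : I s = (s <= 0) :> Prop.
Proof. by rewrite /= in_itv. Qed.

Variable mu : {finite_measure set R -> \bar R}.

Lemma bcont_integrable (D : set R) f B : measurable D -> continuous f -> (forall t, D t -> `|f t| <= B) ->
  mu.-integrable D (EFin \o f).
Proof.
move=> mD cf bf; apply: measurable_bounded_integrable => //.
- by rewrite (le_lt_trans (le_measure mu _ _ (subsetT D))) ?inE//; exact: fin_num_fun_lty (fin_num_measure mu).
- by apply: measurable_funTS; exact: measurable_realfun.continuous_measurable_fun.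
- exists B; split; first exact: num_real.
  by move=> x Bx t Dt; apply: le_trans (bf _ Dt) (ltW Bx).
Qed.

Lemma neg_integrable f B : bcont f B -> mu.-integrable I (EFin \o f).
Proof. by case=> cf bf; apply: (@bcont_integrable _ _ B). Qed.

Definition mass := fine (mu I).

Lemma massE : mu I = mass%:E.
Proof. by rewrite /mass fineK// fin_num_measure. Qed.

Lemma mass_ge0 : 0 <= mass.
Proof. by rewrite fine_ge0. Qed.

Lemma le_int f g B : bcont f B -> bcont g B -> (forall s, s <= 0 -> f s <= g s) ->
  \int[mu]_(s in I) f s <= \int[mu]_(s in I) g s.
Proof.
move=> bf bg fg; have jf := neg_integrable bf; have jg := neg_integrable bg.
by apply: le_Rintegral => // s; rewrite in_negP; exact: fg.
Qed.

Lemma neg_integrableZ (f : R -> R) (k : R) : mu.-integrable I (EFin \o f) ->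
  mu.-integrable I (EFin \o (fun s => k * f s)).
Proof. by move=> jf; exact: (@integrableZl _ _ _ mu I measurable_neg k _ jf). Qed.

Lemma neg_integrableB (f g : R -> R) : mu.-integrable I (EFin \o f) ->
  mu.-integrable I (EFin \o g) -> mu.-integrable I (EFin \o (fun s => f s - g s)).
Proof. by move=> jf jg; exact: (integrableB measurable_neg jf jg). Qed.

Lemma int_cst c : \int[mu]_(s in I) c = c * mass.
Proof. exact: Rintegral_cst. Qed.

Lemma int_le_cst f B c : bcont f B -> (forall s, s <= 0 -> f s <= c) ->
  \int[mu]_(s in I) f s <= c * mass.
Proof.
move=> bf fc; rewrite -int_cst; apply: (@le_int f (fun=> c) (Num.max B `|c|)) => //.
  by case: bf => cf bf; split=> // t; rewrite le_max bf.
by split=> [t|t]; [exact: cvg_cst|rewrite le_max lexx orbT].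
Qed.

(** Dominated convergence: the tails of an integrable weight carry little mass. *)
Lemma int_tail w : mu.-integrable I (EFin \o w) -> (forall s, s <= 0 -> 0 <= w s) ->
  forall e, 0 < e -> exists2 T, 0 < T &
   \int[mu]_(s in I) (w s * (s < - T)%R%:R) <= e.
Proof.
move=> iw w0 e e0.
pose fn n (s : R) : \bar R := (w s * (s < - n%:R)%R%:R)%:E.
have mw : measurable_fun I w by apply/measurable_EFinP; exact: measurable_int iw.
have mfn n : measurable_fun I (fn n).
  apply/measurable_EFinP; apply: measurable_funM => //.
  apply: measurableT_comp => //; apply: measurable_funTS.
  exact: measurable_fun_ltr.
have := @dominated_convergence _ _ _ mu I measurable_neg fn (cst 0%E) (EFin \o w) mfn.
case=> //.
- apply: aeW => s; rewrite in_negP => s0; apply: cvg_near_cst.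
  near=> n; rewrite /fn; suff -> : (s < - n%:R) = false by rewrite mulr0.
  apply/negbTE; rewrite -leNgt lerNl; apply: ltW; near: n; exact: nbhs_infty_gtr.
- apply: aeW => s n; rewrite in_negP => s0; rewrite /fn /= lee_fin.
  by case: (s < _); rewrite ?mulr1 ?mulr0 ger0_norm ?w0.
move=> _ _; rewrite integral0 => /fine_cvg.
move=> /cvgrPdist_le/(_ e e0) [n _ nP].
exists n.+1%:R => //; have := nP n.+1 (leqnSn n); rewrite sub0r normrN => h.
by apply: le_trans h; rewrite ler_norm.
Unshelve. all: by end_near.
Qed.

(** The weight makes the estimate uniform in [f], which is what continuity for
    the compact-open topology on bounded sets needs. *)
Lemma int_tight w : mu.-integrable I (EFin \o w) -> (forall s, s <= 0 -> 0 <= w s) ->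
  forall e, 0 < e -> exists2 T, 0 < T & forall f (C d : R), 0 <= C -> 0 <= d ->
   mu.-integrable I (EFin \o f) ->
   (forall s, s <= 0 -> `|f s| <= C * w s) ->
   (forall s, - T <= s -> s <= 0 -> `|f s| <= d * w s) ->
   `|\int[mu]_(s in I) f s| <= d * \int[mu]_(s in I) w s + C * e.
Proof.
move=> iw w0 e e0; have [T T0 TP] := int_tail iw w0 e0; exists T => // f C d C0 d0 jf fw fd.
have mw : measurable_fun I w by apply/measurable_EFinP; exact: measurable_int iw.
have it : mu.-integrable I (EFin \o (fun s => w s * (s < - T)%R%:R)).
  apply: (le_integrable _ _ _ iw) => //.
    apply/measurable_EFinP; apply: measurable_funM => //.
    apply: measurableT_comp => //; apply: measurable_funTS.
    exact: measurable_fun_ltr.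
  move=> s; rewrite in_negP => s0 /=; rewrite lee_fin normrM ger0_norm ?w0// ler_piMr ?w0//.
  by case: (s < _); rewrite ?normr0 ?normr1.
have id : mu.-integrable I (EFin \o (fun s => d * w s)).
  exact: (@integrableZl _ _ _ mu I measurable_neg d _ iw).
have ic : mu.-integrable I (EFin \o (fun s => C * (w s * (s < - T)%R%:R))).
  exact: (@integrableZl _ _ _ mu I measurable_neg C _ it).
apply: le_trans (le_normr_Rintegral _ jf) _ => //.
apply: (@le_trans _ _ (\int[mu]_(s in I) (d * w s + C * (w s * (s < - T)%R%:R)))).
  apply: le_Rintegral => //.
  - exact: (integrable_abse jf).
  - exact: (integrableD measurable_neg id ic).
  move=> s; rewrite in_negP => s0; have [sT|Ts] := ltP s (- T).
    by rewrite mulr1; have := fw s s0; have := mulr_ge0 d0 (w0 s s0); lra.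
  by rewrite mulr0 mulr0 addr0 fd.
by rewrite RintegralD// RintegralZl// RintegralZl// lerD2l ler_wpM2l.
Qed.

End Integrals.

(** * Mass in a pipe *)

Section Primitive.
Variable R : realType.
Implicit Types (f : R -> R) (a b c t u s B e : R).
Local Notation leb := (@lebesgue_measure R).

Lemma itv_integrable f a b : continuous f -> leb.-integrable `[a, b] (EFin \o f).
Proof.
move=> cf; apply: continuous_compact_integrable; first exact: segment_compact.
exact: continuous_subspaceT.
Qed.

Lemma itv_int_cat f a b c : continuous f -> a <= b -> b <= c ->
  \int[leb]_(r in `[a, c]) f r = \int[leb]_(r in `[a, b]) f r + \int[leb]_(r in `[b, c]) f r.
Proof.
move=> cf ab bc.
have := @Rintegral_itvB R f (BLeft a) (BRight c) b (itv_integrable a c cf).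
rewrite !bnd_simp => /(_ ab bc).
rewrite Rintegral_itv_obnd_cbnd => [<-|]; first by lra.
by apply: integrableS (itv_integrable b c cf) => //; apply: subset_itvr; rewrite bnd_simp.
Qed.

Lemma itv_int_point f a : \int[leb]_(r in `[a, a]) f r = 0.
Proof. by rewrite set_itv1 Rintegral_set1. Qed.

Lemma itv_int_rev f a b : b < a -> \int[leb]_(r in `[a, b]) f r = 0.
Proof. by move=> ba; rewrite set_itv_ge ?Rintegral_set0// bnd_simp -ltNge. Qed.

Lemma itv_int_dist f a b c e : continuous f -> a <= b ->
  (forall t, a <= t <= b -> `|f t - c| <= e) ->
  `|\int[leb]_(r in `[a, b]) f r - c * (b - a)| <= e * (b - a).
Proof.
move=> cf ab fc.
have cstE k : \int[leb]_(r in `[a, b]) k = k * (b - a).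
  by rewrite Rintegral_cst//= lebesgue_measure_itv /= lte_fin; move: ab; rewrite le_eqVlt => /orP[/eqP->|->]; rewrite ?ltxx ?subrr.
have ic k : leb.-integrable `[a, b] (EFin \o (fun=> k : R)) by apply: itv_integrable => ?; exact: cvg_cst.
have iF := itv_integrable a b cf.
rewrite -cstE -RintegralB//.
have iB : leb.-integrable `[a, b] (EFin \o (fun r => f r - c)).
  by apply: itv_integrable => r; apply: cvgB; [exact: cf|exact: cvg_cst].
apply: le_trans (le_normr_Rintegral _ iB) _ => //.
rewrite -(cstE e); apply: le_Rintegral => //; first exact: integrable_abse iB.
Qed.

(** One of the two integrals is over an empty or a one-point interval. *)
Definition prim f u := \int[leb]_(r in `[0, u]) f r - \int[leb]_(r in `[u, 0]) f r.

Lemma primB f a b : continuous f -> a <= b ->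
  \int[leb]_(r in `[a, b]) f r = prim f b - prim f a.
Proof.
move=> cf ab; rewrite /prim.
have pos u : 0 <= u -> \int[leb]_(r in `[u, 0]) f r = 0.
  by rewrite le_eqVlt => /orP[/eqP<-|/itv_int_rev->//]; rewrite itv_int_point.
have ngt u : u <= 0 -> \int[leb]_(r in `[0, u]) f r = 0.
  by rewrite le_eqVlt => /orP[/eqP->|/itv_int_rev->//]; rewrite itv_int_point.
have [a0|a0] := leP 0 a.
  have b0 := le_trans a0 ab.
  by rewrite (pos _ a0) (pos _ b0) (itv_int_cat cf a0 ab); ring.
have [b0|b0] := leP 0 b.
  by rewrite (pos _ b0) (ngt _ (ltW a0)) (itv_int_cat cf (ltW a0) b0); ring.
by rewrite (ngt _ (ltW b0)) (ngt _ (ltW a0)) (itv_int_cat cf ab (ltW b0)); ring.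
Qed.

Lemma prim0 f : prim f 0 = 0.
Proof. by rewrite /prim itv_int_point subrr. Qed.

Lemma prim_dist f a b c e : continuous f ->
  (forall t, Num.min a b <= t <= Num.max a b -> `|f t - c| <= e) ->
  `|prim f b - prim f a - c * (b - a)| <= e * `|b - a|.
Proof.
move=> cf fc; have [ab|ba] := leP a b.
  rewrite -primB// (@ger0_norm _ (b - a)); last by lra.
  by apply: itv_int_dist => // t tab; apply: fc; rewrite min_l// max_r.
have ba' := ltW ba.
rewrite distrC (distrC b a) [X in `|X|](_ : _ = (prim f a - prim f b) - c * (a - b)); last by ring.
rewrite -primB// (@ger0_norm _ (a - b)); last by lra.
by apply: itv_int_dist => // t tab; apply: fc; rewrite min_r// max_l.
Qed.

Lemma prim_lip f B a b : bcont f B -> `|prim f b - prim f a| <= B * `|b - a|.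
Proof.
case=> cf bf; have := @prim_dist f a b 0 B cf; rewrite mul0r subr0; apply=> t _.
by rewrite subr0.
Qed.

Lemma prim_continuous f : continuous f -> continuous (prim f).
Proof.
move=> cf t; apply/cont_epsP => e e0.
have [d d0 dP] := (cont_epsP f t).1 (cf t) 1 ltr01.
pose B := `|f t| + 1.
have B0 : 0 < B by rewrite /B ltr_wpDl.
exists (Num.min d (e / B)) => [|u]; first by rewrite lt_min d0 divr_gt0.
rewrite lt_min => /andP[ud ue].
have := @prim_dist f t u 0 B cf; rewrite mul0r subr0 => h.
apply: le_lt_trans (h _) _.
  move=> r /andP[r1 r2]; rewrite subr0 /B -lerBlDl.
  apply: le_trans (ltW (dP r _)); first exact: lerB_dist.
  by move: r1 r2 ud; case: (leP t u) => tu; rewrite ?ltr_norml => ? ? /andP[? ?]; apply/andP; split; lra.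
by rewrite mulrC -ltr_pdivlMr.
Qed.

Lemma prim_shift f t s : continuous f -> prim (fun r => f (t + r)) s = prim f (t + s) - prim f t.
Proof.
move=> cf.
have cft : continuous (fun r => f (t + r)).
  move=> r; apply: (@continuous_comp _ _ _ (fun r => t + r) f); last exact: cf.
  by apply: cvgD; [exact: cvg_cst|exact: cvg_id].
pose h r := prim (fun r => f (t + r)) r - prim f (t + r).
have ch : continuous h.
  move=> r; apply: cvgB; first exact: prim_continuous.
  apply: (@continuous_comp _ _ _ (fun r => t + r) (prim f)); last exact: prim_continuous.
  by apply: cvgD; [exact: cvg_cst|exact: cvg_id].
have slope r eta : 0 < eta -> exists2 d, 0 < d & forall e, 0 < e -> e < d -> `|h r - h (r - e)| <= eta * e.
  move=> eta0; have eta20 : 0 < eta / 2 by lra.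
  have [d d0 dP] := (cont_epsP f (t + r)).1 (cf _) _ eta20.
  exists d => // e e0 ed.
  have := @prim_dist (fun r => f (t + r)) (r - e) r (f (t + r)) (eta / 2) cft.
  have := @prim_dist f (t + (r - e)) (t + r) (f (t + r)) (eta / 2) cf.
  rewrite (_ : t + r - (t + (r - e)) = e); last by ring.
  rewrite (_ : r - (r - e) = e); last by ring.
  rewrite (min_l (_ : _ <= _)) ?(max_r (_ : _ <= _)) ?(gtr0_norm e0); try lra; move=> h1.
  rewrite (min_l (_ : _ <= _)) ?(max_r (_ : _ <= _)); try lra; move=> h2.
  have h1' : `|prim f (t + r) - prim f (t + (r - e)) - f (t + r) * e| <= eta / 2 * e.
    apply: h1 => v /andP[v1 v2]; apply: ltW; apply: dP; rewrite ltr_norml; apply/andP; split; lra.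
  have h2' : `|prim (fun r => f (t + r)) r - prim (fun r => f (t + r)) (r - e) - f (t + r) * e| <= eta / 2 * e.
    apply: h2 => v /andP[v1 v2]; apply: ltW; apply: dP; rewrite ltr_norml; apply/andP; split; lra.
  rewrite /h; move: h1' h2'; rewrite !ler_norml => /andP[? ?] /andP[? ?]; apply/andP; split; lra.
have hc a b : a <= b -> h a = h b.
  move=> ab; apply/eqP; rewrite eq_le; apply/andP; split.
    apply: dini_ge => // r _ eta /(slope r)[d d0 dP]; exists d => // e e0 ed.
    by have := dP e e0 ed; rewrite ler_norml => /andP[]; lra.
  apply: dini_le => // r _ eta /(slope r)[d d0 dP]; exists d => // e e0 ed.
  by have := dP e e0 ed; rewrite ler_norml => /andP[]; lra.
have : h s = h 0 by case: (leP s 0) => [/hc//|/ltW/hc].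
by rewrite /h prim0 addr0; lra.
Qed.

End Primitive.

Section Delay.
Variables (R : realType) (mu : {finite_measure set R -> \bar R}).
Implicit Types (f : R -> R) (t h s B e d : R).
Local Notation I := (neg R).
Local Notation leb := (@lebesgue_measure R).
Hint Resolve measurable_neg : core.

Lemma continuous_shiftl (T : topologicalType) (f : R -> T) t : continuous f -> continuous (fun s => f (t + s)).
Proof.
move=> cf r; apply: (@continuous_comp _ _ _ (fun r => t + r) f); last exact: cf.
by apply: cvgD; [exact: cvg_cst|exact: cvg_id].
Qed.

Lemma bcont_shift f B t : bcont f B -> bcont (fun s => f (t + s)) B.
Proof. by case=> cf bf; split=> //; exact: continuous_shiftl. Qed.

Lemma int_small e : 0 < e -> exists2 T, 0 < T & forall f (C d : R), 0 <= C -> 0 <= d ->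
   bcont f C -> (forall s, - T <= s -> s <= 0 -> `|f s| <= d) ->
   `|\int[mu]_(s in I) f s| <= d * mass mu + C * e.
Proof.
move=> e0.
have i1 : mu.-integrable I (EFin \o (fun=> 1 : R)).
  by apply: (@neg_integrable _ _ _ 1); split=> [?|?]; [exact: cvg_cst|rewrite normr1].
have [//|T T0 TP] := int_tight i1 _ e0; exists T => // f C d C0 d0 bf fd.
have := TP f C d C0 d0 (neg_integrable mu bf); rewrite int_cst mul1r; apply.
- by move=> s _; rewrite mulr1; case: bf.
- by move=> s s1 s2; rewrite mulr1 fd.
Qed.

(** Uniform continuity on a compact window controls the recent part, and the
    small measure of the remote past controls the rest. *)
Lemma int_shift_continuous f B : bcont f B -> continuous (fun t => \int[mu]_(s in I) f (t + s)).
Proof.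
move=> bf t; apply/cont_epsP => e e0; have [cf lf] := bf.
have B0 : 0 <= B by apply: le_trans (lf 0).
have k0 : 0 < e / 2 / (2 * B + 1) by rewrite divr_gt0//; lra.
have [T T0 TP] := int_small k0.
have m0 := mass_ge0 mu.
have l0 : 0 < e / 4 / (mass mu + 1) by rewrite divr_gt0//; lra.
have [d d0 dP] := heine_cantor (@segment_compact R (t - T) t) cf l0.
exists d => // u ud.
rewrite -RintegralB//; try by apply: (@neg_integrable _ _ _ B); exact: bcont_shift.
apply: le_lt_trans (TP _ (2 * B) (e / 4 / (mass mu + 1)) _ _ _ _) _; first by lra.
- exact: ltW.
- split=> [s|s]; first by apply: cvgB; exact: (continuous_shiftl cf).
  by apply: le_trans (ler_normB _ _) _; have := lf (u + s); have := lf (t + s); lra.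
- move=> s s1 s2; apply: ltW; rewrite distrC; apply: dP; first by rewrite /= in_itv /=; apply/andP; split; lra.
  rewrite /ball /=; rewrite (_ : t + s - (u + s) = t - u); last by ring.
  by rewrite distrC.
have : e / 4 / (mass mu + 1) * mass mu <= e / 4.
  by rewrite mulrC; apply: mul_divS_le; lra.
have : 2 * B * (e / 2 / (2 * B + 1)) <= e / 2.
  by apply: mul_divS_le; lra.
by lra.
Qed.

(** The material in a pipe with inflow [f] and transit times [- s] of law [mu]:
    what entered during the last [- s] units of time is still inside. *)
Definition pipe_mass f t := \int[mu]_(s in I) (\int[leb]_(r in `[s, 0]) f (t + r)).

Lemma pipe_massE f t : continuous f -> pipe_mass f t = \int[mu]_(s in I) (prim f t - prim f (t + s)).
Proof.
move=> cf; apply: eq_Rintegral => s; rewrite inE in_negP => s0.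
by rewrite primB//; [rewrite prim_shift// prim_shift// addr0; ring|exact: continuous_shiftl].
Qed.

Lemma continuous_primB f t : continuous f -> continuous (fun s => prim f t - prim f (t + s)).
Proof.
move=> cf s; apply: cvgB; first exact: cvg_cst.
exact: (continuous_shiftl (prim_continuous cf)).
Qed.

Hypothesis mass1 : mu I = 1%E.
Hypothesis moment : (\int[mu]_(s in I) `|s|%:E < +oo)%E.

Lemma abs_integrable : mu.-integrable I (EFin \o (fun s : R => `|s|)).
Proof.
apply/integrableP; split.
  by apply/measurable_EFinP; apply: measurable_funTS; exact: measurableT_comp.
rewrite (eq_integral (fun s : R => `|s|%:E)) // => s _ /=; by rewrite normr_id.
Qed.

Lemma massE1 : mass mu = 1.
Proof. by rewrite /mass mass1. Qed.

Lemma lip_integrable (q : R -> R) B : continuous q -> (forall s, s <= 0 -> `|q s| <= B * `|s|) ->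
  mu.-integrable I (EFin \o q).
Proof.
move=> cq bq.
have iB : mu.-integrable I (EFin \o (fun s : R => B * `|s|)).
  exact: neg_integrableZ abs_integrable.
apply: (le_integrable _ _ _ iB) => //.
  by apply/measurable_EFinP; apply: measurable_funTS; exact: continuous_measurable_fun.
by move=> s; rewrite in_negP => s0 /=; rewrite lee_fin; apply: le_trans (bq s s0) (ler_norm _).
Qed.

Lemma primB_le f B t s : bcont f B -> s <= 0 -> `|prim f t - prim f (t + s)| <= B * `|s|.
Proof.
move=> bf s0; apply: le_trans (prim_lip _ _ bf) _.
by rewrite (_ : t - (t + s) = - s) ?normrN//; ring.
Qed.

Lemma le_pipe_mass f g B t : bcont f B -> bcont g B -> (forall r, r <= t -> f r <= g r) ->
  pipe_mass f t <= pipe_mass g t.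
Proof.
move=> bf bg fg; have [cf _] := bf; have [cg _] := bg.
rewrite !pipe_massE//; apply: le_Rintegral => //.
- by apply: (@lip_integrable _ B); [exact: continuous_primB|move=> s; exact: primB_le].
- by apply: (@lip_integrable _ B); [exact: continuous_primB|move=> s; exact: primB_le].
move=> s; rewrite in_negP => s0; rewrite -!primB//; try lra.
apply: le_Rintegral => //; try exact: itv_integrable.
by move=> r /=; rewrite in_itv /= => /andP[_ ?]; exact: fg.
Qed.

(** The flow entering the pipe minus the delayed flow leaving it. *)
Lemma pipe_mass_slope f B t eta : bcont f B -> 0 < eta -> exists2 d, 0 < d & forall h, `|h| < d ->
  `|pipe_mass f (t + h) - pipe_mass f t - h * (f t - \int[mu]_(s in I) f (t + s))| <= eta * `|h|.
Proof.
move=> bf eta0; have [cf lf] := bf.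
have B0 : 0 <= B by apply: le_trans (lf 0).
have k0 : 0 < eta / 3 / (2 * B + 1) by rewrite divr_gt0//; lra.
have [T T0 TP] := int_small k0.
have l0 : 0 < eta / 3 by lra.
have [d d0 dP] := heine_cantor (@segment_compact R (t - T) t) cf l0.
exists d => // h hd.
pose q u := prim f (u + h) - prim f u - f u * h.
have qd u : t - T <= u <= t -> `|q u| <= eta / 3 * `|h|.
  move=> ut; have := @prim_dist R f u (u + h) (f u) (eta / 3) cf.
  rewrite (_ : u + h - u = h); last by ring.
  apply=> v uv; rewrite distrC; apply: ltW; apply: dP => //.
  rewrite /ball /=; apply: le_lt_trans hd.
  by move: uv; case: (leP u (u + h)) => uh /andP[? ?]; [rewrite distrC !ger0_norm; lra|rewrite ger0_norm ?ltr0_norm; lra].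
have qB u : `|q u| <= 2 * B * `|h|.
  have := @prim_dist R f u (u + h) (f u) (2 * B) cf.
  rewrite (_ : u + h - u = h); last by ring.
  by apply=> v _; apply: le_trans (ler_normB _ _) _; have := lf v; have := lf u; lra.
have cq : continuous q.
  move=> u; apply: cvgB; last by apply: cvgM; [exact: cf|exact: cvg_cst].
  apply: cvgB; last exact: prim_continuous.
  apply: (@continuous_comp _ _ _ (fun r => r + h) (prim f)); last exact: prim_continuous.
  by apply: cvgD; [exact: cvg_id|exact: cvg_cst].
have bq : bcont q (2 * B * `|h|) by split.
have -> : pipe_mass f (t + h) - pipe_mass f t - h * (f t - \int[mu]_(s in I) f (t + s)) =
    q t - \int[mu]_(s in I) q (t + s).
  rewrite !pipe_massE//.
  have iP u : mu.-integrable I (EFin \o (fun s => prim f u - prim f (u + s))).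
    by apply: (@lip_integrable _ B); [exact: continuous_primB|move=> s; exact: primB_le].
  have iF : mu.-integrable I (EFin \o (fun s => h * f (t + s))).
    exact: (neg_integrableZ h (neg_integrable mu (bcont_shift t bf))).
  have ic k : mu.-integrable I (EFin \o (fun=> k : R)).
    by apply: (@neg_integrable _ _ _ `|k|); split=> // ?; exact: cvg_cst.
  have iq : mu.-integrable I (EFin \o (fun s => q (t + s))) by exact: (neg_integrable mu (bcont_shift t bq)).
  have cE k : k = \int[mu]_(s in I) k by rewrite int_cst massE1 mulr1.
  rewrite mulrBr -RintegralZl//; last exact: (neg_integrable mu (bcont_shift t bf)).
  rewrite {1}(cE (h * f t)) {1}(cE (q t)) -!RintegralB//; last 2 first.
  - exact: neg_integrableB (iP (t + h)) (iP t).
  - exact: neg_integrableB (ic (h * f t)) iF.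
  by apply: eq_Rintegral => s _; rewrite /q (_ : t + s + h = t + h + s); ring.
apply: le_trans (ler_normB _ _) _.
have h1 : `|q t| <= eta / 3 * `|h| by apply: qd; apply/andP; split; lra.
have h0 : 0 <= eta / 3 * `|h| by apply: mulr_ge0 => //; lra.
have h2 : `|\int[mu]_(s in I) q (t + s)| <= eta / 3 * `|h| * mass mu + 2 * B * `|h| * (eta / 3 / (2 * B + 1)).
  apply: TP => //; first by rewrite mulr_ge0//; lra.
  - exact: bcont_shift.
  - by move=> s s1 s2; apply: qd; apply/andP; split; lra.
have : 2 * B * `|h| * (eta / 3 / (2 * B + 1)) <= eta / 3 * `|h|.
  rewrite (_ : 2 * B * `|h| * (eta / 3 / (2 * B + 1)) = eta / 3 * `|h| * (2 * B / (2 * B + 1))); last by field; lra.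
  by rewrite ler_piMr// ler_pdivrMr; lra.
move: h2; rewrite massE1 mulr1; move: h1 h0; set x := eta / 3 * `|h|.
have -> : eta * `|h| = 3 * x by rewrite /x; field.
by lra.
Qed.

(** The moment of order one makes the contribution of the remote past small,
    uniformly in the bound [B]: this is continuity of the delayed mass for the
    compact-open topology on bounded sets. *)
Lemma pipe_mass_small B e : 0 <= B -> 0 < e -> exists2 T, 0 < T & exists2 d, 0 < d &
  forall f g t, bcont f B -> bcont g B ->
   (forall r, t - T <= r -> r <= t -> `|f r - g r| <= d) ->
   `|pipe_mass f t - pipe_mass g t| <= e.
Proof.
move=> B0 e0.
have k0 : 0 < e / 2 / (2 * B + 1) by rewrite divr_gt0//; lra.
have [|T T0 TP] := int_tight abs_integrable _ k0; first by move=> s _; exact: normr_ge0.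
set W := \int[mu]_(s in I) `|s| in TP.
have W0 : 0 <= W by apply: Rintegral_ge0.
exists T => //; exists (e / 2 / (W + 1)); first by rewrite divr_gt0//; lra.
move=> f g t bf bg fg; have [cf lf] := bf; have [cg lg] := bg.
have iP k : bcont k B -> mu.-integrable I (EFin \o (fun s => prim k t - prim k (t + s))).
  move=> bk; apply: (@lip_integrable _ B); last by move=> s; exact: primB_le.
  by apply: continuous_primB; case: bk.
have iB := neg_integrableB (iP _ bf) (iP _ bg).
rewrite !pipe_massE// -RintegralB//; try exact: iP.
have d0 : 0 <= e / 2 / (W + 1) by rewrite ltW// divr_gt0//; lra.
apply: le_trans (TP _ (2 * B) (e / 2 / (W + 1)) _ d0 iB _ _) _; first by lra.
- move=> s s0; apply: le_trans (ler_normB _ _) _.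
  by have := primB_le t bf s0; have := primB_le t bg s0; lra.
- move=> s s1 s2.
  rewrite -!primB//; try lra.
  rewrite -RintegralB//; try exact: itv_integrable.
  have cB : continuous (fun r => f r - g r) by move=> r; apply: cvgB; [exact: cf|exact: cg].
  have := @itv_int_dist R _ (t + s) t 0 (e / 2 / (W + 1)) cB.
  rewrite mul0r subr0 (_ : t - (t + s) = `|s|); last by rewrite ler0_norm; lra.
  apply; first by lra.
  by move=> r /andP[r1 r2]; rewrite subr0; apply: fg; lra.
have : e / 2 / (W + 1) * W <= e / 2.
  by rewrite mulrC; apply: mul_divS_le; lra.
have : 2 * B * (e / 2 / (2 * B + 1)) <= e / 2.
  by apply: mul_divS_le; lra.
by lra.
Qed.

End Delay.

(** * The neutral operator *)

Section Rows.
Variables (R : realType) (m : nat).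
Implicit Types (u v : 'rV[R]_m) (z : R -> 'rV[R]_m).

Lemma row_normP v (e : R) : 0 <= e -> (`|v| <= e <-> forall i, `|v ord0 i| <= e).
Proof.
move=> e0; split=> [ve i|ve].
  by apply: le_trans ve; rewrite /Num.Def.normr /= mx_normrE; exact: (le_bigmax _ (fun ij => `|v ij.1 ij.2|) (ord0, i)).
rewrite /Num.Def.normr /= mx_normrE; apply: bigmax_le => // -[i j] _ /=.
by rewrite (ord1 i).
Qed.

Lemma row_norm_ge v i : `|v ord0 i| <= `|v|.
Proof. exact: (iffLR (row_normP v (normr_ge0 v)) (lexx _) i). Qed.

Lemma row_norm_lt v (e : R) : 0 < e -> (forall i, `|v ord0 i| < e) -> `|v| < e.
Proof.
move=> e0 ve; rewrite /Num.Def.normr /= mx_normrE; apply: bigmax_lt => // -[i j] _ /=.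
by rewrite (ord1 i).
Qed.

Lemma continuous_rowP (T : topologicalType) (z : T -> 'rV[R]_m) :
  continuous z <-> forall i, continuous (fun t => z t ord0 i).
Proof.
split=> [cz i t|cz t]; apply/cvgrPdist_lt => e e0.
  have /cvgrPdist_lt/(_ e e0) := cz t; apply: filterS => u.
  by apply: le_lt_trans; have := row_norm_ge (z t - z u) i; rewrite !mxE.
have H : \forall u \near t, forall i, `|z t ord0 i - z u ord0 i| < e.
  apply: filter_forall => i; have /cvgrPdist_lt/(_ e e0) := cz i t; exact.
by apply: filterS H => u uP; apply: row_norm_lt => // i; rewrite !mxE.
Qed.

Lemma continuous_sum (T : topologicalType) (J : finType) (f : J -> T -> R) :
  (forall j, continuous (f j)) -> continuous (fun t => \sum_j f j t).
Proof. by move=> cf; apply: continuous_big => //; exact: add_continuous. Qed.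

(** The estimate for a sequence with geometric increments also bounds the
    distance to its limit, so that uniformity in a parameter is preserved. *)
Lemma geom_limit (u : nat -> R) (r k : R) : 0 <= k -> k < 1 -> 0 <= r ->
  (forall n, `|u n.+1 - u n| <= r * k ^+ n) ->
  exists l, forall n, `|u n - l| <= r / (1 - k) * k ^+ n.
Proof.
move=> k0 k1 r0 H; have k10 : 0 < 1 - k by lra.
set C := r / (1 - k).
have CE : C - C * k = r by rewrite /C; field; lra.
have C0 : 0 <= C by rewrite divr_ge0// ltW.
have kn n : 0 <= k ^+ n by rewrite exprn_ge0.
have Hv n : u n.+1 + C * k ^+ n.+1 <= u n + C * k ^+ n.
  have := H n; rewrite ler_norml => /andP[_]; rewrite exprS mulrA => h.
  have -> : C * k = C - r by lra.
  by rewrite mulrBl; lra.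
have Hw n : u n - C * k ^+ n <= u n.+1 - C * k ^+ n.+1.
  have := H n; rewrite ler_norml => /andP[h _]; rewrite exprS mulrA.
  have -> : C * k = C - r by lra.
  by rewrite mulrBl; lra.
have HV n p : u (n + p)%N + C * k ^+ (n + p) <= u n + C * k ^+ n.
  by elim: p => [|p IH]; rewrite ?addn0// addnS; apply: le_trans IH.
have HW n p : u n - C * k ^+ n <= u (n + p)%N - C * k ^+ (n + p).
  by elim: p => [|p IH]; rewrite ?addn0// addnS; apply: le_trans (Hw _).
pose A := range (fun n => u n + C * k ^+ n).
have wv n q : u n - C * k ^+ n <= u q + C * k ^+ q.
  apply: le_trans (HW n q) _; apply: le_trans (HV q n); rewrite (addnC q).
  by have := mulr_ge0 C0 (kn (n + q)%N); lra.
have Alb : has_inf A by split; [exists (u 0%N + C * k ^+ 0); exists 0%N|exists (u 0%N - C * k ^+ 0) => _ [q _ <-]].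
exists (inf A) => n; rewrite ler_norml; apply/andP; split.
  by rewrite lerBrDl lerBlDr; apply: ge_inf; [case: Alb|exists n].
rewrite lerBlDr -lerBlDl; apply: lb_le_inf; [by case: Alb|move=> _ [q _ <-]].
exact: wv.
Qed.

Lemma geom_small (C k e : R) : 0 <= k -> k < 1 -> 0 < e -> exists n, C * k ^+ n <= e.
Proof.
move=> k0 k1 e0.
have := @cvg_geometric R C k; rewrite ger0_norm// => /(_ k1)/cvgrPdist_le/(_ e e0) [n _ nP].
by exists n; have := nP n (leqnn n); rewrite /geometric /= sub0r normrN; apply: le_trans; exact: ler_norm.
Qed.

Lemma sum_le0 (J : finType) (x : J -> R) j : (forall k, 0 <= x k) -> \sum_k x k <= 0 -> x j <= 0.
Proof.
move=> x0; rewrite (bigD1 j)//=; apply: le_trans.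
by rewrite lerDl; apply: sumr_ge0 => k _; exact: x0.
Qed.

Definition BC z (r : R) := continuous z /\ forall t i, `|z t ord0 i| <= r.

Definition lip z (L : R) := forall s t i, `|z t ord0 i - z s ord0 i| <= L * `|t - s|.

Lemma BC_bcont z r i : BC z r -> bcont (fun t => z t ord0 i) r.
Proof. by case=> /continuous_rowP cz bz; split. Qed.

Lemma BC_le z r r' : r <= r' -> BC z r -> BC z r'.
Proof. by move=> rr [cz bz]; split=> // t i; apply: le_trans rr. Qed.

Lemma BC_shift z r t : BC z r -> BC (fun s => z (t + s)) r.
Proof. by case=> cz bz; split=> [|s i]; [exact: (continuous_shiftl cz)|exact: bz]. Qed.

Lemma BCB z z' r r' : BC z r -> BC z' r' -> BC (fun t => z t - z' t) (r + r').
Proof.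
move=> [cz bz] [cz' bz']; split=> [t|t i]; first by apply: cvgB; [exact: cz|exact: cz'].
by rewrite !mxE; apply: le_trans (ler_normB _ _) _; rewrite lerD.
Qed.

Lemma BC_const (k : R) : BC (fun=> const_mx k) `|k|.
Proof. by split=> [t|t i]; [exact: cvg_cst|rewrite mxE]. Qed.

Lemma lip_continuous z L : lip z L -> continuous z.
Proof.
move=> lz; apply/continuous_rowP => i t; apply/cont_epsP => e e0.
have L1 : 0 < `|L| + 1 by rewrite ltr_wpDl.
exists (e / (`|L| + 1)) => [|u ut]; first by rewrite divr_gt0.
apply: le_lt_trans (lz t u i) _.
apply: (@le_lt_trans _ _ ((`|L| + 1) * `|u - t|)); last by rewrite mulrC -ltr_pdivlMr.
by rewrite ler_wpM2r// (le_trans (ler_norm L))// lerDl.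
Qed.

End Rows.

Section NeutralOperator.
Variables (R : realType) (m : nat) (S : compartmental R m).
Hypothesis hC4 : C4 S.
Implicit Types (z y : R -> 'rV[R]_m) (s t r e : R) (i j : 'I_m).
Local Notation I := (neg R).
Hint Resolve measurable_neg : core.

(** The neutral operator along a curve; most estimates are about curves on the
    whole line rather than about their segments. *)
Definition DD z t i : R := D S (seg z t) ord0 i.

Definition delay i z t : R := \sum_j \int[nu S i j]_(s in I) z (t + s) ord0 j.

Lemma seg_clamp z t s : s <= 0 -> seg z t (clamp s) = z (t + s).
Proof. by move=> s0; rewrite /seg /= min_l. Qed.

Lemma seg_clamp0 z t : seg z t (clamp 0) = z t.
Proof. by rewrite seg_clamp// addr0. Qed.

Lemma past_le0 (s : past R) : val s <= 0.
Proof. by case: s => s /= /set_mem; rewrite /= in_itv. Qed.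

Lemma clamp_val (s : past R) : clamp (val s) = s.
Proof. by apply: val_inj; rewrite /= min_l// past_le0. Qed.

Lemma eq_seg z z' t : (forall s, s <= t -> z s = z' s) -> seg z t = seg z' t.
Proof. by move=> zz'; apply/funext => s; apply: zz'; rewrite gerDl past_le0. Qed.

Lemma seg_shift z t s : seg (fun r => z (t + r)) s = seg z (t + s).
Proof. by apply/funext => r; rewrite /seg addrA. Qed.

Lemma DDE z t i : DD z t i = z t ord0 i - delay i z t.
Proof.
rewrite /DD /D mxE seg_clamp0; congr (_ - _); apply: eq_bigr => j _.
by apply: eq_Rintegral => s; rewrite inE in_negP => s0; rewrite seg_clamp.
Qed.

Lemma eq_DD z z' t i : (forall s, s <= t -> z s = z' s) -> DD z t i = DD z' t i.
Proof. by move=> zz'; rewrite /DD (eq_seg zz'). Qed.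

Lemma DD_shift z t s i : DD (fun r => z (t + r)) s i = DD z (t + s) i.
Proof. by rewrite /DD seg_shift. Qed.

Lemma z_integrable z r i j t : BC z r ->
  (nu S i j).-integrable I (EFin \o (fun s => z (t + s) ord0 j)).
Proof. by move=> bz; exact: neg_integrable (bcont_shift t (BC_bcont j bz)). Qed.

Lemma delayB z z' r r' i t : BC z r -> BC z' r' -> delay i (fun s => z s - z' s) t = delay i z t - delay i z' t.
Proof.
move=> bz bz'; rewrite /delay -sumrB; apply: eq_bigr => j _.
have jz := z_integrable i j t bz; have jz' := z_integrable i j t bz'.
by rewrite -RintegralB//; apply: eq_Rintegral => s _; rewrite !mxE.
Qed.

Lemma DDB z z' r r' t i : BC z r -> BC z' r' -> DD (fun s => z s - z' s) t i = DD z t i - DD z' t i.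
Proof. by move=> bz bz'; rewrite !DDE (delayB _ _ bz bz') !mxE; ring. Qed.

Definition nu_mass i := \sum_j mass (nu S i j).

(** By (C4) the delayed part of [D] is a contraction with this constant. *)
Definition kap : R := \big[Num.max/0]_i nu_mass i.

Lemma kap_ge0 : 0 <= kap.
Proof. exact: bigmax_ge_id. Qed.

Lemma nu_mass_le i : nu_mass i <= kap.
Proof. exact: le_bigmax. Qed.

Lemma kap_lt1 : kap < 1.
Proof.
apply: bigmax_lt => // i _; case: hC4 => _ /(_ i).
by under eq_bigr do rewrite massE; rewrite sumEFin lte_fin.
Qed.

Lemma kap1 : 0 < 1 - kap.
Proof. by rewrite subr_gt0 kap_lt1. Qed.
Hint Resolve kap1 kap_ge0 : core.

Lemma DD_const (k : R) t i : DD (fun=> const_mx k) t i = k * (1 - nu_mass i).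
Proof.
rewrite DDE mxE mulrBr mulr1; congr (_ - _); rewrite mulr_sumr; apply: eq_bigr => j _.
by under eq_Rintegral do rewrite mxE; rewrite int_cst.
Qed.

(** A negative infimum of [z] would be at least [kap < 1] times itself. *)
Lemma DD_ge0 z r t : BC z r -> (forall s i, s <= t -> 0 <= DD z s i) ->
  forall s i, s <= t -> 0 <= z s ord0 i.
Proof.
move=> bz Dz s0 i0 s0t.
pose A := [set x | exists s i, s <= t /\ x = z s ord0 i].
have Alb : has_inf A.
  split; first by exists (z s0 ord0 i0); exists s0, i0.
  exists (- r) => _ [s [i [_ ->]]]; case: bz => _ /(_ s i); rewrite ler_norml => /andP[] //.
have cA s i : s <= t -> inf A <= z s ord0 i by move=> st; apply: ge_inf; [case: Alb|exists s, i].
suff c0 : 0 <= inf A by apply: le_trans c0 (cA _ _ _).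
rewrite leNgt; apply/negP => c0.
have : kap * inf A <= inf A.
  apply: lb_le_inf; [by case: Alb|move=> _ [s [i [st ->]]]].
  have := Dz s i st; rewrite DDE subr_ge0; apply: le_trans.
  apply: (@le_trans _ _ (nu_mass i * inf A)).
    by rewrite ler_wnM2r// ?nu_mass_le// ltW.
  rewrite mulr_suml; apply: ler_sum => j _; rewrite mulrC -int_cst.
  apply: (@le_int _ _ _ _ (Num.max `|inf A| r)).
  - by split=> [?|?]; [exact: cvg_cst|rewrite le_max lexx].
  - have [cz lz] := bcont_shift s (BC_bcont j bz).
    by split=> // u; rewrite le_max lz orbT.
  - by move=> u u0; apply: cA; lra.
move=> h; have : 0 < (1 - kap) * (- inf A) by rewrite mulr_gt0// oppr_gt0.
by rewrite mulrN mulrBl mul1r; lra.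
Qed.

Lemma DD_le z z' r r' t : BC z r -> BC z' r' -> (forall s i, s <= t -> DD z s i <= DD z' s i) ->
  forall s i, s <= t -> z s ord0 i <= z' s ord0 i.
Proof.
move=> bz bz' Dz s i st; have := DD_ge0 (BCB bz' bz) (t := t) _ i st.
rewrite !mxE subr_ge0; apply=> u k ut; rewrite (DDB _ _ bz' bz) subr_ge0; exact: Dz.
Qed.

Lemma DD_inj z z' r r' t : BC z r -> BC z' r' -> (forall s i, s <= t -> DD z s i = DD z' s i) ->
  forall s, s <= t -> z s = z' s.
Proof.
move=> bz bz' Dz s st; apply/rowP => i; apply/eqP; rewrite eq_le.
by rewrite (DD_le bz bz' (t := t)) ?(DD_le bz' bz (t := t))// => u k ut; rewrite Dz.
Qed.

Lemma DD_bound z r t e : BC z r -> 0 <= e -> (forall s i, s <= t -> `|DD z s i| <= e) ->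
  forall s i, s <= t -> `|z s ord0 i| <= e / (1 - kap).
Proof.
move=> bz e0 Dz s i st.
have k0 : 0 <= e / (1 - kap) by rewrite divr_ge0// ltW.
have cle u j : e <= DD (fun=> const_mx (e / (1 - kap))) u j.
  rewrite DD_const -{1}(divfK (lt0r_neq0 kap1) e) ler_wpM2l// lerB ?nu_mass_le//.
have cge u j : DD (fun=> const_mx (- (e / (1 - kap)))) u j <= - e.
  by have := cle u j; rewrite !DD_const mulNr; lra.
have bd u j : u <= t -> - e <= DD z u j <= e by move=> ut; rewrite -ler_norml Dz.
have := @DD_le _ _ _ _ t bz (BC_const m (e / (1 - kap))) _ s i st.
have := @DD_le _ _ _ _ t (BC_const m (- (e / (1 - kap)))) bz _ s i st.
rewrite !mxE ler_norml => h1 h2; apply/andP; split.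
  by apply: h1 => u j ut; apply: le_trans (cge u j) _; case/andP: (bd u j ut).
by apply: h2 => u j ut; apply: le_trans (cle u j); case/andP: (bd u j ut).
Qed.

Lemma DD_lip z r t L : BC z r -> 0 <= L ->
  (forall s s' i, s <= t -> s' <= t -> `|DD z s i - DD z s' i| <= L * `|s - s'|) ->
  forall s s' i, s <= t -> s' <= t -> `|z s ord0 i - z s' ord0 i| <= L / (1 - kap) * `|s - s'|.
Proof.
move=> bz L0 Dz.
suff H s s' i : s <= s' -> s' <= t -> `|z s ord0 i - z s' ord0 i| <= L / (1 - kap) * `|s - s'|.
  move=> s s' i st s't; case: (leP s s') => [ss'|/ltW ss']; first exact: H.
  by rewrite distrC [`|s - _|]distrC; exact: H.
move=> ss' s't; pose h := s - s'.
have bh := BC_shift h bz.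
have h0 : h <= 0 by rewrite /h; lra.
have := @DD_bound _ _ t (L * `|h|) (BCB bh bz) (mulr_ge0 L0 (normr_ge0 _)) _ s' i s't.
rewrite !mxE (_ : h + s' = s); last by rewrite /h; ring.
rewrite mulrAC; apply=> u j ut; rewrite (DDB _ _ bh bz) DD_shift.
apply: le_trans (Dz _ _ _ _ _) _ => //; first by lra.
by rewrite addrK.
Qed.

Lemma delay_continuous z r i : BC z r -> continuous (delay i z).
Proof.
move=> bz; apply: continuous_sum => j.
have cj := @int_shift_continuous R (nu S i j) _ _ (BC_bcont j bz).
exact: cj.
Qed.

Lemma DD_continuous z r i : BC z r -> continuous (fun t => DD z t i).
Proof.
move=> bz; rewrite (_ : (fun t => _) = fun t => z t ord0 i - delay i z t); last by apply/funext => t; rewrite DDE.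
by move=> t; apply: cvgB; [case: (BC_bcont i bz) => + _; exact|exact: delay_continuous bz t].
Qed.

Lemma delay_bound z r i t : BC z r -> `|delay i z t| <= kap * r.
Proof.
move=> bz; have r0 : 0 <= r by apply: le_trans (bz.2 0 i).
apply: le_trans (ler_norm_sum _ _ _) _.
apply: (@le_trans _ _ (nu_mass i * r)); last by rewrite ler_wpM2r// nu_mass_le.
rewrite mulr_suml; apply: ler_sum => j _.
have bj := bcont_shift t (BC_bcont j bz).
rewrite mulrC ler_norml; apply/andP; split; last first.
  by apply: int_le_cst bj _ => s _; have := bz.2 (t + s) j; rewrite ler_norml => /andP[].
rewrite -mulNr -int_cst; apply: (@le_int _ _ _ _ r) => //.
  by split=> [?|?]; [exact: cvg_cst|rewrite normrN ger0_norm].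
by move=> s _; have := bz.2 (t + s) j; rewrite ler_norml => /andP[].
Qed.

(** The Neumann series, with the uniform error bound of [geom_limit]. *)
Lemma DD_surj y r : BC y r ->
  exists2 z, BC z (r / (1 - kap)) & forall t i, DD z t i = y t ord0 i.
Proof.
move=> by_; case: (posnP m) => [m0|m_gt0].
  have i0 (i : 'I_m) : False by case: i => i; rewrite m0.
  exists y => [|t i]; last by case: (i0 i).
  by split=> [|t i]; [case: by_|case: (i0 i)].
have r0 : 0 <= r by apply: le_trans (by_.2 0 (Ordinal m_gt0)).
pose zn := fix zn n : R -> 'rV[R]_m := if n is n'.+1 then fun t => \row_i (y t ord0 i + delay i (zn n') t) else fun=> const_mx 0.
have bzn n : exists r', BC (zn n) r'.
  elim: n => [|n [r' IH]]; first by exists `|0 : R|; exact: BC_const.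
  exists (r + kap * r'); split=> [|t i].
    apply/continuous_rowP => i; rewrite (_ : (fun t => _) = fun t => y t ord0 i + delay i (zn n) t).
      by move=> t; apply: cvgD; [case: (BC_bcont i by_) => + _; exact|exact: delay_continuous IH t].
    by apply/funext => t; rewrite /= mxE.
  by rewrite /= mxE; apply: le_trans (ler_normD _ _) _; rewrite lerD ?by_.2// (delay_bound _ _ IH).
have step n t i : `|zn n.+1 t ord0 i - zn n t ord0 i| <= r * kap ^+ n.
  elim: n t i => [|n IH] t i.
    rewrite /= !mxE subr0 expr0 mulr1 (_ : delay i _ t = 0) ?addr0 ?by_.2//.
    by rewrite /delay big1// => j _; under eq_Rintegral do rewrite mxE; rewrite int_cst mul0r.
  have [r1 b1] := bzn n.+1; have [r2 b2] := bzn n.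
  rewrite -[zn n.+2]/(fun t => \row_i (y t ord0 i + delay i (zn n.+1) t)) mxE.
  rewrite [X in _ - X](_ : _ = y t ord0 i + delay i (zn n) t); last by rewrite /= mxE.
  rewrite opprD addrACA subrr add0r -(delayB _ _ b1 b2) exprS mulrCA.
  apply: delay_bound; split; first by case: (BCB b1 b2).
  by move=> u k; rewrite mxE [X in _ + X]mxE; exact: IH.
have lim t i := geom_limit kap_ge0 kap_lt1 r0 (fun n => step n t i).
pose z t : 'rV[R]_m := \row_i projT1 (cid (lim t i)).
have zP n t i : `|zn n t ord0 i - z t ord0 i| <= r / (1 - kap) * kap ^+ n.
  by rewrite mxE; case: (cid _) => l /= /(_ n).
have bz : BC z (r / (1 - kap)).
  split=> [|t i]; last by have := zP 0%N t i; rewrite /= mxE sub0r normrN expr0 mulr1.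
  apply/continuous_rowP => i t; apply/cont_epsP => e e0.
  have e40 : 0 < e / 4 by lra.
  have [n nP] := geom_small (r / (1 - kap)) kap_ge0 kap_lt1 e40.
  have [r' [/continuous_rowP/(_ i) cn _]] := bzn n.
  have [d d0 dP] := (cont_epsP _ t).1 (cn t) _ e40.
  exists d => // u /dP h; have h1 := zP n u i; have h2 := zP n t i.
  rewrite (_ : _ - _ = (zn n u ord0 i - zn n t ord0 i) - (zn n u ord0 i - z u ord0 i) + (zn n t ord0 i - z t ord0 i)); last by ring.
  apply: le_lt_trans (ler_normD _ _) _.
  by have := ler_normB (zn n u ord0 i - zn n t ord0 i) (zn n u ord0 i - z u ord0 i); lra.
exists z => // t i; apply/eqP; rewrite -subr_eq0 -normr_eq0 eq_le normr_ge0 andbT.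
apply/ler_addgt0Pr => e e0; rewrite add0r.
have e20 : 0 < e / 2 by lra.
have [n nP] := geom_small (r / (1 - kap)) kap_ge0 kap_lt1 e20.
have [r1 b1] := bzn n.
have h1 := zP n.+1 t i.
have h2 : `|delay i (fun s => zn n s - z s) t| <= kap * (r / (1 - kap) * kap ^+ n).
  apply: delay_bound; split; first by case: (BCB b1 bz).
  by move=> u k; rewrite mxE [X in _ + X]mxE; exact: zP.
rewrite DDE (_ : _ - _ - _ = - (zn n.+1 t ord0 i - z t ord0 i) + delay i (fun s => zn n s - z s) t); last first.
  by rewrite (delayB _ _ b1 bz) /= mxE; ring.
apply: le_trans (ler_normD _ _) _; rewrite normrN.
have h3 : r / (1 - kap) * kap ^+ n.+1 <= r / (1 - kap) * kap ^+ n.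
  by rewrite exprS mulrCA ler_piMl ?(ltW kap_lt1)// mulr_ge0 ?exprn_ge0// divr_ge0// ltW.
have h4 : kap * (r / (1 - kap) * kap ^+ n) <= r / (1 - kap) * kap ^+ n by rewrite mulrCA -exprS.
lra.
Qed.

Definition Dinv y : R -> 'rV[R]_m :=
  xget (fun=> 0) [set z | (exists r, BC z r) /\ forall t i, DD z t i = y t ord0 i].

Lemma DinvP y r : BC y r -> BC (Dinv y) (r / (1 - kap)) /\ forall t i, DD (Dinv y) t i = y t ord0 i.
Proof.
move=> by_; have [z bz zy] := DD_surj by_.
suff -> : Dinv y = z by [].
rewrite /Dinv; case: xgetP => [z' _ [[r' bz'] zy']|/(_ z)[]]; last by split=> //; exists (r / (1 - kap)).
by apply/funext => t; apply: (DD_inj bz' bz (t := t)) => // s i _; rewrite zy zy'.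
Qed.

Lemma DD_small r e : 0 <= r -> 0 < e -> exists2 T, 0 < T & exists2 d, 0 < d &
  forall z z' t i, BC z r -> BC z' r ->
   (forall s j, t - T <= s -> s <= t -> `|z s ord0 j - z' s ord0 j| <= d) ->
   `|DD z t i - DD z' t i| <= e.
Proof.
move=> r0 e0.
have k0 : 0 < e / 2 / (m%:R * (2 * r) + 1) by rewrite divr_gt0//; [lra|rewrite ltr_wpDl// mulr_ge0//; lra].
pose T : R := \big[Num.max/1]_i \big[Num.max/1]_j s2val (cid2 (int_small (nu S i j) k0)).
have T1 i j : s2val (cid2 (int_small (nu S i j) k0)) <= T.
  apply: le_trans (le_bigmax _ _ i); exact: (le_bigmax _ (fun j => s2val (cid2 (int_small (nu S i j) k0))) j).
exists T; first by rewrite (lt_le_trans ltr01)//; exact: bigmax_ge_id.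
exists (e / 4); first by lra.
move=> z z' t i bz bz' zz'.
have bB := BCB bz bz'.
rewrite -(DDB _ _ bz bz') DDE; apply: le_trans (ler_normB _ _) _.
have h1 : `|(z t - z' t) ord0 i| <= e / 4.
  rewrite !mxE; apply: zz' => //.
  have : 0 <= T by rewrite (le_trans ler01)//; exact: bigmax_ge_id.
  by lra.
suff : `|delay i (fun s => z s - z' s) t| <= e / 4 * kap + m%:R * (2 * r) * (e / 2 / (m%:R * (2 * r) + 1)).
  have := @mul_divS_le _ (m%:R * (2 * r)) (e / 2) _ _ => h2 h3.
  have {}h2 : m%:R * (2 * r) * (e / 2 / (m%:R * (2 * r) + 1)) <= e / 2 by apply: h2; [rewrite mulr_ge0//|]; lra.
  have h4 : e / 4 * kap <= e / 4 by rewrite ler_piMr ?(ltW kap_lt1)//; lra.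
  by lra.
apply: le_trans (ler_norm_sum _ _ _) _.
apply: (@le_trans _ _ (\sum_j (e / 4 * mass (nu S i j) + 2 * r * (e / 2 / (m%:R * (2 * r) + 1))))).
  apply: ler_sum => j _; case: (cid2 _) (T1 i j) => Tj /= Tj0 TjP TjT.
  apply: TjP; [lra|lra| |].
    have [cB lB] := bcont_shift t (BC_bcont j bB); split=> // s.
    by apply: le_trans (lB s) _; lra.
  by move=> s s1 s2; rewrite !mxE; apply: zz'; lra.
rewrite big_split /= -mulr_sumr sumr_const card_ord lerD//.
  by rewrite ler_wpM2l ?nu_mass_le//; lra.
by rewrite -[leLHS]mulr_natl !mulrA lexx.
Qed.

End NeutralOperator.

(** * Compact-open topologies *)

Section CompactFamily.
Variables (R : realType) (X : topologicalType) (V : normedModType R) (C : R -> set X).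
Hypothesis Ccompact : forall T, compact (C T).
Hypothesis Cexhausts : forall K : set X, compact K -> exists2 T, 0 < T & K `<=` C T.
Implicit Types (f : {family compact, X -> V}) (T e : R).

(** The basic neighbourhoods of the topology of uniform convergence on compact
    sets, when the compact sets are exhausted by a one-parameter family. *)
Definition near_on f T e : set {family compact, X -> V} :=
  [set h | forall x, C T x -> `|h x - f x| < e].

Lemma near_on_refl f T e : 0 < e -> near_on f T e f.
Proof. by move=> e0 x _; rewrite subrr normr0. Qed.

Lemma near_on_nbhs f T e : 0 < e -> nbhs f (near_on f T e).
Proof.
move=> e0; have := @fam_nbhs X V compact (C T) [set xy | ball xy.1 e xy.2] f (entourage_ball V (PosNum e0)) (@Ccompact T).
by apply: filterS => h hP x Cx; have := hP x Cx; rewrite -ball_normE /= distrC.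
Qed.

Hypothesis Cmono : forall T T', T <= T' -> C T `<=` C T'.

Lemma near_on_basis f (A : set {family compact, X -> V}) : nbhs f A ->
  exists T e, [/\ 0 < T, 0 < e & near_on f T e `<=` A].
Proof.
pose F := filter_from [set Te : R * R | 0 < Te.1 /\ 0 < Te.2] (fun Te => near_on f Te.1 Te.2).
have FF : Filter F.
  apply: filter_from_filter; first by exists (1, 1) => /=.
  move=> [T e] [T' e'] /= [T0 e0] [T'0 e'0].
  exists (Num.max T T', Num.min e e') => /=; first by rewrite lt_max T0 lt_min e0.
  move=> h hP; split=> x Cx; have := hP x (Cmono _ Cx); rewrite lt_min.
    by rewrite le_max lexx => /(_ isT)/andP[].
  by rewrite le_max lexx orbT => /(_ isT)/andP[].
have Ff : {family compact, F --> f}.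
  apply/fam_cvgP => K cK B /uniform_nbhs[E [entE EB]].
  have [T T0 KT] := Cexhausts cK.
  move: entE; rewrite -entourage_ballE => -[e /= e0 eE].
  exists (T, e) => //= h hP; apply: EB => x Kx; apply: eE => /=.
  by rewrite -ball_normE /= distrC; apply: hP; exact: KT.
move=> /Ff[[T e] /= [T0 e0] H]; by exists T, e.
Qed.

Lemma compact_family_hausdorff : (forall x, exists T, C T x) -> hausdorff_space {family compact, X -> V}.
Proof.
move=> Cx f h clfh; apply/funext => x; apply/eqP; rewrite -subr_eq0 -normr_eq0 eq_le normr_ge0 andbT.
rewrite leNgt; apply/negP => e0; have [T Tx] := Cx x.
have e20 : 0 < `|f x - h x| / 2 by rewrite divr_gt0.
have [k [/= k1 k2]] := clfh _ _ (near_on_nbhs f T e20) (near_on_nbhs h T e20).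
have := ler_normD (f x - k x) (k x - h x); rewrite addrA subrK.
have := k1 x Tx; have := k2 x Tx; rewrite (distrC (k x) (f x)); lra.
Qed.

End CompactFamily.

Section Topology.

Lemma pair_hausdorff (X Y : topologicalType) : hausdorff_space X -> hausdorff_space Y -> hausdorff_space (X * Y)%type.
Proof.
have nb (p : X * Y) (A : set X) (B : set Y) : nbhs p.1 A -> nbhs p.2 B -> nbhs p (A `*` B) by exists (A, B).
move=> hX hY [a b] [c d] cl; congr (_, _).
  apply: hX => A B nA nC.
  have [[x y] [[/= Ax _] [Bx _]]] := cl (A `*` setT) (B `*` setT) (nb (a, b) _ _ nA filterT) (nb (c, d) _ _ nC filterT).
  by exists x.
apply: hY => A B nA nC.
have [[x y] [[/= _ Ax] [_ Bx]]] := cl (setT `*` A) (setT `*` B) (nb (a, b) _ _ filterT nA) (nb (c, d) _ _ filterT nC).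
by exists y.
Qed.

(** The images [phi s @` E] decrease with [s], since [phi] moves [E] into
    itself: a limit point of points of remote images lies in all of them. *)
Lemma nested_images (R : realType) (X : topologicalType) (phi : R -> X -> X) (E : set X) :
  hausdorff_space X -> (forall s, continuous (phi s)) ->
  (forall s t x, 0 <= s -> 0 <= t -> phi (s + t) x = phi s (phi t x)) ->
  compact E -> E !=set0 -> (forall s x, 0 <= s -> E x -> E (phi s x)) ->
  exists x, forall s, 0 <= s -> exists2 y, E y & phi s y = x.
Proof.
move=> hX cphi phiD cE [x0 Ex0] Einv.
pose u n := phi n%:R x0.
have Eu n : E (u n) by apply: Einv.
have Fu : (u @ \oo) E by exists 0%N => // n _; exact: Eu.
have [x [Ex clx]] := cE (u @ \oo) _ Fu.
exists x => s s0.
have cs : compact (phi s @` E).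
  by apply: continuous_compact => //; apply: continuous_subspaceT; exact: cphi.
suff : (phi s @` E) x by move=> [y Ey <-]; exists y.
apply: (compact_closed hX cs) => B nB.
pose N := Num.bound s.
have [] := clx (phi s @` E) B _ nB; last by move=> y [? ?]; exists y.
exists N => // n /= Nn.
have sn : 0 <= n%:R - s.
  rewrite subr_ge0; apply: (@le_trans _ _ (N%:R)); last by rewrite ler_nat.
  exact: ltW (archi_boundP s0).
exists (phi (n%:R - s) x0); first exact: Einv.
by rewrite -phiD// addrC subrK.
Qed.

End Topology.

Section Histories.
Variables (R : realType) (m : nat).
Implicit Types (x y : hist R m) (w : vfield R m) (T e L r : R).

Definition recent T : set (past R) := [set s | - T <= val s].
Definition square T : set (R * R) := [set p | `|p.1| <= T /\ `|p.2| <= T].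

Lemma val_continuous : continuous (fun s : past R => val s).
Proof. exact: initial_continuous. Qed.

Lemma clamp_continuous : continuous (@clamp R).
Proof.
apply: (@continuous_comp_initial _ _ _ val) => s.
by apply: continuous_min; [exact: cvg_id|exact: cvg_cst].
Qed.

Lemma recent_compact T : compact (recent T).
Proof.
have -> : recent T = @clamp R @` `[- T, 0].
  apply/seteqP; split=> [s Ts|_ [s + <-]].
    by exists (val s); [rewrite /= in_itv /= past_le0 andbT|exact: clamp_val].
  by rewrite /= in_itv /= => /andP[Ts s0]; rewrite /recent /= min_l.
apply: continuous_compact; last exact: segment_compact.
by apply: continuous_subspaceT; exact: clamp_continuous.
Qed.

Lemma compact_abs_bound (K : set R) : compact K -> exists2 T, 0 < T & forall t, K t -> `|t| <= T.
Proof.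
move=> /compact_bounded[M [_ MP]]; exists (`|M| + 1); first by rewrite ltr_wpDl.
by move=> t Kt; apply: MP => //; rewrite (le_lt_trans (ler_norm M))// ltrDl.
Qed.

Lemma recent_exhausts (K : set (past R)) : compact K -> exists2 T, 0 < T & K `<=` recent T.
Proof.
move=> cK; have [|T T0 TP] := @compact_abs_bound (val @` K).
  by apply: continuous_compact => //; apply: continuous_subspaceT; exact: val_continuous.
exists T => // s Ks; have := TP (val s) (ex_intro2 _ _ s Ks erefl).
by rewrite ler_norml => /andP[].
Qed.

Lemma recent_mono T T' : T <= T' -> recent T `<=` recent T'.
Proof. by move=> TT s; apply: le_trans; rewrite lerN2. Qed.

Lemma recent_cover (s : past R) : exists T, recent T s.
Proof. by exists (- val s); rewrite /recent /= opprK. Qed.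

Lemma square_compact T : compact (square T).
Proof.
have -> : square T = `[- T, T] `*` `[- T, T].
  by apply/seteqP; split=> -[s v] /=; rewrite !in_itv /= -!ler_norml.
by apply: compact_setX; exact: segment_compact.
Qed.

Lemma square_exhausts (K : set (R * R)) : compact K -> exists2 T, 0 < T & K `<=` square T.
Proof.
move=> cK.
have [|T T0 TP] := @compact_abs_bound (fst @` K).
  by apply: continuous_compact => //; apply: continuous_subspaceT => p; exact: cvg_fst.
have [|T' T'0 TP'] := @compact_abs_bound (snd @` K).
  by apply: continuous_compact => //; apply: continuous_subspaceT => p; exact: cvg_snd.
exists (Num.max T T') => [|p Kp]; first by rewrite lt_max T0.
split; rewrite le_max; apply/orP; [left; apply: TP|right; apply: TP']; by exists p.
Qed.

Lemma square_mono T T' : T <= T' -> square T `<=` square T'.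
Proof. by move=> TT p [? ?]; split; apply: le_trans TT. Qed.

Lemma square_cover (p : R * R) : exists T, square T p.
Proof. by exists (Num.max `|p.1| `|p.2|); split; rewrite le_max lexx ?orbT. Qed.

Lemma hist_hausdorff : hausdorff_space (hist R m).
Proof. exact: compact_family_hausdorff recent_compact recent_cover. Qed.

Lemma vfield_hausdorff : hausdorff_space (vfield R m).
Proof. exact: compact_family_hausdorff square_compact square_cover. Qed.

Lemma state_hausdorff : hausdorff_space (vfield R m * hist R m)%type.
Proof. exact: pair_hausdorff vfield_hausdorff hist_hausdorff. Qed.

Definition xnear x T e : set (hist R m) := near_on (V := 'rV[R]_m) recent x T e.
Definition wnear w T e : set (vfield R m) := near_on (V := flux R m) square w T e.

Lemma xnear_nbhs x T e : 0 < e -> nbhs x (xnear x T e).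
Proof. exact: near_on_nbhs recent_compact _ _ _. Qed.

Lemma wnear_nbhs w T e : 0 < e -> nbhs w (wnear w T e).
Proof. exact: near_on_nbhs square_compact _ _ _. Qed.

Lemma xnear_basis x A : nbhs x A -> exists T e, [/\ 0 < T, 0 < e & xnear x T e `<=` A].
Proof. exact: near_on_basis recent_exhausts recent_mono _ _. Qed.

Lemma wnear_basis w A : nbhs w A -> exists T e, [/\ 0 < T, 0 < e & wnear w T e `<=` A].
Proof. exact: near_on_basis square_exhausts square_mono _ _. Qed.

Lemma xnear_mono x T T' e e' : T' <= T -> e <= e' -> xnear x T e `<=` xnear x T' e'.
Proof. by move=> TT ee y yx s Ts; apply: lt_le_trans ee; apply: yx; exact: recent_mono Ts. Qed.

Lemma wnear_mono w T T' e e' : T' <= T -> e <= e' -> wnear w T e `<=` wnear w T' e'.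
Proof. by move=> TT ee y yx s Ts; apply: lt_le_trans ee; apply: yx; exact: square_mono Ts. Qed.

Lemma state_nbhs w x T e : 0 < e -> nbhs (w, x) (wnear w T e `*` xnear x T e).
Proof. by move=> e0; exists (wnear w T e, xnear x T e); first split; [exact: wnear_nbhs|exact: xnear_nbhs|]. Qed.

Lemma state_basis w x A : nbhs (w, x) A -> exists T e, [/\ 0 < T, 0 < e & wnear w T e `*` xnear x T e `<=` A].
Proof.
move=> [[B C] /= [/wnear_basis[T [e [T0 e0 TB]]] /xnear_basis[T' [e' [T'0 e'0 TC]]]] BC_].
exists (Num.max T T'), (Num.min e e'); split; [by rewrite lt_max T0|by rewrite lt_min e0|].
move=> [v y] [/= wv xy]; apply: BC_; split=> /=.
  by apply: TB; apply: wnear_mono wv; rewrite ?le_max ?ge_min lexx.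
by apply: TC; apply: xnear_mono xy; rewrite ?le_max ?ge_min lexx orbT.
Qed.

Lemma translate_continuous t : continuous (@translate R m t : vfield R m -> vfield R m).
Proof.
move=> w A /wnear_basis[T [e [T0 e0 TA]]].
apply: filterS (wnear_nbhs w (T + `|t|) e0) => w' w'P; apply: TA => -[s v] [/= sT vT].
apply: w'P; split=> /=.
  by apply: le_trans (ler_normD _ _) _; rewrite addrC lerD2r.
by apply: le_trans vT _; rewrite lerDl.
Qed.

Lemma translateD s t w : translate s (translate t w) = translate (s + t) w.
Proof. by apply/funext => -[u v]; rewrite /translate /=; congr (w (_, _)); ring. Qed.

Lemma translate0 w : translate 0 w = w.
Proof. by apply/funext => -[u v]; rewrite /translate /= add0r. Qed.

(** A history as a curve on the whole line, constant after time 0. *)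
Definition ext x : R -> 'rV[R]_m := fun t => x (clamp t).

Lemma seg_ext x t : t <= 0 -> seg (ext x) t = shift_hist x (clamp t).
Proof. by move=> t0; rewrite /shift_hist /= min_l. Qed.

Lemma seg_ext0 x : seg (ext x) 0 = x.
Proof. by apply/funext => s; rewrite /seg /ext add0r clamp_val. Qed.

Lemma ext_seg (z : R -> 'rV[R]_m) t s : s <= 0 -> ext (seg z t) s = z (t + s).
Proof. exact: seg_clamp. Qed.

(** Ascoli: the set is closed, pointwise bounded and equicontinuous. *)
Lemma lip_hist_compact r L : compact [set x : hist R m | (forall t i, `|ext x t ord0 i| <= r) /\ lip (ext x) L].
Proof.
set W := (W in compact W).
have hV : hausdorff_space ('rV[R]_m) by exact: norm_hausdorff.
have pW : precompact (W : set {family compact, past R -> 'rV[R]_m}).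
  apply: (@pointwise_precompact_equicontinuous (past R) 'rV[R]_m hV W).
    move=> s; apply: (@precompact_subset _ _ [set v : 'rV[R]_m | `|v| <= `|r|]).
      move=> _ [x [xr _] <-]; apply/(row_normP _ (normr_ge0 r)) => i.
      by have := xr (val s) i; rewrite /ext clamp_val => /le_trans; apply; exact: ler_norm.
    have clB : closed [set v : 'rV[R]_m | `|v| <= `|r|].
      rewrite (_ : [set v | _] = Num.norm @^-1` [set u | u <= `|r|])//.
      by apply: closed_comp; [move=> v _; exact: norm_continuous|exact: closed_le].
    rewrite precompact_closed//; apply: bounded_closed_compact => //.
    exists `|r|; split=> [|k rk v /= vr]; first exact: num_real.
    by apply: le_trans vr (ltW rk).
  move=> s E; rewrite -entourage_ballE => -[e /= e0 eE].
  have L1 : 0 < `|L| + 1 by rewrite ltr_wpDl.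
  have d0 : 0 < e / (`|L| + 1) by rewrite divr_gt0.
  have : \forall u \near s, `|val u - val s| < e / (`|L| + 1).
    have /cvgrPdist_lt/(_ _ d0) := @val_continuous s.
    by apply: filterS => u; rewrite distrC.
  apply: filterS => u us x [xr xL]; apply: eE => /=; rewrite -ball_normE /=.
  apply: row_norm_lt => // i; rewrite !mxE.
  have := xL (val u) (val s) i; rewrite /ext !clamp_val => /le_lt_trans; apply.
  rewrite distrC; apply: (@le_lt_trans _ _ ((`|L| + 1) * `|val u - val s|)); last by rewrite mulrC -ltr_pdivlMr.
  by rewrite ler_wpM2r// (le_trans (ler_norm L))// lerDl.
move: pW; rewrite precompact_closed// => x clx.
have ev (s : past R) e : 0 < e -> exists2 y, W y & `|y s - x s| < e.
  move=> e0; have [T Ts] := recent_cover s.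
  by have [y [Wy yP]] := clx _ (xnear_nbhs x T e0); exists y => //; exact: yP.
have evi s i e : 0 < e -> exists2 y, W y & `|ext y s ord0 i - ext x s ord0 i| < e.
  move=> e0; have [y Wy yx] := ev (clamp s) _ e0; exists y => //.
  by apply: le_lt_trans yx; have := row_norm_ge (y (clamp s) - x (clamp s)) i; rewrite !mxE.
split=> [t i|s t i].
  apply/ler_addgt0Pr => e e0; have [y [yr _] yx] := evi t i e e0.
  rewrite (_ : ext x t ord0 i = ext y t ord0 i - (ext y t ord0 i - ext x t ord0 i)); last by ring.
  by apply: le_trans (ler_normB _ _) _; rewrite lerD// ltW.
apply/ler_addgt0Pr => e e0; have e20 : 0 < e / 2 by lra.
have [T Ts] := recent_cover (clamp s); have [T' Tt] := recent_cover (clamp t).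
have [y [[yr yL] yP]] := clx _ (xnear_nbhs x (Num.max T T') e20).
have h u : recent (Num.max T T') (clamp u) -> `|ext y u ord0 i - ext x u ord0 i| < e / 2.
  by move=> uP; apply: le_lt_trans (yP _ uP); have := row_norm_ge (y (clamp u) - x (clamp u)) i; rewrite !mxE.
have h1 : `|ext y s ord0 i - ext x s ord0 i| < e / 2 by apply: h; apply: recent_mono Ts; rewrite le_max lexx.
have h2 : `|ext y t ord0 i - ext x t ord0 i| < e / 2 by apply: h; apply: recent_mono Tt; rewrite le_max lexx orbT.
have h3 := yL s t i.
rewrite (_ : _ - _ = (ext y t ord0 i - ext y s ord0 i) - (ext y t ord0 i - ext x t ord0 i) + (ext y s ord0 i - ext x s ord0 i)); last by ring.
apply: le_trans (ler_normD _ _) _.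
have := ler_normB (ext y t ord0 i - ext y s ord0 i) (ext y t ord0 i - ext x t ord0 i).
lra.
Qed.

End Histories.

(** * The hull *)

Section Hull.
Lemma three_point (V : zmodType) (a b x y : V) : a - b = (x - y) - (x - a) + (y - b).
Proof.
have H (p q c : V) : p - q = (p - c) + (c - q) by rewrite addrA subrK.
by rewrite opprB (addrC (x - y)) -(H a y x) -(H a b y).
Qed.

Variables (R : realType) (m : nat) (S : compartmental R m).
Hypotheses (S_closed : closed_system S) (hC1 : C1 S) (hC2 : C2 S).
Implicit Types (w : vfield R m) (s t v e r : R) (i : 'I_m.+1) (j : 'I_m).

Lemma flux_entry_le (u : flux R m) i j : `|u.1 i j| <= `|u|.
Proof.
rewrite prod_normE le_max /=; apply/orP; left; rewrite /Num.Def.normr /= mx_normrE.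
exact: (le_bigmax _ (fun ij => `|u.1 ij.1 ij.2|) (i, j)).
Qed.

Lemma flux_row_le (u : flux R m) j : `|u.2 ord0 j| <= `|u|.
Proof. by rewrite prod_normE le_max /= row_norm_ge orbT. Qed.

Lemma flux_norm_lt (u : flux R m) e : 0 < e -> (forall i j, `|u.1 i j| < e) ->
  (forall j, `|u.2 ord0 j| < e) -> `|u| < e.
Proof.
move=> e0 u1 u2; rewrite prod_normE gt_max; apply/andP; split; last exact: row_norm_lt.
rewrite /Num.Def.normr /= mx_normrE; apply: bigmax_lt => // -[i j] _ /=; exact: u1.
Qed.

Definition G w i j t v : R := (w (t, v)).1 i j.

Lemma G_gtilde i j t v : G (gtilde S) i j t v = pipe S i j t v.
Proof. by rewrite /G /gtilde mxE. Qed.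

Lemma Omega_compact : compact (Omega S).
Proof. by case: hC2. Qed.

Lemma Omega_translate t w : Omega S w -> Omega S (translate t w).
Proof. by case: hC2 => _ _ + _ => /(_ t w). Qed.

Lemma Omega_nonempty : Omega S !=set0.
Proof. by case: hC2. Qed.

Lemma Omega_approx w T e : Omega S w -> 0 < e -> exists s, wnear w T e (translate s (gtilde S)).
Proof. by move=> Ow e0; have [_ [[s _ <-] h]] := Ow _ (wnear_nbhs w T e0); exists s. Qed.

Lemma Omega_two w t v v' e : Omega S w -> 0 < e -> exists t', forall i j,
  `|G w i j t v - pipe S i j t' v| < e /\ `|G w i j t v' - pipe S i j t' v'| < e.
Proof.
move=> Ow e0; have [s sP] := Omega_approx (Num.max `|t| (Num.max `|v| `|v'|)) Ow e0.
exists (s + t) => i j; split.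
  have := sP (t, v); rewrite /square /= !le_max !lexx !orbT => /(_ (conj isT isT)).
  apply: le_lt_trans; rewrite distrC.
  have := flux_entry_le (translate s (gtilde S) (t, v) - w (t, v)) i j.
  by rewrite !mxE.
have := sP (t, v'); rewrite /square /= !le_max !lexx !orbT => /(_ (conj isT isT)).
apply: le_lt_trans; rewrite distrC.
have := flux_entry_le (translate s (gtilde S) (t, v') - w (t, v')) i j.
by rewrite !mxE.
Qed.

Lemma G_mono w i j t v v' : Omega S w -> v <= v' -> G w i j t v <= G w i j t v'.
Proof.
move=> Ow vv'; apply/ler_addgt0Pr => e e0; have e20 : 0 < e / 2 by lra.
have [t' /(_ i j)[]] := Omega_two t v v' Ow e20.
have [_ /(_ i j t' v v' vv') + _] := hC1.
by rewrite !ltr_norml => h /andP[h1 h2] /andP[h3 h4]; lra.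
Qed.

Lemma G_zero w i j t : Omega S w -> G w i j t 0 = 0.
Proof.
move=> Ow; apply/eqP; rewrite -normr_eq0 eq_le normr_ge0 andbT; apply/ler_addgt0Pr => e e0.
have [t' /(_ i j)[+ _]] := Omega_two t 0 0 Ow e0.
by have [_ _ ->] := hC1; rewrite subr0 add0r => /ltW.
Qed.

Lemma G_env w j t v : Omega S w -> G w ord0 j t v = 0.
Proof.
move=> Ow; apply/eqP; rewrite -normr_eq0 eq_le normr_ge0 andbT; apply/ler_addgt0Pr => e e0.
have [t' /(_ ord0 j)[+ _]] := Omega_two t v v Ow e0.
by have [_ ->] := S_closed; rewrite subr0 add0r => /ltW.
Qed.

Lemma inflow_Omega w j t v : Omega S w -> (w (t, v)).2 ord0 j = 0.
Proof.
move=> Ow; apply/eqP; rewrite -normr_eq0 eq_le normr_ge0 andbT; apply/ler_addgt0Pr => e e0.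
have [s sP] := Omega_approx (Num.max `|t| `|v|) Ow e0.
have := sP (t, v); rewrite /square /= !le_max !lexx !orbT => /(_ (conj isT isT)).
move=> /ltW/(le_trans _) h; rewrite add0r; apply: h.
have := flux_row_le (translate s (gtilde S) (t, v) - w (t, v)) j.
by rewrite !mxE; have [-> _] := S_closed; rewrite sub0r normrN.
Qed.

(** On the hull a bound for the monotone [v |-> G w i j t v] at [- r] and [r] is
    enough. *)
Lemma G_bound r : exists2 B, 0 <= B & forall w i j t v, Omega S w -> `|v| <= r -> `|G w i j t v| <= B.
Proof.
have [_ _ ad _] := let: And3 h _ _ := hC1 in h.
have [_ [B1 B1P]] := ad r; have [_ [B2 B2P]] := ad (- r).
exists (Num.max `|B1| `|B2|) => [|w i j t v Ow vr]; first by rewrite le_max normr_ge0.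
have e1 t' : `|pipe S i j t' r| <= Num.max `|B1| `|B2|.
  rewrite le_max; apply/orP; left; rewrite -G_gtilde; apply: le_trans (flux_entry_le _ i j) _.
  by apply: le_trans (B1P t') (ler_norm _).
have e2 t' : `|pipe S i j t' (- r)| <= Num.max `|B1| `|B2|.
  rewrite le_max; apply/orP; right; rewrite -G_gtilde; apply: le_trans (flux_entry_le _ i j) _.
  by apply: le_trans (B2P t') (ler_norm _).
apply/ler_addgt0Pr => e e0; have [t' /(_ i j)[+ _]] := Omega_two t v v Ow e0.
have [_ mono _] := hC1; move: vr; rewrite ler_norml => /andP[vr1 vr2].
have := mono i j t' _ _ vr1; have := mono i j t' _ _ vr2.
have := e1 t'; have := e2 t'; set B := Num.max _ _.
rewrite !ler_norml ltr_norml => /andP[h1 h2] /andP[h3 h4] h5 h6 /andP[h7 h8].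
by apply/andP; split; lra.
Qed.

Lemma entry_derivable i j t v : derivable (pipe S i j t) v 1.
Proof.
have [der _ _ _] := let: And3 h _ _ := hC1 in h.
have /cvg_ex[/= l lP] := der t v.
apply/cvg_ex; exists (l.1 i j).
have ce : continuous (fun u : flux R m => u.1 i j).
  move=> u; apply: (@continuous_comp _ _ _ fst (fun A : 'M[R]_(m.+1, m) => A i j)).
    exact: cvg_fst.
  exact: coord_continuous.
have H : (h^-1 *: (gtilde S (t, h%:A + v) - gtilde S (t, v))).1 i j @[h --> 0^'] --> l.1 i j.
  by apply: (@continuous_cvg _ _ _ _ _ _ (fun u : flux R m => u.1 i j)); [exact: ce|exact: lP].
have E : (fun h : R => h^-1 *: ((pipe S i j t \o shift v) h%:A - pipe S i j t v)) =
    (fun h => (h^-1 *: (gtilde S (t, h%:A + v) - gtilde S (t, v))).1 i j).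
  by apply/funext => h; rewrite /= !mxE.
by rewrite E; exact: H.
Qed.

Lemma pipe_slope i j t v v' : v <= v' -> exists2 u, v <= u <= v' &
  pipe S i j t v' - pipe S i j t v = dpipe S i j t u * (v' - v).
Proof.
rewrite le_eqVlt => /orP[/eqP->|vv'].
  by exists v'; rewrite ?lexx// !subrr mulr0.
have [||c] := @MVT R (pipe S i j t) (dpipe S i j t) v v' vv'.
- move=> x _; rewrite /dpipe derive1E; apply: DeriveDef => //; exact: entry_derivable.
- apply: continuous_subspaceT => x.
  by apply/differentiable_continuous/derivable1_diffP; exact: entry_derivable.
rewrite in_itv /= => /andP[c1 c2] E; exists c => //; by rewrite !ltW.
Qed.

Lemma G_slope_ge w i j (c : R) : Omega S w -> (forall t v, c <= dpipe S i j t v) ->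
  forall t v v', v <= v' -> c * (v' - v) <= G w i j t v' - G w i j t v.
Proof.
move=> Ow cd t v v' vv'; apply/ler_addgt0Pr => e e0; have e20 : 0 < e / 2 by lra.
have [t' /(_ i j)[]] := Omega_two t v v' Ow e20.
have [u _ uE] := pipe_slope i j t' vv'.
have : c * (v' - v) <= dpipe S i j t' u * (v' - v) by rewrite ler_wpM2r// subr_ge0.
by rewrite -uE !ltr_norml => h /andP[h1 h2] /andP[h3 h4]; lra.
Qed.

Lemma G_slope_le w i j (d : R) : Omega S w -> (forall t v, dpipe S i j t v <= d) ->
  forall t v v', v <= v' -> G w i j t v' - G w i j t v <= d * (v' - v).
Proof.
move=> Ow cd t v v' vv'; apply/ler_addgt0Pr => e e0; have e20 : 0 < e / 2 by lra.
have [t' /(_ i j)[]] := Omega_two t v v' Ow e20.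
have [u _ uE] := pipe_slope i j t' vv'.
have : dpipe S i j t' u * (v' - v) <= d * (v' - v) by rewrite ler_wpM2r// subr_ge0.
by rewrite -uE !ltr_norml => h /andP[h1 h2] /andP[h3 h4]; lra.
Qed.

(** Continuity in each variable becomes joint continuity because the
    nonlinearities are monotone in the second one. *)
Lemma pipe_continuous i j : continuous (fun p : R * R => pipe S i j p.1 p.2).
Proof.
have [_ _ ad _] := let: And3 h _ _ := hC1 in h.
have ct v : continuous (fun t => pipe S i j t v).
  have [uc _] := ad v; move=> t; apply/cont_epsP => e e0.
  have := uc _ (entourage_ball _ (PosNum e0)).
  rewrite /nbhs /= -entourage_ballE => -[d /= d0 dP].
  exists d => // u ut; have := dP (u, t); rewrite /= ball_prod_normE => /(_ ut).
  apply: le_lt_trans; have := flux_entry_le (gtilde S (u, v) - gtilde S (t, v)) i j.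
  by rewrite !mxE.
have cv t : continuous (pipe S i j t).
  by move=> v; apply/differentiable_continuous/derivable1_diffP; exact: entry_derivable.
apply/(@cont_ballP R (R * R)%type R^o) => -[t0 v0] e e0; have e20 : 0 < e / 2 by lra.
have [d d0 dP] := (cont_epsP _ v0).1 (cv t0 v0) _ e20.
have [d1 d10 d1P] := (cont_epsP _ t0).1 (ct (v0 + d / 2) t0) _ e20.
have [d2 d20 d2P] := (cont_epsP _ t0).1 (ct (v0 - d / 2) t0) _ e20.
exists (Num.min (d / 2) (Num.min d1 d2)) => /=.
  by rewrite !lt_min d10 d20 divr_gt0.
move=> [t v] [/=]; rewrite -!ball_normE /= !lt_min => /and3P[_ t1 t2] /and3P[v1 _ _].
have [_ mono _] := hC1.
rewrite distrC in t1; rewrite distrC in t2.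
move: v1; rewrite ltr_norml => /andP[v1 v2].
have m1 : pipe S i j t v <= pipe S i j t (v0 + d / 2) by apply: mono; lra.
have m2 : pipe S i j t (v0 - d / 2) <= pipe S i j t v by apply: mono; lra.
have := dP (v0 + d / 2); rewrite (_ : v0 + d / 2 - v0 = d / 2); last by ring.
rewrite gtr0_norm; last by lra.
have := dP (v0 - d / 2); rewrite (_ : v0 - d / 2 - v0 = - (d / 2)); last by ring.
rewrite normrN gtr0_norm; last by lra.
have dd : d / 2 < d by lra.
move=> /(_ dd) + /(_ dd); have := d1P t t1; have := d2P t t2.
rewrite !ltr_norml => /andP[? ?] /andP[? ?] /andP[? ?] /andP[? ?]; apply/andP; split; lra.
Qed.

Lemma gtilde_continuous : continuous (gtilde S : R * R -> flux R m).
Proof.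
apply/(@cont_ballP R (R * R)%type (flux R m)) => p e e0.
have [|[i j]|d d0 dP] := @common_radius R ('I_m.+1 * 'I_m)%type
    (fun ij d => forall q : R * R, ball p d q -> `|pipe S ij.1 ij.2 p.1 p.2 - pipe S ij.1 ij.2 q.1 q.2| < e).
- by move=> ij d d' _ d'd H q qP; apply: H; exact: le_ball d'd _ qP.
- by have /(@cont_ballP R (R * R)%type R^o)/(_ p _ e0)[d d0 dP] := @pipe_continuous i j; exists d.
exists d => // q qP; apply: flux_norm_lt => // [i j|j]; rewrite !mxE; first exact: (dP (i, j)).
by rewrite !S_closed.1 subrr normr0.
Qed.

Lemma Omega_continuous w : Omega S w -> continuous (w : R * R -> flux R m).
Proof.
move=> Ow; apply/(@cont_ballP R (R * R)%type (flux R m)) => p e e0; have e30 : 0 < e / 3 by lra.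
have [s sP] := Omega_approx (Num.max `|p.1| `|p.2| + 1) Ow e30.
have /(@cont_ballP R (R * R)%type (flux R m))/(_ (s + p.1, p.2) _ e30)[d d0 dP] := gtilde_continuous.
exists (Num.min d 1) => [|q]; first by rewrite lt_min d0 ltr01.
rewrite ball_prod_normE /= prod_normE gt_max !lt_min => /andP[/andP[/= qd1 q1] /andP[/= qd2 q2]].
have c1 : `|translate s (gtilde S) p - translate s (gtilde S) q| < e / 3.
  apply: dP; split; rewrite /= -ball_normE /=; last exact: qd2.
  by rewrite (_ : s + p.1 - (s + q.1) = p.1 - q.1)//; ring.
have hp := sP p _; have hq := sP q _.
have {}hp : `|translate s (gtilde S) p - w p| < e / 3.
  by apply: hp; split; rewrite ler_wpDr// le_max lexx ?orbT.
have {}hq : `|translate s (gtilde S) q - w q| < e / 3.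
  apply: hq; split.
    rewrite (_ : q.1 = p.1 - (p.1 - q.1)); last by ring.
    by apply: le_trans (ler_normB _ _) _; apply: lerD; [rewrite le_max lexx|exact: ltW].
  rewrite (_ : q.2 = p.2 - (p.2 - q.2)); last by ring.
  by apply: le_trans (ler_normB _ _) _; apply: lerD; [rewrite le_max lexx orbT|exact: ltW].
have -> : w p - w q = (translate s (gtilde S) p - translate s (gtilde S) q) - (translate s (gtilde S) p - w p) + (translate s (gtilde S) q - w q).
  exact: three_point.
apply: le_lt_trans (ler_normD _ _) _.
have := ler_normB (translate s (gtilde S) p - translate s (gtilde S) q) (translate s (gtilde S) p - w p).
lra.
Qed.

Lemma G_continuous w i j : Omega S w -> continuous (fun p : R * R => G w i j p.1 p.2).
Proof.
move=> /Omega_continuous/(@cont_ballP R (R * R)%type (flux R m)) H.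
apply/(@cont_ballP R (R * R)%type R^o) => p e /(H p)[d d0 dP]; exists d => // q /dP.
apply: le_lt_trans; case: p {dP} q => p1 p2 [q1 q2].
by have := flux_entry_le (w (p1, p2) - w (q1, q2)) i j; rewrite !mxE.
Qed.

Lemma translate_near w t T e : Omega S w -> 0 < e -> exists d T' e', [/\ 0 < d, 0 < e' &
  forall w' t', wnear w T' e' w' -> `|t' - t| < d -> wnear (translate t w) T e (translate t' w')].
Proof.
move=> Ow e0; have e20 : 0 < e / 2 by lra.
have [d d0 dP] := heine_cantor (@square_compact R (T + `|t|)) (Omega_continuous Ow) e20.
exists (Num.min d 1), (T + `|t| + 1), (e / 2); split=> //; first by rewrite lt_min d0 ltr01.
move=> w' t' w'P; rewrite lt_min => /andP[t'd t'1] -[s v] [/= sT vT].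
have T0 : 0 <= T by apply: le_trans sT.
have tt : `|t'| <= `|t| + 1.
  by rewrite (_ : t' = t + (t' - t)); [apply: le_trans (ler_normD _ _) _; rewrite lerD2l ltW|ring].
have h1 : `|w' (t' + s, v) - w (t' + s, v)| < e / 2.
  apply: w'P; split=> /=; last by have := normr_ge0 t; lra.
  by apply: le_trans (ler_normD _ _) _; lra.
have h2 : `|w (t + s, v) - w (t' + s, v)| < e / 2.
  apply: dP.
    split=> /=; last by have := normr_ge0 t; lra.
    by apply: le_trans (ler_normD _ _) _; lra.
  split=> /=; rewrite -ball_normE /=; last by rewrite subrr normr0.
  by rewrite (_ : t + s - (t' + s) = - (t' - t)) ?normrN//; ring.
rewrite /translate /= (_ : _ - _ = (w' (t' + s, v) - w (t' + s, v)) - (w (t + s, v) - w (t' + s, v))).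
  by apply: le_lt_trans (ler_normB _ _) _; lra.
by rewrite opprB addrA subrK.
Qed.

(** Minimality of the hull is about the two-sided flow; a closed set invariant
    in one time direction still contains an invariant one. *)
Lemma Omega_minimal (sg : R) (A : set (vfield R m)) : sg = 1 \/ sg = -1 ->
  A `<=` Omega S -> compact A -> A !=set0 ->
  (forall t w, 0 <= t -> A w -> A (translate (sg * t) w)) -> A = Omega S.
Proof.
move=> sg1 AO cA A0 Ainv.
have hv := @vfield_hausdorff R m.
have phiD (s t : R) w : 0 <= s -> 0 <= t -> translate (sg * (s + t)) w = translate (sg * s) (translate (sg * t) w).
  by move=> _ _; rewrite translateD mulrDr.
have [x xP] := @nested_images R _ (fun t w => translate (sg * t) w) A hv
  (fun s => @translate_continuous R m (sg * s)) phiD cA A0 (fun t w h => @Ainv t w h).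
pose B := [set w | A w /\ forall t, A (translate t w)].
have sgK t : sg * (sg * t) = t by case: sg1 => ->; rewrite ?mul1r// !mulN1r opprK.
have xB t : A (translate t x).
  have [t0|t0] := leP 0 (sg * t).
    by have := Ainv _ _ t0 _; rewrite sgK; apply; have [y Ay <-] := xP 0 (lexx 0); rewrite mulr0 translate0.
  have [|y Ay <-] := xP (- (sg * t)); first by lra.
  by rewrite translateD mulrN sgK subrr translate0.
have Bx : B x by split; [have := xB 0; rewrite translate0|exact: xB].
have BA : B `<=` A by move=> w [].
have cB : compact B.
  apply: (subclosed_compact _ cA BA) => w clw.
  have clA (v : vfield R m) : closure A v -> A v by exact: (compact_closed hv cA).
  split; first by apply: clA => U nU; have [u [[Au _] Uu]] := clw _ nU; exists u.
  move=> t; apply: clA => U nU.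
  by have [u [[_ uA] Uu]] := clw _ (translate_continuous nU); exists (translate t u); split=> //; exact: uA.
have BO : B = Omega S.
  case: hC2 => _ _ _; apply.
  - exact: subset_trans BA AO.
  - by exists x.
  - exact: cB.
  - by move=> t w [_ wB]; split=> [|s]; [exact: wB|rewrite translateD; exact: wB].
by apply/seteqP; split=> //; rewrite -BO.
Qed.

End Hull.

(** * The vector field and the total mass along a curve *)

Section Field.
Variables (R : realType) (m : nat) (S : compartmental R m).
Hypotheses (S_closed : closed_system S) (hC1 : C1 S) (hC2 : C2 S) (hC3 : C3 S) (hC4 : C4 S) (hC5 : C5 S).
Implicit Types (w : vfield R m) (s t v e r T : R) (i j : 'I_m) (z h : R -> 'rV[R]_m).
Local Notation I := (neg R).
Local Notation DD := (DD S).
Hint Resolve measurable_neg : core.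

Definition FF w z t i : R := F S (translate t w) (seg z t) ord0 i.
Definition MM w z t : R := M S (translate t w) (seg z t).

(** The flow from compartment [j] towards compartment [i] at its entrance. *)
Definition rate w z i j t : R := G w (cpt i) j t (z t ord0 j).

(** The mass of all the pipes. *)
Definition content w z t : R := \sum_i \sum_j pipe_mass (mu S j i) (rate w z j i) t.

Lemma rate_bcont w z r i j B : Omega S w -> BC z r ->
  (forall w' (i' : 'I_m.+1) j' t v, Omega S w' -> `|v| <= r -> `|G w' i' j' t v| <= B) -> bcont (rate w z i j) B.
Proof.
move=> Ow bz GB; split=> [t|t]; last by apply: GB => //; exact: bz.2.
apply/cont_epsP => e e0.
have /(@cont_ballP R (R * R)%type R^o)/(_ (t, z t ord0 j) _ e0)[d d0 dP] := @G_continuous _ _ _ S_closed hC1 w (cpt i) j Ow.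
have [d' d'0 d'P] := (cont_epsP _ t).1 ((BC_bcont j bz).1 t) _ d0.
exists (Num.min d d') => [|u]; first by rewrite lt_min d0.
rewrite lt_min => /andP[ud /d'P zd]; rewrite distrC; apply: (dP (u, z u ord0 j)).
by split=> /=; rewrite -ball_normE /= distrC.
Qed.

Lemma FFE w z t i : Omega S w ->
  FF w z t i = \sum_j (\int[mu S i j]_(s in I) rate w z i j (t + s)) - \sum_j rate w z j i t.
Proof.
move=> Ow; have Ot := Omega_translate hC2 (t := t) Ow.
rewrite /FF /F mxE /inflow_at (inflow_Omega S_closed) // addr0.
rewrite [g ord0 i _ _](_ : _ = 0); last exact: (G_env S_closed _ _ _ Ot).
rewrite oppr0 add0r addrC; congr (_ - _).
  apply: eq_bigr => j _; apply: eq_Rintegral => s; rewrite inE in_negP => s0.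
  by rewrite seg_clamp// /g /rate /G /translate /= addr0.
by apply: eq_bigr => j _; rewrite seg_clamp0 /g /rate /G /translate /= addr0.
Qed.

Lemma MME w z t : MM w z t = \sum_i DD z t i + content w z t.
Proof.
apply: (f_equal (fun x : R => \sum_i DD z t i + x)); rewrite /content /pipe_mass; apply: eq_bigr => i _; apply: eq_bigr => j _.
apply: eq_Rintegral => s; rewrite inE in_negP => s0; apply: eq_Rintegral => r.
rewrite inE /= in_itv /= => /andP[_ r0].
by rewrite seg_clamp// /g /rate /G /translate /= addr0.
Qed.

Lemma eq_FF w z h t i : (forall s, s <= t -> z s = h s) -> FF w z t i = FF w h t i.
Proof. by move=> zh; rewrite /FF (eq_seg zh). Qed.

Lemma eq_MM w z h t : (forall s, s <= t -> z s = h s) -> MM w z t = MM w h t.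
Proof. by move=> zh; rewrite /MM (eq_seg zh). Qed.

Lemma sum_FF w z t : Omega S w ->
  \sum_i FF w z t i = \sum_i \sum_j ((\int[mu S j i]_(s in I) rate w z j i (t + s)) - rate w z j i t).
Proof.
move=> Ow; under eq_bigr do rewrite FFE//.
under [RHS]eq_bigr do rewrite sumrB.
by rewrite !sumrB; congr (_ - _); rewrite exchange_big.
Qed.

(** Closedness of the system: all that leaves a compartment enters a pipe, and
    all that leaves a pipe enters a compartment. *)
Lemma content_slope w z r t eta : Omega S w -> BC z r -> 0 < eta -> exists2 d, 0 < d &
  forall k, `|k| < d -> `|content w z (t + k) - content w z t + k * \sum_i FF w z t i| <= eta * `|k|.
Proof.
move=> Ow bz eta0; have [B B0 GB] := G_bound hC1 r.
have n0 : 0 < ((m * m)%N%:R + 1 : R) by rewrite ltr_wpDl.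
pose eta' := eta / ((m * m)%N%:R + 1).
have eta'0 : 0 < eta' by rewrite divr_gt0.
have [|[i j]|d d0 dP] := @common_radius R ('I_m * 'I_m)%type (fun ij d => forall k, `|k| < d ->
  `|pipe_mass (mu S ij.2 ij.1) (rate w z ij.2 ij.1) (t + k) - pipe_mass (mu S ij.2 ij.1) (rate w z ij.2 ij.1) t -
    k * (rate w z ij.2 ij.1 t - \int[mu S ij.2 ij.1]_(s in I) rate w z ij.2 ij.1 (t + s))| <= eta' * `|k|).
- by move=> ij d d' _ dd H k kd; apply: H; exact: lt_le_trans dd.
- have [d d0 dP] := pipe_mass_slope (hC3 j i).1 (hC3 j i).2 t (rate_bcont j i Ow bz GB) eta'0.
  by exists d.
exists d => // k kd; rewrite sum_FF// /content -sumrB mulr_sumr -big_split /=.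
apply: (@le_trans _ _ (\sum_(i < m) \sum_(j < m) eta' * `|k|)).
  apply: le_trans (ler_norm_sum _ _ _) _; apply: ler_sum => i _.
  rewrite -sumrB mulr_sumr -big_split /=; apply: le_trans (ler_norm_sum _ _ _) _; apply: ler_sum => j _.
  by rewrite -[X in k * X]opprB mulrN; exact: (dP (i, j) k kd).
rewrite !sumr_const card_ord -mulrnA -mulr_natl mulrA ler_wpM2r// /eta' mulrC.
rewrite -mulrA ler_piMr ?(ltW eta0)// mulrC ler_pdivrMr// mul1r lerDl//.
Qed.

Lemma content_continuous w z r : Omega S w -> BC z r -> continuous (content w z).
Proof.
move=> Ow bz t; apply/cont_epsP => e e0.
have [d d0 dP] := content_slope t Ow bz ltr01.
set c := \sum_i FF w z t i in dP.
have c0 : 0 < `|c| + 1 by rewrite ltr_wpDl.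
exists (Num.min d (e / (`|c| + 1))) => [|u]; first by rewrite lt_min d0 divr_gt0.
rewrite lt_min => /andP[/dP]; rewrite mul1r (_ : t + (u - t) = u); last by ring.
move=> h1; rewrite ltr_pdivlMr// mulrDr mulr1 => h2.
rewrite -[X in `|X|](addrK ((u - t) * c)).
by apply: le_lt_trans (ler_normB _ _) _; rewrite normrM; lra.
Qed.

Lemma MM_continuous w z r : Omega S w -> BC z r -> continuous (MM w z).
Proof.
move=> Ow bz; rewrite (_ : MM w z = fun t => \sum_i DD z t i + content w z t); last by apply/funext => t; exact: MME.
have c1 : continuous (fun t => \sum_i DD z t i).
  apply: continuous_sum => i; exact: (@DD_continuous _ _ S z r i bz).
by move=> t; apply: cvgD; [exact: c1|exact: content_continuous Ow bz t].
Qed.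

(** Mass is nondecreasing in the history for the order of [D], because [D]-order
    implies the usual order and the flows are monotone. *)
Lemma MM_le w z h r t : Omega S w -> BC z r -> BC h r ->
  (forall s i, s <= t -> DD z s i <= DD h s i) ->
  MM w z t + \sum_i (DD h t i - DD z t i) <= MM w h t.
Proof.
move=> Ow bz bh Dzh; have [B B0 GB] := G_bound hC1 r.
rewrite !MME sumrB.
suff : content w z t <= content w h t.
  by move: (content _ _ _) (content _ _ _) (\sum_i _) (\sum_i _) => a b c d; lra.
apply: ler_sum => i _; apply: ler_sum => j _.
apply: (le_pipe_mass (hC3 j i).2 (rate_bcont j i Ow bz GB) (rate_bcont j i Ow bh GB)) => s st.
by apply: (G_mono hC1) => //; exact: (DD_le hC4 bz bh Dzh i st).
Qed.

Lemma dsup_ge0 k i : (0 <= dsup S k i)%E.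
Proof.
have [u _ uE] := pipe_slope hC1 k i 0 (@ler01 R).
apply: (@le_trans _ _ (dpipe S k i 0 u)%:E).
  rewrite lee_fin; move: uE; rewrite subr0 mulr1 => <-.
  by rewrite subr_ge0; have [_ + _] := hC1; apply.
by apply: ereal_sup_ubound; exists (0, u).
Qed.

Lemma cinf_real i j : exists2 c, 0 <= c & cinf S (cpt i) j = c%:E.
Proof.
have c0 : (0 <= cinf S (cpt i) j)%E.
  have := hC5 i j (@measurable_neg R) (fun _ H => H).
  rewrite (hC3 i j).1 mule1; apply: contraTT; rewrite -!ltNge => c0.
  rewrite (le_lt_trans _ c0)// -[leRHS]adde0 leeD2l// oppe_le0.
  by apply: sume_ge0 => k _; rewrite mule_ge0// dsup_ge0.
have : (cinf S (cpt i) j < +oo)%E.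
  apply: (@le_lt_trans _ _ (dpipe S (cpt i) j 0 0)%:E); last exact: ltry.
  by apply: ereal_inf_lbound; exists (0, 0).
by case: (cinf S (cpt i) j) c0 => // c; rewrite lee_fin => c0 _; exists c.
Qed.

(** An infinite slope out of a compartment forces its neutral delays to be
    empty; otherwise (C5) is an inequality between finite measures. *)
Lemma C5_cases i : (forall j, mass (nu S i j) = 0) \/
  exists d : 'I_m.+1 -> R, (forall k, 0 <= d k /\ forall t v, dpipe S k i t v <= d k) /\
   forall j, exists2 c, 0 <= c /\ (forall t v, c <= dpipe S (cpt i) j t v) &
     forall A, measurable A -> A `<=` I -> ((\sum_k d k)%:E * nu S i j A <= c%:E * mu S i j A)%E.
Proof.
have [[k kinf]|Hfin] := pselect (exists k, dsup S k i = +oo%E).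
  left=> j; apply/eqP; rewrite eq_le mass_ge0 andbT leNgt; apply/negP => m0.
  have := hC5 i j (@measurable_neg R) (fun _ H => H).
  have -> : (\sum_k dsup S k i * nu S i j I = +oo)%E.
    apply/eqP; rewrite -leye_eq (bigD1 k)//=.
    have -> : (dsup S k i * nu S i j I = +oo)%E by rewrite kinf massE gt0_mulye ?lte_fin.
    by apply: leeDl; apply: sume_ge0 => k' _; rewrite mule_ge0 ?dsup_ge0.
  have [c c0 ->] := cinf_real i j.
  by rewrite (hC3 i j).1 mule1.
right.
have dfin k : exists2 d, 0 <= d & dsup S k i = d%:E.
  have := dsup_ge0 k i; case E : (dsup S k i) => [d| |] //; first by rewrite lee_fin; exists d.
  by case: Hfin; exists k.
pose d k := s2val (cid2 (dfin k)).
have d0 k : 0 <= d k by rewrite /d; case: cid2.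
have dE k : dsup S k i = (d k)%:E by rewrite /d; case: cid2.
exists d; split=> [k|j].
  split=> // t v; rewrite -lee_fin -dE; apply: ereal_sup_ubound; by exists (t, v).
have [c c0 cE] := cinf_real i j; exists c.
  split=> // t v; rewrite -lee_fin -cE; apply: ereal_inf_lbound; by exists (t, v).
move=> A mA AI; have := hC5 i j mA AI; rewrite cE.
under eq_bigr do rewrite dE.
rewrite -ge0_sume_distrl; last by move=> k _; rewrite lee_fin.
rewrite sumEFin sube_ge0//; apply/orP; right.
by rewrite fin_numM// fin_num_measure.
Qed.

Import HBNNSimple.

Lemma le_measure_int_on (m1 m2 : {measure set R -> \bar R}) (f : R -> \bar R) :
  (forall A, measurable A -> A `<=` I -> (m1 A <= m2 A)%E) ->
  (forall x, (0 <= f x)%E) -> measurable_fun setT f ->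
  (\int[m1]_(x in I) f x <= \int[m2]_(x in I) f x)%E.
Proof.
move=> m12 f0 mf; rewrite !ge0_integralE //= ge_ereal_sup// => _ [h/= hfS] <-.
apply: le_ereal_sup_tmp; exists (sintegral m2 h); first by exists h.
rewrite !sintegralE lee_fsum// => r [t _ <-].
have [->|ht] := eqVneq (h t) 0; first by rewrite !mul0e.
rewrite lee_pmul ?lee_fin ?m12//.
move=> x /= hx; apply: contrapT => nIx; have := hfS x.
rewrite /patch; case: ifPn => [|_]; first by rewrite inE.
rewrite lee_fin hx => h0; move/eqP: ht; apply; apply/eqP; rewrite eq_le h0 /=.
exact: (@fun_ge0 _ _ h t).
Qed.

Lemma int_dominated (m1 m2 : {finite_measure set R -> \bar R}) (a b : R) f B : 0 <= a -> 0 <= b ->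
  (forall A, measurable A -> A `<=` I -> (a%:E * m1 A <= b%:E * m2 A)%E) ->
  bcont f B -> (forall s, s <= 0 -> 0 <= f s) ->
  a * \int[m1]_(s in I) f s <= b * \int[m2]_(s in I) f s.
Proof.
move=> a0 b0 m12 bf f0.
pose f' s := f (Num.min s 0).
have bf' : bcont f' B by exact: bcont_comp_min.
have f'0 s : 0 <= f' s by apply: f0; rewrite ge_min lexx orbT.
have ff' (n : {finite_measure set R -> \bar R}) : \int[n]_(s in I) f s = \int[n]_(s in I) f' s.
  by apply: eq_Rintegral => s; rewrite inE in_negP => s0; rewrite /f' min_l.
rewrite !ff' -lee_fin !EFinM.
have mf : measurable_fun setT (EFin \o f').
  by apply/measurable_EFinP; apply: continuous_measurable_fun; case: bf'.
have fE (n : {finite_measure set R -> \bar R}) : (\int[n]_(s in I) f' s)%:E = (\int[n]_(s in I) (EFin \o f') s)%E.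
  by rewrite fineK//; apply: integrable_fin_num => //; exact: neg_integrable bf'.
rewrite !fE.
have := @le_measure_int_on (mscale (NngNum a0) m1) (mscale (NngNum b0) m2) (EFin \o f') m12 _ mf.
rewrite !ge0_integral_mscale//=; try by move=> *; rewrite lee_fin.
- by apply=> x; rewrite lee_fin.
- exact: measurable_funTS.
- exact: measurable_funTS.
Qed.

(** The only terms of [F] that can decrease when the history grows are the
    outflows of compartment [i]; since [D] agrees at [t], they grow by at most
    their largest slope times the growth of the delayed terms of [D], which (C5)
    compares with the growth of the inflows. *)
Lemma quasi_monotone w z h r t i : Omega S w -> BC z r -> BC h r ->
  (forall s j, s <= t -> DD z s j <= DD h s j) -> DD z t i = DD h t i ->
  FF w z t i <= FF w h t i.
Proof.
move=> Ow bz bh Dzh Dti; have [B B0 GB] := G_bound hC1 r.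
have zh s j : s <= t -> z s ord0 j <= h s ord0 j by exact: (DD_le hC4 bz bh Dzh).
have bB := BCB bh bz.
pose e j s := (h (t + s) - z (t + s)) ord0 j.
have be j : bcont (e j) (r + r) by exact: bcont_shift (BC_bcont j bB).
have e0 j s : s <= 0 -> 0 <= e j s by move=> s0; rewrite /e !mxE subr_ge0 zh//; lra.
have pE : h t ord0 i - z t ord0 i = \sum_j \int[nu S i j]_(s in I) e j s.
  have := DDB S t i bh bz; rewrite Dti subrr DDE !mxE => /eqP; rewrite subr_eq0 => /eqP ->.
  by apply: eq_bigr.
set p := _ - _ in pE.
have p0 : 0 <= p by rewrite subr_ge0 zh.
rewrite !FFE//.
have bz' j k := bcont_shift t (rate_bcont j k Ow bz GB).
have bh' j k := bcont_shift t (rate_bcont j k Ow bh GB).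
have dI j : \int[mu S i j]_(s in I) rate w h i j (t + s) - \int[mu S i j]_(s in I) rate w z i j (t + s) =
    \int[mu S i j]_(s in I) (rate w h i j (t + s) - rate w z i j (t + s)).
  by rewrite RintegralB//; [exact: neg_integrable (bh' i j)|exact: neg_integrable (bz' i j)].
suff : \sum_j (rate w h j i t - rate w z j i t) <=
       \sum_j \int[mu S i j]_(s in I) (rate w h i j (t + s) - rate w z i j (t + s)).
  by rewrite -(eq_bigr _ (fun j _ => dI j)) !sumrB; lra.
have bd j : bcont (fun s => rate w h i j (t + s) - rate w z i j (t + s)) (B + B).
  have [c1 l1] := bh' i j; have [c2 l2] := bz' i j; split=> s.
    by apply: cvgB; [exact: c1|exact: c2].
  by apply: le_trans (ler_normB _ _) _; rewrite lerD.
case: (C5_cases i) => [m0|[d [dP cP]]].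
  have p00 : p = 0.
    rewrite pE big1// => j _; apply/eqP; rewrite eq_le; apply/andP; split.
      have := int_le_cst (nu S i j) (be j) (c := r + r); rewrite m0 mulr0; apply=> s _.
      by apply: le_trans (ler_norm _) _; case: (be j).
    by apply: Rintegral_ge0 => s; rewrite in_negP; exact: e0.
  have -> : \sum_j (rate w h j i t - rate w z j i t) = 0.
    rewrite big1// => j _; rewrite /rate (_ : h t ord0 i = z t ord0 i) ?subrr//.
    by apply/eqP; rewrite -subr_eq0 -/p p00.
  apply: sumr_ge0 => j _; apply: Rintegral_ge0 => s; rewrite in_negP => s0.
  by rewrite subr_ge0; apply: (G_mono hC1) => //; apply: zh; lra.
apply: (@le_trans _ _ ((\sum_k d k) * p)).
  rewrite big_ord_recl mulrDl -[leLHS]add0r lerD//; first by rewrite mulr_ge0// (dP _).1.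
  rewrite mulr_suml; apply: ler_sum => j _.
  by apply: (@G_slope_le _ _ _ hC1 w (cpt j) i (d (cpt j)) Ow (dP _).2); exact: zh.
rewrite pE mulr_sumr; apply: ler_sum => j _.
have [c [c0 cd] cA] := cP j.
have d0 : 0 <= \sum_k d k by apply: sumr_ge0 => k _; case: (dP k).
apply: le_trans (int_dominated d0 c0 cA (be j) (e0 j)) _.
rewrite -RintegralZl//; last exact: neg_integrable (be j).
apply: (@le_int _ _ _ _ (Num.max (c * (r + r)) (B + B))).
- have [ce le_] := be j; split=> [s|s]; first by apply: cvgM; [exact: cvg_cst|exact: ce].
  by rewrite normrM ger0_norm// le_max ler_wpM2l.
- by have [ce le_] := bd j; split=> // s; rewrite le_max le_ orbT.
move=> s s0; rewrite /e !mxE; apply: (@G_slope_ge _ _ _ hC1 w (cpt i) j c Ow cd).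
by apply: zh; lra.
Qed.

End Field.

(** * Balance of mass, subsolutions and comparison *)

(** The hypotheses on the system, bundled because every statement about its
    solutions rests on them. *)
Record standing (R : realType) (m : nat) (S : compartmental R m) : Prop := Standing {
  st_pos : (0 < m)%N; st_closed : closed_system S; st_reg : F_regular S; st_C1 : C1 S;
  st_C2 : C2 S; st_C3 : C3 S; st_C4 : C4 S; st_C5 : C5 S }.

Section Dynamics.
Variables (R : realType) (m : nat) (S : compartmental R m).
Hypothesis H : standing S.
Let S_closed := st_closed H.
Let hC1 := st_C1 H.
Let hC2 := st_C2 H.
Let hC3 := st_C3 H.
Let hC4 := st_C4 H.
Let hC5 := st_C5 H.
Implicit Types (w : vfield R m) (s t e r T a b : R) (i j : 'I_m) (z h y : R -> 'rV[R]_m).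
Local Notation DD := (DD S).
Local Notation FF := (FF S).
Local Notation MM := (MM S).
Local Notation kap := (kap S).
Local Notation Dinv := (Dinv S).

Definition DDrow z t : 'rV[R]_m := \row_i DD z t i.

Lemma BC_DDrow z r : BC z r -> BC (DDrow z) (r + kap * r).
Proof.
move=> bz; split=> [|t i].
  apply/continuous_rowP => i; have cD := @DD_continuous _ _ S z r i bz.
  by rewrite (_ : (fun t => _) = fun t => DD z t i)//; apply/funext => t; rewrite mxE.
by rewrite mxE DDE; apply: le_trans (ler_normB _ _) _; rewrite lerD ?bz.2// delay_bound.
Qed.

(** Differentiability stated with explicit increments, relative to [J]; at an
    end point of [J] it is the one-sided derivative. *)
Definition solves w z (J : set R) := forall t i, J t -> forall eta : R, 0 < eta ->
  exists2 d, 0 < d & forall k, J (t + k) -> `|k| < d ->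
   `|DD z (t + k) i - DD z t i - k * FF w z t i| <= eta * `|k|.

(** Only the past of [t] is involved, so that this property survives any change
    of [z] after [t]. *)
Definition leftsol w z t := forall i eta, 0 < eta -> exists2 d, 0 < d &
  forall e, 0 < e -> e < d -> `|DD z (t - e) i - DD z t i + e * FF w z t i| <= eta * e.

Lemma solves_leftsol w z (J : set R) a t : solves w z J -> a < t -> (forall s, a <= s <= t -> J s) -> leftsol w z t.
Proof.
move=> sz at_ HJ i eta eta0; have Jt : J t by apply: HJ; rewrite lexx ltW.
have [d d0 dP] := sz t i Jt eta eta0.
exists (Num.min d (t - a)) => [|e e0]; first by rewrite lt_min d0 subr_gt0.
rewrite lt_min => /andP[ed ea].
have := dP (- e); rewrite normrN gtr0_norm// mulNr opprK; apply => //.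
by apply: HJ; lra.
Qed.

Lemma eq_leftsol w z h t : (forall s, s <= t -> z s = h s) -> leftsol w z t -> leftsol w h t.
Proof.
move=> zh lz i eta /(lz i)[d d0 dP]; exists d => // e e0 ed.
have := dP e e0 ed; rewrite (eq_FF S w i zh) (eq_DD S i zh).
by rewrite (@eq_DD _ _ S z h (t - e))// => s st; apply: zh; lra.
Qed.

(** [h] is a subsolution near [t] as soon as each coordinate is touched from
    below, at time [t], by a solution that stays below in all coordinates: the
    maximum of finitely or infinitely many solutions is of this kind. *)
Definition touched w h t := forall i, exists z r, [/\ BC z r, leftsol w z t,
  (forall s j, s <= t -> DD z s j <= DD h s j) & DD z t i = DD h t i].

Lemma leftsol_touched w z r t : BC z r -> leftsol w z t -> touched w z t.
Proof. by move=> bz lz i; exists z, r; split. Qed.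

Lemma touched_left w h r t i eta : Omega S w -> BC h r -> touched w h t -> 0 < eta ->
  exists2 d, 0 < d & forall e, 0 < e -> e < d -> DD h t i - DD h (t - e) i <= e * FF w h t i + eta * e.
Proof.
move=> Ow bh /(_ i)[z [r' [bz lz zh zhi]]] eta0.
have [d d0 dP] := lz i eta eta0; exists d => // e e0 ed.
have := dP e e0 ed; rewrite ler_norml => /andP[h1 _].
have h2 : DD z (t - e) i <= DD h (t - e) i by apply: zh; lra.
have h3 : FF w z t i <= FF w h t i.
  have bz' : BC z (Num.max r r') by apply: BC_le bz; rewrite le_max lexx orbT.
  have bh' : BC h (Num.max r r') by apply: BC_le bh; rewrite le_max lexx.
  exact: (quasi_monotone S_closed hC1 hC2 hC3 hC4 hC5 Ow bz' bh' zh zhi).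
have h4 : e * FF w z t i <= e * FF w h t i by rewrite ler_pM2l.
move: h1 h2 h4; rewrite zhi; move: (DD _ _ _) (DD _ _ _) (DD _ _ _) (_ * FF w z t i) (_ * FF w h t i).
by move=> x1 x2 x3 x4 x5; lra.
Qed.

(** The delayed terms cancel in the balance of mass, which therefore changes at
    the rate of the sum over [i] of the derivative of [DD h t i] minus
    [FF w h t i]; for a touched function no term of that sum is positive. *)
Lemma MM_nonincreasing w h r a b : Omega S w -> BC h r -> a <= b ->
  (forall t, a < t <= b -> touched w h t) -> MM w h b <= MM w h a.
Proof.
move=> Ow bh ab th; apply: dini_le => //.
  exact: (MM_continuous S_closed hC1 hC2 hC3 Ow bh).
move=> t tab eta eta0.
have m0 : 0 < (m%:R + 1 : R) by rewrite ltr_wpDl.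
pose eta' := eta / (m%:R + 1); have eta'0 : 0 < eta' by rewrite divr_gt0.
have etaE : eta = m%:R * eta' + eta' by rewrite -[X in _ + X]mul1r -mulrDl /eta' mulrC divfK// gt_eqF.
have [|i|d1 d10 d1P] := @common_radius R 'I_m (fun i d => forall e, 0 < e -> e < d ->
  DD h t i - DD h (t - e) i <= e * FF w h t i + eta' * e).
- by move=> j d d' _ dd HH e e0 ed; apply: HH => //; exact: lt_le_trans dd.
- exact: touched_left Ow bh (th t tab) eta'0.
have [d2 d20 d2P] := content_slope S_closed hC1 hC2 hC3 t Ow bh eta'0.
exists (Num.min d1 d2) => [|e e0]; first by rewrite lt_min d10.
rewrite lt_min => /andP[ed1 ed2].
have := d2P (- e); rewrite normrN gtr0_norm// => /(_ ed2); rewrite mulNr ler_norml => /andP[h1 _].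
have : \sum_i (DD h t i - DD h (t - e) i) <= \sum_i (e * FF w h t i + eta' * e).
  by apply: ler_sum => i _; exact: d1P.
rewrite sumrB big_split /= -mulr_sumr sumr_const card_ord -[_ *+ m]mulr_natl.
move: h1; rewrite !MME etaE; move: (content _ _ _ _) (content _ _ _ _) (\sum_i DD h t i) (\sum_i DD h (t - e) i) (e * \sum_i _).
by move=> x1 x2 x3 x4 x5; rewrite mulrDl mulrA; move: (m%:R * eta' * e) (eta' * e) => y1 y2; lra.
Qed.

(** The balance of mass is exact along a solution. *)
Lemma MM_conserved w z r a b : Omega S w -> BC z r -> a <= b ->
  (forall t, a < t <= b -> leftsol w z t) -> MM w z b = MM w z a.
Proof.
move=> Ow bz ab lz; apply/eqP; rewrite eq_le; apply/andP; split.
  by apply: (MM_nonincreasing Ow bz ab) => t /lz; exact: (leftsol_touched bz).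
apply: dini_ge => //.
  exact: (MM_continuous S_closed hC1 hC2 hC3 Ow bz).
move=> t tab eta eta0.
have m0 : 0 < (m%:R + 1 : R) by rewrite ltr_wpDl.
pose eta' := eta / (m%:R + 1); have eta'0 : 0 < eta' by rewrite divr_gt0.
have etaE : eta = m%:R * eta' + eta' by rewrite -[X in _ + X]mul1r -mulrDl /eta' mulrC divfK// gt_eqF.
have [|i|d1 d10 d1P] := @common_radius R 'I_m (fun i d => forall e, 0 < e -> e < d ->
  `|DD z (t - e) i - DD z t i + e * FF w z t i| <= eta' * e).
- by move=> j d d' _ dd HH e e0 ed; apply: HH => //; exact: lt_le_trans dd.
- exact: lz tab i eta' eta'0.
have [d2 d20 d2P] := content_slope S_closed hC1 hC2 hC3 t Ow bz eta'0.
exists (Num.min d1 d2) => [|e e0]; first by rewrite lt_min d10.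
rewrite lt_min => /andP[ed1 ed2].
have := d2P (- e); rewrite normrN gtr0_norm// => /(_ ed2); rewrite mulNr ler_norml => /andP[_ h1].
have : \sum_i (DD z (t - e) i - DD z t i + e * FF w z t i) <= \sum_(i < m) eta' * e.
  by apply: ler_sum => i _; apply: le_trans (ler_norm _) (d1P _ _ _ _).
rewrite big_split /= sumrB -mulr_sumr sumr_const card_ord -[_ *+ m]mulr_natl.
move: h1; rewrite !MME etaE; move: (content _ _ _ _) (content _ _ _ _) (\sum_i DD z t i) (\sum_i DD z (t - e) i) (e * \sum_i _).
by move=> x1 x2 x3 x4 x5; rewrite mulrDl mulrA; move: (m%:R * eta' * e) (eta' * e) => y1 y2; lra.
Qed.

Lemma sum_upper_bound (x : 'I_m -> R) a i : (forall j, x j <= a) -> `|\sum_j x j| <= a ->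
  `|x i| <= (m%:R + 1) * a.
Proof.
move=> xa sa0; have a0 : 0 <= a := le_trans (normr_ge0 _) sa0.
move: sa0; rewrite ler_norml => /andP[sa _].
have ma : 0 <= m%:R * a by rewrite mulr_ge0.
rewrite mulrDl mul1r ler_norml; apply/andP; split; last by have := xa i; lra.
have : \sum_j (a - x j) >= a - x i.
  by rewrite (bigD1 i)//= lerDl; apply: sumr_ge0 => j _; rewrite subr_ge0.
by rewrite sumrB sumr_const card_ord -mulr_natl; lra.
Qed.

(** A subsolution along which mass is conserved is a solution: no coordinate
    can grow slower than the field without losing mass. *)
Lemma touched_solves w h r : Omega S w -> BC h r -> (forall t, touched w h t) ->
  (forall i, continuous (fun t => FF w h t i)) ->
  (forall s t, MM w h s = MM w h t) -> solves w h setT.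
Proof.
move=> Ow bh th cF Mc t i _ eta eta0.
have m0 : 0 < (m%:R + 1 : R) by rewrite ltr_wpDl.
pose eta' := eta / (m%:R + 1); have eta'0 : 0 < eta' by rewrite divr_gt0.
have [|j|d1 d10 d1P] := @common_radius R 'I_m (fun i d => forall u, `|u - t| < d -> `|FF w h u i - FF w h t i| < eta').
- by move=> j d d' _ dd HH u ud; apply: HH => //; exact: lt_le_trans dd.
- by have [d d0 dP] := (cont_epsP _ t).1 (cF j t) _ eta'0; exists d.
have up a b j : t - d1 < a -> a <= b -> b < t + d1 -> DD h b j - DD h a j <= (b - a) * (FF w h t j + eta').
  move=> ta ab bt.
  have := @dini_le R (fun u => DD h u j - (FF w h t j + eta') * u) a b ab.
  move=> HH; suff : DD h b j - (FF w h t j + eta') * b <= DD h a j - (FF w h t j + eta') * a.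
    rewrite mulrBl !(mulrC _ (FF w h t j + eta')); move: (DD _ _ _) (DD _ _ _) (_ * b) (_ * a) => x1 x2 x3 x4; lra.
  apply: HH.
    move=> u; apply: cvgB; first exact: (@DD_continuous _ _ S h r j bh).
    by apply: cvgM; [exact: cvg_cst|exact: cvg_id].
  move=> u uab e e0; have [d d0 dP] := touched_left j Ow bh (th u) e0.
  exists d => // k k0 kd; have := dP k k0 kd.
  have : FF w h u j <= FF w h t j + eta'.
    have /(d1P j) : `|u - t| < d1 by rewrite ltr_distl; lra.
    by rewrite ltr_distl => /andP[_ /ltW].
  move=> h1; have : k * FF w h u j <= k * (FF w h t j + eta') by rewrite ler_pM2l.
  rewrite mulrBr [(_ + _) * k]mulrC.
  by move: (DD _ _ _) (DD _ _ _) (k * _) (k * _) (_ * u) (e * k) => x1 x2 x3 x4 x5 x6; lra.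
have [d2 d20 d2P] := content_slope S_closed hC1 hC2 hC3 t Ow bh eta'0.
exists (Num.min d1 d2) => [|k _]; first by rewrite lt_min d10.
rewrite lt_min => /andP[kd1 kd2].
have := d2P k kd2.
have -> : content S w h (t + k) - content S w h t = - \sum_j (DD h (t + k) j - DD h t j).
  by have := Mc (t + k) t; rewrite !MME sumrB; move: (content _ _ _ _) (content _ _ _ _) (\sum_i _) (\sum_i _) => x1 x2 x3 x4; lra.
have etaE : eta * `|k| = (m%:R + 1) * (eta' * `|k|) by rewrite mulrA; congr (_ * _); rewrite /eta' mulrC divfK// gt_eqF.
rewrite mulr_sumr addrC -sumrB => h1; rewrite etaE.
have [k0|k0] := leP 0 k.
  apply: (@sum_upper_bound (fun j => DD h (t + k) j - DD h t j - k * FF w h t j)) => [j|].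
    have := @up t (t + k) j; rewrite ger0_norm// in kd1.
    rewrite addrAC subrr add0r mulrDr => HH.
    have : t - d1 < t by lra.
    move=> /HH{}HH; have : t <= t + k by lra.
    move=> /HH{}HH; have : t + k < t + d1 by lra.
    move=> /HH; rewrite ger0_norm// [k * eta']mulrC.
    by move: (DD _ _ _) (DD _ _ _) (k * _) (_ * k) => x1 x2 x3 x4; lra.
  rewrite -normrN -sumrN; move: h1; congr (_ <= _); congr `|_|; apply: eq_bigr => j _.
  by rewrite [RHS]opprB.
rewrite -normrN; apply: (@sum_upper_bound (fun j => - (DD h (t + k) j - DD h t j - k * FF w h t j))) => [j|].
  have := @up (t + k) t j; rewrite ltr0_norm// in kd1.
  rewrite opprD addrA subrr sub0r mulrDr mulNr => HH.
  have : t - d1 < t + k by lra.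
  move=> /HH{}HH; have : t + k <= t by lra.
  move=> /HH{}HH; have : t < t + d1 by lra.
  move=> /HH; rewrite ltr0_norm// [- k * eta']mulrC.
  by move: (DD _ _ _) (DD _ _ _) (k * _) (eta' * - k) => x1 x2 x3 x4; lra.
by move: h1; congr (_ <= _); congr `|_|; apply: eq_bigr => j _; rewrite [RHS]opprB.
Qed.

(** The join of two curves for the order of [D]: it is in general not their
    pointwise maximum. *)
Definition Dmax z h := Dinv (fun t => \row_i Num.max (DD z t i) (DD h t i)).

Lemma DmaxP z h r : BC z r -> BC h r -> BC (Dmax z h) ((r + kap * r) / (1 - kap)) /\
  forall t i, DD (Dmax z h) t i = Num.max (DD z t i) (DD h t i).
Proof.
move=> bz bh; have [|b1 b2] := @DinvP _ _ S hC4 (fun t => \row_i Num.max (DD z t i) (DD h t i)) (r + kap * r).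
  have [cz lz] := BC_DDrow bz; have [ch lh] := BC_DDrow bh.
  split=> [|t i].
    apply/continuous_rowP => i; rewrite (_ : (fun t => _) = fun t => Num.max (DD z t i) (DD h t i)); last first.
      by apply/funext => t; rewrite mxE.
    by move=> t; apply: continuous_max; exact: (@DD_continuous _ _ S _ r i).
  rewrite mxE; case: (leP (DD z t i) (DD h t i)) => _; first by have := lh t i; rewrite mxE.
  by have := lz t i; rewrite mxE.
by split=> // t i; rewrite b2 mxE.
Qed.

(** The excess mass of the maximum over [h] vanishes initially and does not
    increase, and it bounds the positive part of the difference. *)
Lemma comparison w z h r a b : Omega S w -> BC z r -> BC h r -> a <= b ->
  (forall t, a < t <= b -> leftsol w z t) -> (forall t, a < t <= b -> leftsol w h t) ->
  (forall s j, s <= a -> DD z s j <= DD h s j) ->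
  forall s j, s <= b -> DD z s j <= DD h s j.
Proof.
move=> Ow bz bh ab lz lh zh s j sb.
have [sa|as_] := leP s a; first exact: zh.
have [bM DM] := DmaxP bz bh.
set g := Dmax z h in bM DM.
have tg t : a < t <= s -> touched w g t.
  move=> /andP[at_ ts] i; have tab : a < t <= b by rewrite at_ (le_trans ts).
  have [zhi|zhi] := leP (DD z t i) (DD h t i).
    exists h, r; split=> //; [exact: lh|by move=> u k _; rewrite DM le_max lexx orbT|].
    by rewrite DM max_r.
  exists z, r; split=> //; [exact: lz|by move=> u k _; rewrite DM le_max lexx|].
  by rewrite DM max_l// ltW.
have h1 := MM_nonincreasing Ow bM (ltW as_) tg.
have gh u : u <= a -> g u = h u.
  apply: (DD_inj hC4 bM bh) => v k va; rewrite DM max_r//; exact: zh.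
have h2 : MM w g a = MM w h a by exact: eq_MM.
have h3 : MM w h s = MM w h a.
  by apply: (MM_conserved Ow bh (ltW as_)) => t /andP[at_ ts]; apply: lh; rewrite at_ (le_trans ts).
pose r' := Num.max r ((r + kap * r) / (1 - kap)).
have bh' : BC h r' by apply: BC_le bh; rewrite le_max lexx.
have bg' : BC g r' by apply: BC_le bM; rewrite le_max lexx orbT.
have h4 : MM w h s + \sum_i (DD g s i - DD h s i) <= MM w g s.
  by apply: (MM_le S_closed hC1 hC3 hC4 Ow bh' bg') => u k _; rewrite DM le_max lexx orbT.
have : \sum_i (DD g s i - DD h s i) <= 0.
  by rewrite -(lerD2l (MM w h s)) addr0; apply: le_trans h4 _; rewrite h3 -h2.
move=> /(sum_le0 (x := fun i => DD g s i - DD h s i) j) h5.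
have : DD g s j - DD h s j <= 0.
  by apply: h5 => k; rewrite subr_ge0 DM le_max lexx orbT.
by rewrite subr_le0 DM; apply: le_trans; rewrite le_max lexx.
Qed.

(** Comparison in both directions. *)
Lemma uniqueness w z h r a b : Omega S w -> BC z r -> BC h r -> a <= b ->
  (forall t, a < t <= b -> leftsol w z t) -> (forall t, a < t <= b -> leftsol w h t) ->
  (forall s, s <= a -> z s = h s) -> forall s, s <= b -> z s = h s.
Proof.
move=> Ow bz bh ab lz lh zh.
have E s j : s <= a -> DD z s j = DD h s j.
  by move=> sa; apply: eq_DD => u us; apply: zh; exact: le_trans sa.
apply: (DD_inj hC4 bz bh) => s j sb; apply/eqP; rewrite eq_le; apply/andP; split.
  by apply: (comparison Ow bz bh ab lz lh) => // u k ua; rewrite E.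
by apply: (comparison Ow bh bz ab lh lz) => // u k ua; rewrite E.
Qed.

End Dynamics.

(** * Regularity and separation of solutions *)

Section Regularity.
Variables (R : realType) (m : nat) (S : compartmental R m).
Hypothesis H : standing S.
Let S_closed := st_closed H.
Let hC1 := st_C1 H.
Let hC2 := st_C2 H.
Let hC3 := st_C3 H.
Let hC4 := st_C4 H.
Let hC5 := st_C5 H.
Implicit Types (w : vfield R m) (s t e r T L a b : R) (i j : 'I_m) (z h y : R -> 'rV[R]_m) (x : hist R m).
Local Notation DD := (DD S).
Local Notation FF := (FF S).
Local Notation kap := (kap S).
Local Notation Dinv := (Dinv S).
Local Notation leftsol := (leftsol S).
Local Notation solves := (solves S).

Definition ucont z := forall e, 0 < e -> exists2 d, 0 < d &
  forall s t, `|t - s| < d -> `|z t - z s| < e.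

Definition Dlip z L := forall s t i, `|DD z t i - DD z s i| <= L * `|t - s|.

Lemma lip_ucont z L : lip z L -> ucont z.
Proof.
move=> lz e e0; have L1 : 0 < `|L| + 1 by rewrite ltr_wpDl.
exists (e / (`|L| + 1)) => [|s t st]; first by rewrite divr_gt0.
apply: row_norm_lt => // i; rewrite !mxE; apply: le_lt_trans (lz s t i) _.
apply: (@le_lt_trans _ _ ((`|L| + 1) * `|t - s|)); last by rewrite mulrC -ltr_pdivlMr.
by rewrite ler_wpM2r// (le_trans (ler_norm L))// lerDl.
Qed.

Lemma Dlip_lip z r L : 0 <= L -> BC z r -> Dlip z L -> lip z (L / (1 - kap)).
Proof.
move=> L0 bz Dz s t i; have := @DD_lip _ _ S hC4 z r (Num.max s t) L bz L0.
apply; rewrite ?le_max ?lexx ?orbT// => u v k _ _; exact: Dz.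
Qed.

Lemma min_lip (u v c : R) : `|Num.min u c - Num.min v c| <= `|u - v|.
Proof.
case: (leP u c) => uc; case: (leP v c) => vc //.
- by rewrite distrC (distrC u) !ger0_norm; lra.
- by rewrite !ger0_norm; lra.
- by rewrite subrr normr0.
Qed.

Lemma ext_clamp x s : ext x (Num.min s 0) = ext x s.
Proof. by rewrite /ext; congr x; apply: val_inj; rewrite /= -minA minxx. Qed.

Lemma BU_ext x : BU x -> ucont (ext x) /\ exists2 r, 0 <= r & BC (ext x) r.
Proof.
move=> [ux [r xr]].
have uc : ucont (ext x).
  move=> e e0; have := ux _ (entourage_ball _ (PosNum e0)).
  rewrite /nbhs /= -entourage_ballE => -[d /= d0 dP].
  exists d => // s t st; have := dP (clamp t, clamp s); rewrite /= -ball_normE /= /ext; apply.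
  rewrite /ball /=; exact: le_lt_trans (min_lip _ _ _) st.
split=> //; exists `|r| => //; split=> [t|t i].
  apply/cont_epsP => e /uc[d d0 dP]; exists d => // u ut; exact: dP.
by apply: le_trans (row_norm_ge _ _) _; apply: le_trans (xr _) (ler_norm _).
Qed.

Lemma BU_ball_BC r x : 0 <= r -> BU_ball r x -> BC (ext x) r.
Proof.
move=> r0 [bx xr]; have [_ [r' _ [cx _]]] := BU_ext bx; split=> // t i.
exact: le_trans (row_norm_ge _ _) (xr _).
Qed.

Lemma seg_BU z r t : 0 <= r -> BC z r -> ucont z -> BU_ball r (seg z t).
Proof.
move=> r0 bz uz.
have xr (s : past R) : `|seg z t s| <= r by apply/(row_normP _ r0) => i; exact: bz.2.
split=> //; split; last by exists r.
move=> E; rewrite -entourage_ballE => -[e /= e0 eE].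
have [d d0 dP] := uz e e0.
rewrite /nbhs /= -entourage_ballE; exists d => //= -[s u] /= su; apply: eE.
rewrite /= -ball_normE /= /seg; apply: dP.
rewrite (_ : t + val s - (t + val u) = val s - val u); last by ring.
exact: su.
Qed.

Lemma seg_BUext x t r : 0 <= r -> BU_ball r x -> BU_ball r (seg (ext x) t).
Proof.
move=> r0 bx; have [ux _] := BU_ext bx.1.
apply: seg_BU => //; exact: BU_ball_BC bx.
Qed.

Lemma F_bound r : exists2 C, 0 <= C & forall w x i, Omega S w -> BU_ball r x -> `|F S w x ord0 i| <= C.
Proof.
have [_ _ /(_ r)[C CP] _] := st_reg H; exists `|C| => // w x i Ow bx.
by apply: le_trans (row_norm_ge _ _) _; apply: le_trans (CP w x Ow bx) (ler_norm _).
Qed.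

Lemma F_near r w0 x0 e : Omega S w0 -> BU_ball r x0 -> 0 < e -> exists T d, [/\ 0 < T, 0 < d &
  forall w x, Omega S w -> BU_ball r x -> wnear w0 T d w -> xnear x0 T d x ->
    forall i, `|F S w x ord0 i - F S w0 x0 ord0 i| < e].
Proof.
move=> Ow0 bx0 e0; have [_ _ _ /(_ r)/subspace_continuousP cF] := st_reg H.
have /cvgrPdist_lt/(_ e e0) := cF (w0, x0) (conj Ow0 bx0).
rewrite /= => /state_basis[T [d [T0 d0 Td]]].
exists T, d; split=> // w x Ow bx wP xP i.
have := Td (w, x) (conj wP xP) (conj Ow bx); apply: le_lt_trans; rewrite distrC.
by have := row_norm_ge (F S w0 x0 - F S w x) i; rewrite !mxE.
Qed.

Lemma sup_norm_le x e : (forall s : past R, `|x s| <= e) -> sup_norm x <= e.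
Proof.
move=> xe; apply: ge_sup; first by exists `|x (clamp 0)|, (clamp 0).
by move=> _ [s _ <-].
Qed.

Lemma F_lip w0 x0 : Omega S w0 -> BU x0 -> exists L d T e, [/\ 0 <= L, 0 < d, 0 < e &
  forall w, Omega S w -> wnear w0 T e w -> forall (x y : hist R m) (k : R), BU x -> BU y ->
   (forall s : past R, `|x s - x0 s| <= d) -> (forall s : past R, `|y s - x0 s| <= d) ->
   (forall s : past R, `|x s - y s| <= k) -> forall i, `|F S w x ord0 i - F S w y ord0 i| <= L * k].
Proof.
move=> Ow0 bx0; have [_ + _ _] := st_reg H => /(_ w0 x0 Ow0 bx0)[L [d [d0]]].
move=> /wnear_basis[T [e [T0 e0 Te]]].
exists `|L|, d, T, e; split=> // w Ow wP x y k bx by_ xd yd xy i.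
have := Te w wP Ow x y bx by_ (sup_norm_le xd) (sup_norm_le yd).
set N := sup_norm (fun s : past R => x s - y s).
move=> h; apply: (@le_trans _ _ (L * N)).
  apply: le_trans h; have := row_norm_ge (F S w x - F S w y) i; by rewrite !mxE.
have s0 : 0 <= N.
  apply: le_trans (normr_ge0 (x (clamp 0) - y (clamp 0))) _.
  apply: ub_le_sup; last by exists (clamp 0).
  by exists k => _ [s _ <-]; exact: xy.
apply: (@le_trans _ _ (`|L| * N)).
  by rewrite ler_wpM2r// ler_norm.
by rewrite ler_wpM2l// sup_norm_le.
Qed.

(** The regularity hypothesis is about histories; here it is turned into joint
    continuity along curves. *)
Lemma FF_near r w z t e : 0 <= r -> Omega S w -> BC z r -> ucont z -> 0 < e -> exists T d, [/\ 0 < T, 0 < d &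
  forall w' z' t', Omega S w' -> BU_ball r (seg z' t') -> wnear w T d w' ->
   (forall s j, `|s - t| <= T -> `|z' s ord0 j - z s ord0 j| <= d) -> `|t' - t| < d ->
   forall i, `|FF w' z' t' i - FF w z t i| < e].
Proof.
move=> r0 Ow bz uz e0.
have [T0 [d0 [T00 d00 FP]]] := F_near (Omega_translate hC2 (t := t) Ow) (seg_BU t r0 bz uz) e0.
have [d1 [T1 [e1 [d10 e10 tP]]]] := translate_near S_closed hC1 t T0 Ow d00.
have d02 : 0 < d0 / 2 by lra.
have [d2 d20 uP] := uz _ d02.
exists (Num.max T1 (T0 + 1)), (Num.min (Num.min d1 d2) (Num.min (Num.min e1 (d0 / 4)) 1)).
split; first by rewrite lt_max; apply/orP; right; lra.
  by rewrite !lt_min d10 d20 e10 ltr01 !andbT; lra.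
move=> w' z' t' Ow' bz' w'P z'P; rewrite !lt_min => /andP[/andP[td1 td2] /andP[/andP[te1 td0] t1]] i.
apply: FP => //; first exact: Omega_translate.
- apply: tP => //; apply: wnear_mono w'P; first by rewrite le_max lexx.
  by rewrite !ge_min lexx !orbT.
move=> s Ts; rewrite /seg.
have h1 : `|z' (t' + val s) - z (t' + val s)| < d0 / 2.
  apply: row_norm_lt => // j; rewrite !mxE.
  have : `|t' + val s - t| <= Num.max T1 (T0 + 1).
    rewrite le_max; apply/orP; right.
    have := past_le0 s; move: Ts t1; rewrite /recent /= ltr_distl ler_distl => ? /andP[? ?] ?.
    apply/andP; split; lra.
  move=> /(z'P _ j)/le_lt_trans; apply.
  by rewrite !gt_min; apply/orP; right; apply/orP; left; apply/orP; right; lra.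
have h2 : `|z (t' + val s) - z (t + val s)| < d0 / 2.
  by apply: uP; rewrite (_ : t' + val s - (t + val s) = t' - t)//; ring.
rewrite -(subrK (z (t' + val s)) (z' (t' + val s))) -addrA.
by apply: le_lt_trans (ler_normD _ _) _; lra.
Qed.

Lemma FF_continuous r w z i : 0 <= r -> Omega S w -> BC z r -> ucont z -> continuous (fun t => FF w z t i).
Proof.
move=> r0 Ow bz uz t; apply/cont_epsP => e e0.
have [T [d [T0 d0 FP]]] := FF_near t r0 Ow bz uz e0.
exists d => // u ud; apply: FP => //.
- exact: seg_BU.
- by move=> p _; rewrite subrr normr0.
- by move=> s j _; rewrite subrr normr0 ltW.
Qed.

Lemma FF_bound r : 0 <= r -> exists2 C, 0 <= C & forall w z t i, Omega S w -> BU_ball r (seg z t) -> `|FF w z t i| <= C.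
Proof.
move=> r0; have [C C0 CP] := F_bound r; exists C => // w z t i Ow bz.
by apply: CP => //; exact: Omega_translate.
Qed.

Lemma increments w z r a b i (v eta : R) : Omega S w -> BC z r -> a <= b ->
  (forall t, a < t <= b -> leftsol w z t) -> (forall t, a < t <= b -> `|FF w z t i - v| <= eta) ->
  `|DD z b i - DD z a i - (b - a) * v| <= eta * (b - a).
Proof.
move=> Ow bz ab lz Fv.
have cf (c : R) : continuous (fun t => DD z t i - c * t).
  move=> u; apply: cvgB; first exact: (@DD_continuous _ _ S z r i bz).
  by apply: cvgM; [exact: cvg_cst|exact: cvg_id].
have h1 : DD z b i - (v + eta) * b <= DD z a i - (v + eta) * a.
  apply: (@dini_le R (fun t => DD z t i - (v + eta) * t)) => // t tab e e0.
  have [d d0 dP] := lz t tab i e e0; exists d => // k k0 kd.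
  have := dP k k0 kd; have := Fv t tab; rewrite ler_norml => /andP[_ h].
  have : k * (FF w z t i) <= k * (v + eta) by rewrite ler_pM2l//; lra.
  rewrite ler_norml => h2 /andP[h3 _]; rewrite mulrBr [(v + eta) * k]mulrC.
  by move: h2 h3; move: (DD _ _ _) (DD _ _ _) (k * _) (k * _) (_ * t) (e * k) => x1 x2 x3 x4 x5 x6; lra.
have h2 : DD z a i - (v - eta) * a <= DD z b i - (v - eta) * b.
  apply: (@dini_ge R (fun t => DD z t i - (v - eta) * t)) => // t tab e e0.
  have [d d0 dP] := lz t tab i e e0; exists d => // k k0 kd.
  have := dP k k0 kd; have := Fv t tab; rewrite ler_norml => /andP[h _].
  have : k * (v - eta) <= k * (FF w z t i) by rewrite ler_pM2l//; lra.
  rewrite ler_norml => h2 /andP[_ h3]; rewrite mulrBr [(v - eta) * k]mulrC.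
  by move: h2 h3; move: (DD _ _ _) (DD _ _ _) (k * _) (k * _) (_ * t) (e * k) => x1 x2 x3 x4 x5 x6; lra.
by rewrite ler_norml; move: h1 h2; move: (DD z b i) (DD z a i) => x1 x2 h1 h2; apply/andP; split; lra.
Qed.

(** Limits of solutions for the compact-open topology are solutions, as long
    as everything stays in one ball. *)
Lemma solves_limit w z r (J : set R) : 0 <= r -> Omega S w -> BC z r -> ucont z ->
  (forall s t u, J s -> J u -> s <= t <= u -> J t) ->
  (forall T e, 0 < T -> 0 < e -> exists w' z', [/\ Omega S w', BC z' r, wnear w T e w',
     (forall s j, `|s| <= T -> `|z' s ord0 j - z s ord0 j| <= e) &
     forall t, J t -> `|t| <= T -> BU_ball r (seg z' t) /\ leftsol w' z' t]) ->
  solves w z J.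
Proof.
move=> r0 Ow bz uz Jc app t i Jt eta eta0.
have [T1 [d1 [T10 d10 FP]]] := FF_near t r0 Ow bz uz eta0.
exists d1 => // k Jtk kd; apply/ler_addgt0Pr => ze ze0.
have ze2 : 0 < ze / 2 by lra.
have [T2 T20 [d2 d20 DP]] := DD_small hC4 r0 ze2.
pose T := `|t| + `|k| + T1 + T2 + 1.
have T0 : 0 < T by rewrite /T; have := normr_ge0 t; have := normr_ge0 k; lra.
have [|w' [z' [Ow' bz' ww' zz' Jz']]] := app T (Num.min d1 d2) T0; first by rewrite lt_min d10.
have DDzz' u : `|u - t| <= `|k| -> `|DD z' u i - DD z u i| <= ze / 2.
  move=> ut; apply: DP => // s j s1 s2; apply: le_trans (zz' _ _ _) _; last by rewrite ge_min lexx orbT.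
  move: ut; rewrite ler_distl => /andP[u1 u2].
  by rewrite /T ler_norml; have := ler_norm t; have := lerNnormlW (lexx `|t|); move=> ? ?; apply/andP; split; lra.
have uT u : `|u - t| <= `|k| -> `|u| <= T.
  move=> ut; rewrite -(subrK t u); apply: le_trans (ler_normD _ _) _; rewrite /T; lra.
have HF u : J u -> `|u - t| <= `|k| -> `|FF w' z' u i - FF w z t i| <= eta.
  move=> Ju ut; apply/ltW/FP => //.
  - by case: (Jz' u Ju (uT u ut)).
  - apply: wnear_mono ww'; last by rewrite ge_min lexx.
    by rewrite /T; have := normr_ge0 t; have := normr_ge0 k; lra.
  - move=> s j st; apply: le_trans (zz' _ _ _) _; last by rewrite ge_min lexx.
    rewrite -(subrK t s); apply: le_trans (ler_normD _ _) _; rewrite /T.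
    by have := normr_ge0 k; lra.
  - exact: le_lt_trans kd.
have key : `|DD z' (t + k) i - DD z' t i - k * FF w z t i| <= eta * `|k|.
  have [k0|k0] := leP 0 k.
    have := @increments w' z' r t (t + k) i (FF w z t i) eta Ow' bz'.
    rewrite (_ : t + k - t = k) ?(ger0_norm k0); last by ring.
    apply; first by lra.
      move=> u ut; have ut' : `|u - t| <= `|k| by rewrite (ger0_norm k0) ler_norml; lra.
      by case: (Jz' u (Jc t u (t + k) Jt Jtk _) (uT u ut')) => //; lra.
    move=> u ut; have ut' : `|u - t| <= `|k| by rewrite (ger0_norm k0) ler_norml; lra.
    by apply: HF => //; apply: (Jc t u (t + k)) => //; lra.
  have := @increments w' z' r (t + k) t i (FF w z t i) eta Ow' bz'.
  rewrite (_ : t - (t + k) = - k) ?(ltr0_norm k0); last by ring.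
  have flip (p q g : R) : `|p - q - k * g| = `|q - p - - k * g|.
    by rewrite -normrN; congr `|_|; rewrite mulNr; ring.
  rewrite flip.
  apply; first by lra.
    move=> u ut; have ut' : `|u - t| <= `|k| by rewrite (ltr0_norm k0) ler_norml; lra.
    by case: (Jz' u (Jc (t + k) u t Jtk Jt _) (uT u ut')) => //; lra.
  move=> u ut; have ut' : `|u - t| <= `|k| by rewrite (ltr0_norm k0) ler_norml; lra.
  by apply: HF => //; apply: (Jc (t + k) u t) => //; lra.
have h1 := DDzz' (t + k); have h2 := DDzz' t.
have {}h1 : `|DD z' (t + k) i - DD z (t + k) i| <= ze / 2.
  by apply: h1; rewrite (_ : t + k - t = k)//; ring.
have {}h2 : `|DD z' t i - DD z t i| <= ze / 2 by apply: h2; rewrite subrr normr0.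
exact: dist3 key h1 h2.
Qed.

Lemma gap_step (u u' v v' fu fv g e : R) : `|u' - u + fu| <= e / 2 -> `|v' - v + fv| <= e / 2 ->
  fu <= fv + g -> (v' - u') - (v - u) <= g + e.
Proof. by clear; rewrite !ler_norml => /andP[? ?] /andP[? ?] ?; lra. Qed.

(** Lower the coordinate [i] of [h] by the gap at time [t], but not below [z]:
    quasi-monotonicity compares [z] with the resulting curve, which meets it at
    time [t], and the Lipschitz condition on [F] compares that curve with [h]. *)
Lemma gap_cost w z h r L c i : 0 <= r -> 0 <= L -> Omega S w -> BC z r -> BC h r -> Dlip z L -> Dlip h L ->
  (forall s j, DD z s j <= DD h s j) -> DD z c i = DD h c i ->
  exists2 K, 0 <= K & exists2 d, 0 < d & forall t, `|t - c| < d ->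
    FF w z t i <= FF w h t i + K * (DD h t i - DD z t i).
Proof.
move=> r0 L0 Ow bz bh Dz Dh zh zhc.
have k1 := kap1 hC4.
pose a t := DD h t i - DD z t i.
have ca : continuous a by move=> u; apply: cvgB; [exact: (@DD_continuous _ _ S h r i bh)|exact: (@DD_continuous _ _ S z r i bz)].
have a0 t : 0 <= a t by rewrite subr_ge0.
have ac : a c = 0 by rewrite /a zhc subrr.
have lipz := Dlip_lip L0 bz Dz; have liph := Dlip_lip L0 bh Dh.
have uh := lip_ucont liph.
have [L1 [d1 [T1 [e1 [L10 d10 e10 FL]]]]] := F_lip (Omega_translate hC2 (t := c) Ow) (seg_BU c r0 bh uh).1.
have [d2 [T2 [e2 [d20 e20 tP]]]] := translate_near S_closed hC1 c T1 Ow e10.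
have d12 : 0 < d1 / 2 by lra.
have [d3 d30 uP] := uh _ d12.
have e4 : 0 < d1 / 2 * (1 - kap) by rewrite mulr_gt0.
have [d4 d40 aP] := (cont_epsP a c).1 (ca c) _ e4.
exists (L1 / (1 - kap)); first by rewrite divr_ge0// ltW.
exists (Num.min d2 (Num.min d3 d4)) => [|t]; first by rewrite !lt_min d20 d30.
rewrite -/(a t).
  rewrite !lt_min => /and3P[tc2 tc3 tc4].
  have at4 : a t < d1 / 2 * (1 - kap) by have := aP t tc4; rewrite ac subr0 ger0_norm.
  pose y s : 'rV[R]_m := \row_j (if j == i then Num.max (DD z s i) (DD h s i - a t) else DD h s j).
  have yh s j : `|DD h s j - y s ord0 j| <= a t.
    rewrite mxE; case: eqVneq => [->|_]; last by rewrite subrr normr0.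
    exact: max_gap.
  have yz s j : DD z s j <= y s ord0 j.
    by rewrite mxE; case: eqVneq => [->|_]; rewrite ?le_max ?lexx.
  have ylip s u j : `|y u ord0 j - y s ord0 j| <= L * `|u - s|.
    rewrite !mxE; case: eqVneq => [_|_]; last exact: Dh.
    apply: max_dist; first exact: Dz.
    by rewrite [X in `|X|](_ : _ = DD h u i - DD h s i); [exact: Dh|move: (DD h u i) (DD h s i) => p q; ring].
  have b_y : BC y (r + kap * r + a t).
    split; first exact: lip_continuous ylip.
    move=> s j; rewrite -[y s ord0 j](subKr (DD h s j)).
    apply: le_trans (ler_normB _ _) _; apply: lerD; last exact: yh.
    by have := (BC_DDrow S bh).2 s j; rewrite mxE.
  have [bh' h'y] := DinvP hC4 b_y.
  set h' := Dinv y in bh' h'y.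
  have Dh' : Dlip h' L by move=> s u j; rewrite !h'y; exact: ylip.
  have uh' := lip_ucont (Dlip_lip L0 bh' Dh').
  have r'0 : 0 <= (r + kap * r + a t) / (1 - kap).
    by rewrite divr_ge0 ?(ltW k1)// addr_ge0// addr_ge0// mulr_ge0// kap_ge0.
  have hh' s j : `|h s ord0 j - h' s ord0 j| <= a t / (1 - kap).
    have := @DD_bound _ _ S hC4 _ _ s (a t) (BCB bh bh') (a0 t) _ s j (lexx s).
    rewrite !mxE; apply=> u k _; rewrite (DDB S u k bh bh') h'y; exact: yh.
  have hh'n s : `|h' s - h s| <= a t / (1 - kap).
    have ak : 0 <= a t / (1 - kap) by rewrite divr_ge0// ltW.
    by rewrite distrC; apply/(row_normP _ ak) => j; rewrite !mxE; exact: hh'.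
  have step1 : FF w z t i <= FF w h' t i.
    pose r' := Num.max r ((r + kap * r + a t) / (1 - kap)).
    have bz' : BC z r' by apply: BC_le bz; rewrite le_max lexx.
    have bh'' : BC h' r' by apply: BC_le bh'; rewrite le_max lexx orbT.
    apply: (quasi_monotone S_closed hC1 hC2 hC3 hC4 hC5 Ow bz' bh'').
      by move=> s j _; rewrite h'y.
    by rewrite h'y mxE eqxx max_l// /a opprB addrCA subrr addr0.
  have hc (s : past R) : `|seg h t s - seg h c s| <= d1 / 2.
    apply/ltW/uP; rewrite (_ : t + val s - (c + val s) = t - c)//; ring.
  have ak2 : a t / (1 - kap) <= d1 / 2 by rewrite ler_pdivrMr// ltW.
  have := FL (translate t w) (Omega_translate hC2 Ow) _ (seg h' t) (seg h t) (a t / (1 - kap)).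
  move=> /(_ _ (seg_BU t r'0 bh' uh').1 (seg_BU t r0 bh uh).1 _ _ _ i) FL'.
  have : `|FF w h' t i - FF w h t i| <= L1 * (a t / (1 - kap)).
    apply: FL'.
    - apply: tP => //; exact: near_on_refl.
    - move=> s; rewrite -(subrK (seg h t s) (seg h' t s)) -addrA.
      by apply: le_trans (ler_normD _ _) _; have := hc s; have := hh'n (t + val s); rewrite /seg; lra.
    - by move=> s; apply: le_trans (hc s) _; lra.
    - by move=> s; exact: hh'n.
  rewrite ler_distl => /andP[_ h1]; apply: le_trans step1 _; apply: le_trans h1 _.
  by rewrite lerD2l mulrA mulrAC.
Qed.

(** A strict inequality in one coordinate persists: where the gap is small, it
    decreases at a rate proportional to itself at most. *)
Lemma separation w z h r L t0 t1 i : 0 <= r -> 0 <= L -> Omega S w -> BC z r -> BC h r -> Dlip z L -> Dlip h L ->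
  t0 <= t1 -> (forall t, t0 < t <= t1 -> leftsol w z t) -> (forall t, t0 < t <= t1 -> leftsol w h t) ->
  (forall s j, DD z s j <= DD h s j) -> DD z t0 i < DD h t0 i -> DD z t1 i < DD h t1 i.
Proof.
move=> r0 L0 Ow bz bh Dz Dh t01 lz lh zh zh0.
pose a t := DD h t i - DD z t i.
have ca : continuous a by move=> u; apply: cvgB; [exact: (@DD_continuous _ _ S h r i bh)|exact: (@DD_continuous _ _ S z r i bz)].
have a0 t : 0 <= a t by rewrite subr_ge0.
rewrite -subr_gt0 lt0r a0 andbT; apply/eqP => at1.
have [|c [t0c c1 ac pos]] := first_zero ca a0 t01 _ at1; first by rewrite subr_gt0.
have zhc : DD z c i = DD h c i by apply/esym/eqP; rewrite -subr_eq0 -/(a c) ac.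
have [K K0 [d d0 FFle]] := gap_cost r0 L0 Ow bz bh Dz Dh zh zhc.
suff : 0 < a c by rewrite ac ltxx.
apply: (gap_persists ca K0 d0 t0c (a0 c) pos) => t t0t tc td eta eta0.
have eta2 : 0 < eta / 2 by lra.
have tt : t0 < t <= t1 by rewrite t0t (le_trans tc).
have [da da0 daP] := lz t tt i _ eta2; have [db db0 dbP] := lh t tt i _ eta2.
exists (Num.min da db) => [|k k0]; first by rewrite lt_min da0.
rewrite lt_min => /andP[ka kb].
have h1 := daP k k0 ka; have h2 := dbP k k0 kb.
have h3 : k * FF w z t i <= k * FF w h t i + K * a t * k.
  by rewrite [_ * k]mulrC -mulrDr ler_pM2l//; exact: FFle.
by apply: gap_step h3; rewrite -mulrAC.
Qed.

End Regularity.

(** * Minimal sets consist of entire orbits *)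

Section Orbits.
Variables (R : realType) (m : nat) (S : compartmental R m).
Hypothesis H : standing S.
Implicit Types (w : vfield R m) (s t e r T L a b : R) (i j : 'I_m) (z h y : R -> 'rV[R]_m) (x : hist R m)
  (p q : vfield R m * hist R m) (K : set (vfield R m * hist R m)).
Local Notation DD := (DD S).
Local Notation FF := (FF S).
Local Notation leftsol := (leftsol S).
Local Notation solves := (solves S).

Definition state w z t : vfield R m * hist R m := (translate t w, seg z t).

(** Going back in time only forgets the recent part of a history. It is a
    continuous map on all states, while solutions need not extend to the past. *)
Definition back s p : vfield R m * hist R m := (translate (- s) p.1, shift_hist p.2 (clamp (- s))).

Lemma state_back w z t s : 0 <= s -> back s (state w z t) = state w z (t - s).
Proof.
move=> s0; rewrite /back /state /= translateD addrC; congr (_, _).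
apply/funext => u; rewrite /shift_hist /seg /= (_ : Num.min (- s) 0 = - s); last by rewrite min_l// oppr_le0.
rewrite min_l; first by congr z; ring.
by have := past_le0 u; rewrite /=; lra.
Qed.

Lemma back_state p s : 0 <= s -> back s p = state p.1 (ext p.2) (- s).
Proof. by move=> s0; rewrite /back /state seg_ext// oppr_le0. Qed.

Lemma backD s t p : 0 <= s -> 0 <= t -> back (s + t) p = back s (back t p).
Proof.
by move=> s0 t0; rewrite (back_state p t0) state_back// back_state ?addr_ge0//; congr state; ring.
Qed.

Definition pnear p T e := wnear p.1 T e `*` xnear p.2 T e.

Lemma pnear_nbhs p T e : 0 < e -> nbhs p (pnear p T e).
Proof. by case: p => w x; exact: state_nbhs. Qed.

Lemma pnear_basis p A : nbhs p A -> exists T e, [/\ 0 < T, 0 < e & pnear p T e `<=` A].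
Proof. by case: p => w x; exact: state_basis. Qed.

Lemma back_continuous s : continuous (back s).
Proof.
move=> p A /pnear_basis[T [e [T0 e0 TA]]].
apply: filterS (pnear_nbhs p (T + `|s|) e0) => q [wq xq]; apply: TA; split=> [[u v] [/= uT vT]|u Tu].
  apply: wq; split=> /=; last by apply: le_trans vT _; rewrite lerDl.
  by apply: le_trans (ler_normD _ _) _; rewrite normrN addrC lerD2r.
apply: xq; rewrite /recent /= le_min; apply/andP; split; last by have := normr_ge0 s; lra.
have : - `|s| <= Num.min (- s) 0 by rewrite le_min oppr_le0 normr_ge0 lerN2 ler_norm.
by move: Tu; rewrite /recent /= => ? ?; lra.
Qed.

Lemma past_ext z x t : seg z 0 = x -> t <= 0 -> ext x t = z t.
Proof. by move=> <- t0; rewrite ext_seg// add0r. Qed.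

Lemma difference_quotient (a b c : 'rV[R]_m) (k : R) i :
  (a - k *: (b - c)) ord0 i = a ord0 i - k * (b ord0 i - c ord0 i).
Proof. by rewrite !mxE. Qed.

Lemma eq_state w z h t : (forall s, s <= t -> z s = h s) -> state w z t = state w h t.
Proof. by move=> zh; rewrite /state (eq_seg zh). Qed.

Lemma state_shift w z t s : state (translate t w) (fun u => z (t + u)) s = state w z (t + s).
Proof. by rewrite /state translateD seg_shift addrC. Qed.

Lemma leftsol_shift w z t s : leftsol w z (t + s) -> leftsol (translate t w) (fun u => z (t + u)) s.
Proof.
move=> lz i eta /(lz i)[d d0 dP]; exists d => // e e0 ed.
have -> : FF (translate t w) (fun u => z (t + u)) s i = FF w z (t + s) i.
  by rewrite /FF translateD seg_shift addrC.
by rewrite !DD_shift addrA; exact: dP.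
Qed.

(** The multiplicative form of the difference quotient treats the right
    derivative at 0 and the two-sided derivative afterwards alike. *)
Lemma solutionP w x z : is_solution S w x z <->
  [/\ continuous z, seg z 0 = x & solves w z [set t | 0 <= t]].
Proof.
split=> -[cz z0 sz]; split=> //.
  move=> t i /= t0 eta eta0; have := sz t t0; move/cvgrPdist_lt => /(_ eta eta0).
  rewrite /= !nearE /= /within /= => -[d /= d0 dP]; exists d => // k tk kd.
  have [->|k0] := eqVneq k 0; first by rewrite addr0 subrr mul0r subrr normr0 mulr0.
  have := dP k; rewrite /= sub0r normrN => /(_ kd k0 tk)/ltW h1.
  have {}h1 := le_trans (row_norm_ge _ i) h1.
  rewrite difference_quotient in h1.
  rewrite (_ : _ - _ = - (k * (FF w z t i - k^-1 * (DD z (t + k) i - DD z t i)))); last by field.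
  by rewrite normrN normrM mulrC; apply: ler_wpM2r h1; exact: normr_ge0.
move=> t t0; apply/cvgrPdist_lt => e e0; have e2 : 0 < e / 2 by lra.
have [d d0 dP] : exists2 d, 0 < d & forall i k, 0 <= t + k -> `|k| < d ->
    `|DD z (t + k) i - DD z t i - k * FF w z t i| <= e / 2 * `|k|.
  have [|d d0 dP] := @common_radius R _ (fun i d => forall k, 0 <= t + k -> `|k| < d ->
      `|DD z (t + k) i - DD z t i - k * FF w z t i| <= e / 2 * `|k|) _ (fun i => sz t i t0 _ e2).
    by move=> i d d' _ dd' dP k tk kd; apply: dP => //; exact: lt_le_trans dd'.
  by exists d => // i k; exact: dP.
exists d => //= k /=; rewrite sub0r normrN => kd k0 tk.
apply: row_norm_lt => // i; apply: le_lt_trans (_ : e / 2 < e); last by lra.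
rewrite difference_quotient -/(DD z (t + k) i) -/(DD z t i) -/(FF w z t i).
have := dP i k tk kd.
rewrite (_ : _ - _ - _ = - (k * (FF w z t i - k^-1 * (DD z (t + k) i - DD z t i)))); last by field.
by rewrite normrN normrM mulrC ler_pM2r// normr_gt0.
Qed.

Lemma solution_BC w x z T : 0 <= T -> BU x -> is_solution S w x z ->
  exists2 r, 0 <= r & BC (fun t => z (Num.min t T)) r.
Proof.
move=> T0 bx [cz z0 _]; have [_ [r r0 [_ xr]]] := BU_ext bx.
have [c _ cP] := @EVT_max R (fun t => `|z t|) 0 T T0 (continuous_subspaceT (fun t => continuous_comp (cz t) (@norm_continuous _ _ _))).
exists (Num.max r `|z c|); first by rewrite le_max r0.
split=> [t|t i].
  by apply: continuous_comp; [apply: continuous_min; [exact: cvg_id|exact: cvg_cst]|exact: cz].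
have [t0|t0] := leP t 0.
  rewrite min_l ?le_max; last by apply: le_trans T0.
  by rewrite -(past_ext z0 t0) xr.
rewrite le_max; apply/orP; right; apply: le_trans (row_norm_ge _ _) _; apply: cP.
by rewrite in_itv /= le_min ge_min lexx orbT T0 (ltW t0).
Qed.

(** Solutions are only compared on bounded time intervals, where freezing them
    makes them bounded. *)
Lemma solution_unique w x z h : Omega S w -> BU x -> is_solution S w x z -> is_solution S w x h -> z = h.
Proof.
move=> Ow bx sz sh; apply/funext => t; pose T := Num.max t 0.
have T0 : 0 <= T by rewrite le_max lexx orbT.
have tT : t <= T by rewrite le_max lexx.
have [r r0 bz] := solution_BC T0 bx sz; have [r' r'0 bh] := solution_BC T0 bx sh.
have fr y : is_solution S w x y -> forall u, 0 < u <= T -> leftsol w (fun t => y (Num.min t T)) u.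
  move=> /solutionP[_ _ sy] u /andP[u0 uT]; apply: (@eq_leftsol _ _ _ w y).
    by move=> s su; rewrite min_l// (le_trans su).
  by apply: (solves_leftsol sy u0) => s /andP[].
have bz' : BC (fun t => z (Num.min t T)) (Num.max r r') by apply: BC_le bz; rewrite le_max lexx.
have bh' : BC (fun t => h (Num.min t T)) (Num.max r r') by apply: BC_le bh; rewrite le_max lexx orbT.
have := @uniqueness _ _ S H w _ _ _ 0 T Ow bz' bh' T0 (fr _ sz) (fr _ sh).
move=> /(_ _ t tT); rewrite min_l//; apply => s s0.
rewrite !min_l; try exact: le_trans T0.
have [_ z0 _] := sz; have [_ h0 _] := sh.
by rewrite -(past_ext z0 s0) (past_ext h0).
Qed.

(** Both properties pass to the limit: [K] is closed, [back t] is continuous and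
    limits of solutions are solutions. *)
Lemma backward_limit K r p : 0 <= r -> K `<=` Omega S `*` @BU R m -> closed K -> K p -> BC (ext p.2) r ->
  (forall T e, 0 < T -> 0 < e -> exists q, [/\ wnear p.1 T e q.1, xnear p.2 T e q.2, BC (ext q.2) r &
     forall t, 0 <= t <= T -> K (back t q) /\ leftsol q.1 (ext q.2) (- t)]) ->
  forall t, 0 <= t -> K (back t p) /\ leftsol p.1 (ext p.2) (- t).
Proof.
move=> r0 KB cK Kp bp app.
have near_p t A : 0 <= t -> nbhs (back t p) A -> exists q, K (back t q) /\ A (back t q).
  move=> t0 /(@back_continuous t p)/pnear_basis[T [e [T0 e0 TA]]].
  have [|q [wq xq _ /(_ t)[]]] := app (Num.max T t) e _ e0; first by rewrite lt_max T0.
    by rewrite t0 le_max lexx orbT.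
  move=> Kq _; exists q; split=> //; apply: TA; split=> /=.
    by apply: wnear_mono wq; rewrite ?le_max ?lexx.
  by apply: xnear_mono xq; rewrite ?le_max ?lexx.
have [Op Bp] := KB p Kp.
have sp : solves p.1 (ext p.2) [set t | t <= 0].
  apply: (solves_limit H r0 Op bp (BU_ext Bp).1) => [s t u /= _ u0 /andP[_ tu]|T e T0 e0]; first exact: le_trans u0.
  have [q [wq xq bq qP]] := app T e T0 e0; exists q.1, (ext q.2).
  have [|Kq _] := qP 0; first by rewrite lexx ltW.
  have q00 : q.1 = (back 0 q).1 by rewrite /= oppr0 translate0.
  split=> //.
  - by rewrite q00; exact: (KB _ Kq).1.
  - move=> s j sT; have := row_norm_ge (ext q.2 s - ext p.2 s) j; rewrite !mxE => /le_trans; apply.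
    rewrite /ext; apply/ltW/xq; rewrite /recent /= le_min.
    by rewrite oppr_le0 (ltW T0) andbT lerNl; apply: le_trans sT; rewrite -normrN ler_norm.
  move=> t /= t0 tT; have := qP (- t); rewrite opprK => -[|Kt lt]; last split=> //.
    by rewrite oppr_ge0 t0 /=; apply: le_trans tT; rewrite -normrN ler_norm.
  rewrite seg_ext//; have := (KB _ Kt).2; rewrite /back /= opprK => bt; split=> // s.
  by apply/row_normP => // i; exact: bq.2.
move=> t t0; split.
  by apply: cK => A /(near_p t A t0)[q [? ?]]; exists (back t q).
apply: (solves_leftsol (a := - t - 1) sp) => [|s /andP[_ st]]; first lra.
by apply: le_trans st _; lra.
Qed.

Definition entire K r := [/\ K `<=` Omega S `*` BU_ball r, compact K &
  forall p, K p -> exists z, [/\ seg z 0 = p.2, BC z r, forall t, leftsol p.1 z t & forall t, K (state p.1 z t)]].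

Lemma entire_lip r : 0 <= r -> exists2 L, 0 <= L & forall K p z, entire K r ->
  BC z r -> (forall t, leftsol p.1 z t) -> (forall t, K (state p.1 z t)) -> Dlip S z L.
Proof.
move=> r0; have [C C0 CP] := FF_bound H r0; exists C => // K p z [KB _ _] bz lz Kz.
have Op : Omega S p.1 by have := (KB _ (Kz 0)).1; rewrite /= translate0.
have le s t i : s <= t -> `|DD z t i - DD z s i| <= C * `|t - s|.
  move=> st; have := @increments _ _ S p.1 z r s t i 0 C Op bz st (fun t _ => lz t).
  rewrite mulr0 subr0 (ger0_norm (_ : 0 <= t - s)) ?subr_ge0//; apply => u _.
  by rewrite subr0; apply: CP => //; exact: (KB _ (Kz u)).2.
move=> s t i; have [/le//|/ltW/le] := leP s t.
by move=> /(_ i); rewrite distrC [`|s - t|]distrC.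
Qed.

Lemma compact_bound_now K : compact K -> exists2 r, 0 <= r & forall p, K p -> `|p.2 (clamp 0)| <= r.
Proof.
move=> cK; pose ev p : 'rV[R]_m := p.2 (clamp 0).
have cev : continuous ev.
  move=> p; apply/cvgrPdist_lt => e e0.
  apply: filterS (pnear_nbhs p 0 e0) => p' [_ /(_ (clamp 0))] /=.
  by rewrite distrC; apply; rewrite /recent /= oppr0 minxx.
have /compact_bounded[r [_ rP]] : compact (ev @` K) by apply: continuous_compact => //; exact: continuous_subspaceT.
exists (`|r| + 1) => [|p Kp]; first by rewrite addr_ge0.
have rr : r < `|r| + 1 by apply: le_lt_trans (ler_norm r) _; rewrite ltrDl.
by apply: (rP _ rr (ev p)); exists p.
Qed.

(** The points of [K] with a whole past in [K] form a nonempty closed positively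
    invariant subset: it contains the limit points of any forward orbit. *)
Lemma minimal_entire K : minimal S K -> exists2 r, 0 <= r & entire K r.
Proof.
move=> [KB [p0 Kp0] cK invK minK].
have clK : closed K by apply: compact_closed cK; exact: state_hausdorff.
have [r r0 rK] := compact_bound_now cK.
have orb p : K p -> exists2 z, is_solution S p.1 p.2 z & forall t, 0 <= t -> K (state p.1 z t).
  move=> Kp; have [[q [z sz _]] _] := invK p 0 Kp (lexx 0).
  by exists z => // t t0; apply: (invK p t Kp t0).2; exists z.
have orbr p z r' : K p -> is_solution S p.1 p.2 z -> (forall t, 0 <= t -> K (state p.1 z t)) ->
    r <= r' -> BC (ext p.2) r' -> BC z r'.
  move=> Kp [cz z0 _] Kz rr' bp; split=> // t i; have [t0|t0] := leP t 0.
    by rewrite -(past_ext z0 t0); exact: bp.2.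
  apply: le_trans (row_norm_ge _ _) _; apply: le_trans rr'.
  by have := rK _ (Kz t (ltW t0)); rewrite /state /= seg_clamp0.
pose past_in p := forall t, 0 <= t -> K (back t p) /\ leftsol p.1 (ext p.2) (- t).
have past_BC p : K p -> past_in p -> BC (ext p.2) r.
  move=> Kp pp; have [_ Bp] := KB _ Kp; have [_ [r' _ [cx _]]] := BU_ext Bp; split=> // t i.
  rewrite -(ext_clamp p.2 t); set u := Num.min t 0; have u0 : 0 <= - u by rewrite oppr_ge0 ge_min lexx orbT.
  apply: le_trans (row_norm_ge _ _) _; have [/rK] := pp _ u0.
  by rewrite back_state// /state /= opprK seg_clamp0.
(* Cluster points of one forward orbit have a whole past in [K]. *)
pose K' := [set p | K p /\ past_in p].
have K'K : K' = K.
  apply: minK => [p []//|||].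
  - have [z sz Kz] := orb _ Kp0.
    have [Ow B0] := KB _ Kp0; have [_ [r1 r10 b0]] := BU_ext B0.
    pose r2 := Num.max r r1.
    have r20 : 0 <= r2 by rewrite le_max r0.
    have bz : BC z r2.
      by apply: (orbr _ _ _ Kp0 sz Kz); rewrite ?le_max ?lexx//; apply: BC_le b0; rewrite le_max lexx orbT.
    have [|q [Kq cq]] := cK (state p0.1 z @ +oo) _ _.
      by exists 0; split; [exact: num_real|move=> t /ltW; exact: Kz].
    exists q; split=> //.
    have near_q T A : nbhs q A -> exists2 t, T < t & A (state p0.1 z t).
      move=> nA; have [|_ [[t tT <-] At]] := cq (state p0.1 z @` [set t | T < t]) A _ nA; last by exists t.
      by exists T; split; [exact: num_real|move=> t tT; exists t].
    have bq : BC (ext q.2) r2.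
      have [_ [r' _ [cx _]]] := BU_ext (KB _ Kq).2; split=> // t i.
      apply/ler_addgt0Pr => e e0.
      have [t' _ [_ /(_ (clamp t))]] := near_q 0 _ (pnear_nbhs q `|t| e0).
      move=> /(_ _)/ltW h1; have {}h1 : `|(state p0.1 z t').2 (clamp t) - q.2 (clamp t)| <= e.
        apply: h1; rewrite /recent /= le_min oppr_le0 normr_ge0 andbT.
        by rewrite lerNl -normrN ler_norm.
      have := le_trans (row_norm_ge _ i) h1; rewrite !mxE /state /= /seg.
      have := bz.2 (t' + val (clamp t)) i; rewrite /ext; move: (z _ ord0 i) (q.2 _ ord0 i) => a b.
      by rewrite !ler_norml => /andP[? ?] /andP[? ?]; lra.
    apply: (backward_limit r20 KB clK Kq bq) => T e T0 e0.
    have [t Tt [wt xt]] := near_q T _ (pnear_nbhs q T e0).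
    exists (state p0.1 z t); split=> //.
      split=> [u|u i]; last by rewrite /ext /state /= /seg; exact: bz.2.
      by have [_ [r' _ [/(_ u)]]] := BU_ext (KB _ (Kz t (ltW (lt_trans T0 Tt)))).2.
    move=> s /andP[s0 sT]; rewrite state_back//; split; first by apply: Kz; lra.
    apply: (@eq_leftsol _ _ _ _ (fun u => z (t + u))) => [u us|].
      by rewrite /state /= ext_seg//; lra.
    apply: leftsol_shift; have [_ _ sz'] := (solutionP _ _ _).1 sz.
    by apply: (solves_leftsol (a := 0) sz') => [|u /andP[]//]; lra.
  - apply: subclosed_compact cK _; last by move=> p [].
    move=> p cp; have Kp : K p by apply: clK => A /cp[q [[Kq _] Aq]]; exists q.
    split=> //; have [_ [r1 r10 b0]] := BU_ext (KB _ Kp).2.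
    pose r2 := Num.max r r1.
    have r20 : 0 <= r2 by rewrite le_max r0.
    have bp : BC (ext p.2) r2 by apply: BC_le b0; rewrite le_max lexx orbT.
    apply: (backward_limit r20 KB clK Kp bp) => T e T0 e0.
    have [q [[Kq pq] [wq xq]]] := cp _ (pnear_nbhs p T e0).
    exists q; split=> //; first by apply: BC_le (past_BC _ Kq pq); rewrite le_max lexx.
    by move=> t /andP[t0 _]; exact: pq.
  - move=> p t [Kp pp] t0; have [ex all] := invK p t Kp t0; split=> // q tq.
    split; first exact: all.
    have [z sz Kz] := orb _ Kp.
    have [z' sz' ->] := tq; have [Op Bp] := KB _ Kp.
    rewrite (solution_unique Op Bp sz' sz) {z' sz' tq}.
    have zE u : u <= 0 -> ext p.2 u = z u by case: sz => _ z0 _; exact: past_ext.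
    move=> s s0; rewrite (state_back p.1 z t s0); split.
      have [ts|ts] := leP s t; first by apply: Kz; rewrite subr_ge0.
      have := (pp (s - t) _).1; rewrite back_state ?subr_ge0 ?(ltW ts)// opprB => /(_ isT).
      by rewrite (@eq_state _ (ext p.2) z)// => u ut; apply: zE; lra.
    apply: (@eq_leftsol _ _ _ _ (fun u => z (t + u))) => [u us|].
      by rewrite /= ext_seg//; lra.
    apply: leftsol_shift; have [_ _ sz'] := (solutionP _ _ _).1 sz.
    have [ts|ts] := leP (t - s) 0; last by apply: (solves_leftsol (a := 0) sz') => [//|u /andP[]//].
    apply: (@eq_leftsol _ _ _ _ (ext p.2)) => [u us|]; first by apply: zE; lra.
    by have [|_] := pp (s - t) _; [lra|rewrite opprB].
exists r => //.
have KP p : K p -> exists z, [/\ seg z 0 = p.2, BC z r, forall t, leftsol p.1 z t & forall t, K (state p.1 z t)].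
  move=> Kp; have [_ pp] : K' p by rewrite K'K.
  have [z sz Kz] := orb _ Kp.
  have zE u : u <= 0 -> ext p.2 u = z u by case: sz => _ z0 _; exact: past_ext.
  exists z; split.
  - by case: sz.
  - by apply: (orbr _ _ _ Kp sz Kz) => //; exact: past_BC.
  - have [_ _ sz'] := (solutionP _ _ _).1 sz.
    move=> t; have [t0|t0] := leP t 0; last by apply: (solves_leftsol (a := 0) sz') => [//|u /andP[]//].
    apply: (@eq_leftsol _ _ _ _ (ext p.2)) => [u us|]; first by apply: zE; lra.
    by have [|_] := pp (- t) _; [lra|rewrite opprK].
  - move=> t; have [t0|t0] := leP t 0; last by apply: Kz; exact: ltW.
    have := (pp (- t) _).1; rewrite back_state ?oppr_ge0// opprK => /(_ t0).
    by rewrite (@eq_state _ (ext p.2) z)// => u ut; apply: zE; lra.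
split=> // p Kp; split; first exact: (KB _ Kp).1.
split=> [|s]; first exact: (KB _ Kp).2.
have [z [<- bz _ _]] := KP p Kp; apply/row_normP => // i; exact: bz.2.
Qed.

Lemma entire_solves K r p z : 0 <= r -> entire K r -> BC z r ->
  (forall t, leftsol p.1 z t) -> (forall t, K (state p.1 z t)) -> solves p.1 z setT.
Proof.
move=> r0 eK bz lz Kz; have [L L0 LP] := entire_lip r0.
have uz := lip_ucont (Dlip_lip H L0 bz (LP K p z eK bz lz Kz)).
have [KB _ _] := eK.
have Op : Omega S p.1 by have := (KB _ (Kz 0)).1; rewrite /= translate0.
apply: (solves_limit H r0 Op bz uz) => // T e T0 e0; exists p.1, z; split=> //.
- by apply: near_on_refl.
- by move=> s j _; rewrite subrr normr0 ltW.
- by move=> t _ _; split=> //; exact: (KB _ (Kz t)).2.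
Qed.

End Orbits.

(** * Continuity of the total mass *)

Section ContinuityOn.
Variables (R : realType) (X : topologicalType).
Implicit Types (A B : set X) (f g : X -> R) (c e : R).

Definition cont_on A f := forall p, A p -> forall e, 0 < e -> \forall q \near p, A q -> `|f q - f p| < e.

Lemma cont_on_sub A B f : A `<=` B -> cont_on B f -> cont_on A f.
Proof. by move=> AB cf p /AB Bp e /(cf p Bp e); apply: filterS => q fq /AB. Qed.

Lemma cont_onD A f g : cont_on A f -> cont_on A g -> cont_on A (fun p => f p + g p).
Proof.
move=> cf cg p Ap e e0; have e2 : 0 < e / 2 by lra.
apply: filterS2 (cf p Ap _ e2) (cg p Ap _ e2) => q fq gq Aq.
rewrite opprD addrACA; apply: le_lt_trans (ler_normD _ _) _.
by have := fq Aq; have := gq Aq; lra.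
Qed.

Lemma cont_on_sum A (J : finType) (f : J -> X -> R) : (forall j, cont_on A (f j)) ->
  cont_on A (fun p => \sum_j f j p).
Proof.
move=> cf; have -> : (fun p => \sum_j f j p) = (\sum_j f j)%R.
  by apply/funext => p; rewrite fct_sumE.
elim/big_ind: _ => [p _ e e0|g h cg ch|j _]; [|exact: cont_onD|exact: cf].
by apply: nearW => q _; rewrite subrr normr0.
Qed.

Lemma cont_onN A f : cont_on A f -> cont_on A (fun p => - f p).
Proof. by move=> cf p Ap e /(cf p Ap); apply: filterS => q fq /fq; rewrite -opprD normrN. Qed.

Lemma closed_ge A f c : closed A -> cont_on A f -> closed (A `&` [set p | c <= f p]).
Proof.
move=> cA cf p cp; have Ap : A p by apply: cA => B /cp[q [[Aq _] Bq]]; exists q.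
split=> //; apply/ler_addgt0Pr => e e0 /=; have [q [[Aq cq] /(_ Aq)]] := cp _ (cf p Ap e e0).
by move: cq; rewrite /= ltr_norml => ? /andP[? ?]; lra.
Qed.

Lemma compact_max A f : compact A -> A !=set0 -> cont_on A f -> exists2 p, A p & forall q, A q -> f q <= f p.
Proof.
move=> cA A0 cf; have [|p pA pP] := @compact_EVT_max X R f A A0 cA.
  apply/subspace_continuousP => p Ap; apply/cvgrPdist_lt => e e0.
  by apply: filterS (cf p Ap e e0) => q fq /fq; rewrite distrC.
by exists p => [|q Aq]; [rewrite -inE|apply: pP; rewrite inE].
Qed.

End ContinuityOn.

(** Over a compact total space a strict bound on one fibre is a strict bound on
    the neighbouring ones. *)
Lemma fibre_lt (R : realType) (W X : topologicalType) (K : set (W * X)) (f : W * X -> R) (w : W) (c : R) :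
  hausdorff_space W -> compact K -> cont_on K f -> (forall p, K p -> p.1 = w -> f p < c) ->
  \forall w' \near w, forall p, K p -> p.1 = w' -> f p < c.
Proof.
move=> hW /compact_near_coveringP cK cf fc.
suff : \forall w' \near w, K `<=` (fun p => K p -> p.1 = w' -> f p < c).
  by apply: filterS => w' w'P p Kp; exact: w'P.
apply: cK => p Kp; have [pw|/eqP pw] := pselect (p.1 = w).
  have [e e0 eP] : exists2 e, 0 < e & f p + e <= c.
    by exists (c - f p); [rewrite subr_gt0 fc|rewrite addrC subrK].
  exists ([set q | K q -> `|f q - f p| < e], setT); first by split; [exact: cf|exact: filterT].
  move=> [q w'] [/= fq _] Kq _; move: (fq Kq); rewrite ltr_norml => /andP[_ ?].
  by apply: lt_le_trans eP; rewrite -ltrBlDl.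
have := hW; rewrite open_hausdorff => /(_ _ _ pw)[[U V] /= [pU wV] [oU oV /eqP UV]].
exists (fst @^-1` U, V); first split=> /=.
- by apply: (@cvg_fst _ _ (nbhs p.1) (nbhs p.2)); apply: open_nbhs_nbhs; split=> //; rewrite -inE.
- by apply: open_nbhs_nbhs; split=> //; rewrite -inE.
move=> [q w'] [/= Uq Vw'] _ qw'; exfalso.
have : (U `&` V) w' by split=> //; rewrite -qw'.
by rewrite UV.
Qed.

Section Continuity.
Variables (R : realType) (m : nat) (S : compartmental R m).
Hypothesis H : standing S.
Let S_closed := st_closed H.
Let hC1 := st_C1 H.
Let hC2 := st_C2 H.
Let hC3 := st_C3 H.
Let hC4 := st_C4 H.
Implicit Types (w : vfield R m) (s t e r T L a b : R) (i j : 'I_m) (z h y : R -> 'rV[R]_m) (x : hist R m)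
  (p q : vfield R m * hist R m) (K : set (vfield R m * hist R m)).
Local Notation DD := (DD S).
Local Notation MM := (MM S).

Lemma xnear_ext (x x' : hist R m) T e s j : 0 <= T -> xnear x T e x' -> - T <= s -> `|ext x' s ord0 j - ext x s ord0 j| < e.
Proof.
move=> T0 xy sT; have := row_norm_ge (ext x' s - ext x s) j; rewrite !mxE => /le_lt_trans; apply.
by apply: xy; rewrite /recent /= le_min sT oppr_le0.
Qed.

Lemma D_ext x i : D S x ord0 i = DD (ext x) 0 i.
Proof. by rewrite /DD seg_ext0. Qed.

Lemma D_cont r i : 0 <= r -> cont_on (Omega S `*` @BU_ball R m r) (fun p => D S p.2 ord0 i).
Proof.
move=> r0 p [_ Bp] e e0; have e2 : 0 < e / 2 by lra.
have [T T0 [d d0 DP]] := DD_small hC4 r0 e2.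
apply: filterS (pnear_nbhs p T d0) => q [_ xq] [_ Bq]; rewrite !D_ext.
apply: le_lt_trans (_ : e / 2 < e); last by lra.
apply: DP; [exact: BU_ball_BC Bq|exact: BU_ball_BC Bp|move=> s j].
by rewrite sub0r => sT _; apply/ltW/(xnear_ext _ (ltW T0) xq sT).
Qed.

Lemma M_ext w x : M S w x = MM w (ext x) 0.
Proof. by rewrite /MM translate0 seg_ext0. Qed.

(** Uniform continuity of the flows on a compact window, together with the small
    mass of what has been in a pipe for a long time. *)
Lemma M_cont r : 0 <= r -> cont_on (Omega S `*` @BU_ball R m r) (fun p => M S p.1 p.2).
Proof.
move=> r0.
have -> : (fun p : vfield R m * hist R m => M S p.1 p.2) = (fun p => \sum_i D S p.2 ord0 i +
    \sum_i \sum_j pipe_mass (mu S j i) (rate p.1 (ext p.2) j i) 0).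
  by apply/funext => p; rewrite M_ext MME; under eq_bigr do rewrite -D_ext.
apply: cont_onD; first by apply: cont_on_sum => i; exact: D_cont.
apply: cont_on_sum => i; apply: cont_on_sum => j p [Op Bp] e e0.
have e2 : 0 < e / 2 by lra.
have [B B0 BP] := G_bound hC1 r.
have [mass1 moment] := hC3 j i.
have [T T0 [d d0 PP]] := pipe_mass_small moment B0 e2.
have d2 : 0 < d / 2 by lra.
have [k k0 kP] := heine_cantor (@square_compact R (T + r)) (Omega_continuous S_closed hC1 Op) d2.
pose d' := Num.min k (d / 2); have d'0 : 0 < d' by rewrite lt_min k0.
apply: filterS (pnear_nbhs p (T + r) d'0) => q [wq xq] [Oq Bq].
apply: le_lt_trans (_ : e / 2 < e); last by lra.
have bq := BU_ball_BC r0 Bq; have bp := BU_ball_BC r0 Bp.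
apply: PP; [exact: (rate_bcont S_closed hC1 _ _ Oq bq BP)|exact: (rate_bcont S_closed hC1 _ _ Op bp BP)|].
move=> s; rewrite sub0r => sT s0; rewrite /rate.
have xs : `|ext q.2 s ord0 i - ext p.2 s ord0 i| < k.
  have := @xnear_ext _ _ (T + r) _ s i _ xq; rewrite /d' lt_min => /(_ _ _)/andP[]; [lra|lra|by []].
have sq v : `|v| <= r -> square (T + r) (s, v).
  by move=> vr; split=> /=; [rewrite ler_norml; lra|lra].
have h1 : `|G q.1 (cpt j) i s (ext q.2 s ord0 i) - G p.1 (cpt j) i s (ext q.2 s ord0 i)| < d / 2.
  have := wq (s, ext q.2 s ord0 i) (sq _ (bq.2 s i)); rewrite lt_min => /andP[_].
  by apply: le_lt_trans; have := flux_entry_le (q.1 (s, ext q.2 s ord0 i) - p.1 (s, ext q.2 s ord0 i)) (cpt j) i; rewrite /G /= !mxE.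
have h2 : `|G p.1 (cpt j) i s (ext q.2 s ord0 i) - G p.1 (cpt j) i s (ext p.2 s ord0 i)| < d / 2.
  have := kP (s, ext p.2 s ord0 i) (s, ext q.2 s ord0 i) (sq _ (bp.2 s i)).
  have bl : ball (s, ext p.2 s ord0 i) k (s, ext q.2 s ord0 i) by split=> /=; [exact: ballxx|rewrite /ball /= distrC].
  move=> /(_ bl); rewrite distrC; apply: le_lt_trans.
  by have := flux_entry_le (p.1 (s, ext q.2 s ord0 i) - p.1 (s, ext p.2 s ord0 i)) (cpt j) i; rewrite /G /= !mxE.
rewrite -(subrKA (G p.1 (cpt j) i s (ext q.2 s ord0 i))); apply: le_trans (ler_normD _ _) _; lra.
Qed.

Lemma cont_on_back (f : vfield R m * hist R m -> R) r s : 0 <= r -> 0 <= s -> cont_on (Omega S `*` @BU_ball R m r) f ->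
  cont_on (Omega S `*` @BU_ball R m r) (fun p => f (back s p)).
Proof.
move=> r0 s0 cf; have bk p : (Omega S `*` @BU_ball R m r) p -> (Omega S `*` @BU_ball R m r) (back s p).
  move=> [Op Bp]; split; first exact: Omega_translate.
  by rewrite back_state//; exact: seg_BUext.
move=> p Ap e e0.
have near_p : \forall q \near p, (Omega S `*` @BU_ball R m r) (back s q) -> `|f (back s q) - f (back s p)| < e.
  exact: (@back_continuous _ _ s p _ (cf _ (bk p Ap) e e0)).
by apply: filterS near_p => q qP Aq; apply: qP; exact: bk.
Qed.

End Continuity.

(** * The upper envelope of a family of entire orbits *)

Section Roof.
Variables (R : realType) (m : nat) (S : compartmental R m).
Hypothesis H : standing S.
Let S_closed := st_closed H.
Let hC1 := st_C1 H.
Let hC2 := st_C2 H.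
Let hC3 := st_C3 H.
Let hC4 := st_C4 H.
Implicit Types (w : vfield R m) (s t e : R) (i j : 'I_m) (z h y : R -> 'rV[R]_m) (x : hist R m)
  (p q : vfield R m * hist R m).
Local Notation DD := (DD S).
Local Notation MM := (MM S).
Local Notation kap := (kap S).
Local Notation Dinv := (Dinv S).
Local Notation leftsol := (leftsol S).
Local Notation solves := (solves S).

Variables (K : set (vfield R m * hist R m)) (r : R).
Hypotheses (r0 : 0 <= r) (eK : entire S K r).
Hypothesis onto : forall w, Omega S w -> exists x, K (w, x).

Let OT t w (Ow : Omega S w) : Omega S (translate t w) := @Omega_translate R m S hC2 t w Ow.

Lemma entire_sub : K `<=` Omega S `*` @BU_ball R m r.
Proof. by case: eK. Qed.

Lemma entire_compact : compact K.
Proof. by case: eK. Qed.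

Definition orbit w z := [/\ BC z r, forall t, leftsol w z t & forall t, K (state w z t)].

Lemma orbit_Omega w z : orbit w z -> Omega S w.
Proof. by move=> [_ _ /(_ 0)/entire_sub[/=]]; rewrite translate0. Qed.

Lemma orbit_through w x t : K (translate t w, x) -> exists2 z, orbit w z & seg z t = x.
Proof.
move=> Kx; have [_ _ /(_ _ Kx)[z [/= z0 bz lz Kz]]] := eK.
have tw : translate (- t) (translate t w) = w by rewrite translateD addNr translate0.
exists (fun s => z (- t + s)); last by rewrite seg_shift addNr.
split=> [|s|s]; first exact: BC_shift.
  by rewrite -tw; exact: leftsol_shift.
by rewrite -tw state_shift.
Qed.

Lemma orbits_lip : exists2 L, 0 <= L & forall w z, orbit w z -> Dlip S z L.
Proof.
have [L L0 LP] := entire_lip H r0; exists L => // w z [bz lz Kz].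
by have [x Kx] := onto (orbit_Omega (And3 bz lz Kz)); exact: (LP K (w, x) z eK bz lz Kz).
Qed.

Definition top w : 'rV[R]_m := \row_i sup [set D S p.2 ord0 i | p in K `&` [set p | p.1 = w]].

Lemma top_max w i : Omega S w -> exists2 x, K (w, x) & D S x ord0 i = top w ord0 i /\
  forall x', K (w, x') -> D S x' ord0 i <= top w ord0 i.
Proof.
move=> Ow; have [x0 Kx0] := onto Ow.
have fib_closed : closed [set p : vfield R m * hist R m | p.1 = w].
  have cw : closed [set w] by apply: compact_closed; [exact: vfield_hausdorff|exact: compact_set1].
  by apply: (@closed_comp _ _ fst [set w] _ cw) => p _; exact: cvg_fst.
have [|||[w' x] [Kx /= ww'] xP] := @compact_max _ _ (K `&` [set p | p.1 = w]) (fun p => D S p.2 ord0 i).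
- exact: compact_closedI entire_compact fib_closed.
- by exists (w, x0).
- by apply: cont_on_sub (D_cont H i r0) => p [/entire_sub].
subst w'; have E : top w ord0 i = D S x ord0 i.
  rewrite mxE; apply/eqP; rewrite eq_le; apply/andP; split.
    by apply: ge_sup; [exists (D S x ord0 i), (w, x)|move=> _ [p Kp <-]; exact: xP].
  apply: ub_le_sup; last by exists (w, x).
  by exists (D S x ord0 i) => _ [p Kp <-]; exact: xP.
by exists x => //; rewrite E; split=> // x' Kx'; exact: (xP (w, x')).
Qed.

Lemma orbit_le_top w z t i : orbit w z -> DD z t i <= top (translate t w) ord0 i.
Proof.
move=> oz; have [_ _ Kz] := oz; have Ow := @OT t _ (orbit_Omega oz).
by have [x _ [_ xP]] := top_max i Ow; exact: xP (Kz t).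
Qed.

Lemma orbit_at_top w t i : Omega S w -> exists2 z, orbit w z & DD z t i = top (translate t w) ord0 i.
Proof.
move=> Ow; have [x Kx [xt _]] := top_max i (@OT t _ Ow).
by have [z oz zx] := orbit_through Kx; exists z => //; rewrite /DD zx.
Qed.

Lemma top_lip : exists2 L, 0 <= L & forall w, Omega S w ->
  lip (fun t => top (translate t w)) L.
Proof.
have [L L0 LP] := orbits_lip; exists L => // w Ow.
have le s t i : top (translate t w) ord0 i - top (translate s w) ord0 i <= L * `|t - s|.
  have [z oz zt] := orbit_at_top t i Ow.
  have := orbit_le_top s i oz; have := ler_norm (DD z t i - DD z s i); have := LP w z oz s t i.
  by rewrite -zt; lra.
move=> s t i; have := le s t i; have := le t s i; rewrite [`|s - t|]distrC ler_norml.
by move=> ? ?; apply/andP; split; lra.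
Qed.

Lemma top_bound w : Omega S w -> BC (fun t => top (translate t w)) (r + kap * r).
Proof.
move=> Ow; have [L L0 LP] := top_lip; split; first exact: lip_continuous (LP w Ow).
move=> t i; have [z [bz _ _] <-] := orbit_at_top t i Ow.
by have := (BC_DDrow S bz).2 t i; rewrite mxE.
Qed.

(** The history whose [D]-values are, at every past time, the highest ones
    allowed by [K]. *)
Definition topsol w := Dinv (fun t => top (translate t w)).
Definition roof w : hist R m := seg (topsol w) 0.
Let r' := (r + kap * r) / (1 - kap).

Lemma r'_ge0 : 0 <= r'.
Proof.
have k1 := kap1 hC4; have k0 := kap_ge0 S.
by apply: divr_ge0; [apply: addr_ge0 => //; exact: mulr_ge0|exact: ltW].
Qed.

Lemma topsolP w : Omega S w -> BC (topsol w) r' /\ forall t i, DD (topsol w) t i = top (translate t w) ord0 i.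
Proof. by move=> /top_bound/(DinvP hC4). Qed.

Lemma topsol_shift w t s : Omega S w -> topsol (translate t w) s = topsol w (t + s).
Proof.
move=> Ow; have [bz zP] := topsolP Ow; have [bz' z'P] := topsolP (@OT t _ Ow).
have := DD_inj hC4 bz' (BC_shift t bz) (t := s); apply=> // u i _.
by rewrite DD_shift z'P zP translateD addrC.
Qed.

Lemma state_topsol w t : Omega S w -> state w (topsol w) t = (translate t w, roof (translate t w)).
Proof.
move=> Ow; rewrite /state /roof; congr (_, _); apply/funext => s.
by rewrite /seg topsol_shift// add0r.
Qed.

Lemma topsol_Dlip : exists2 L, 0 <= L & forall w, Omega S w -> Dlip S (topsol w) L.
Proof.
have [L L0 LP] := top_lip; exists L => // w Ow s t i.
by have [_ zP] := topsolP Ow; rewrite !zP; exact: LP.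
Qed.

(** Each of the suprema that define the roof is attained by a solution. *)
Lemma topsol_touched w t : Omega S w -> touched S w (topsol w) t.
Proof.
move=> Ow i; have [_ tP] := topsolP Ow; have [z oz zt] := orbit_at_top t i Ow.
have [bz lz _] := oz; exists z, r; split=> //; last by rewrite zt tP.
by move=> s j _; rewrite tP; exact: orbit_le_top.
Qed.

Definition roof_mass w := M S w (roof w).

Lemma MM_topsol w t : Omega S w -> MM w (topsol w) t = roof_mass (translate t w).
Proof. by move=> Ow; rewrite /MM /roof_mass; have [-> ] := state_topsol t Ow. Qed.

Local Opaque roof_mass.

Lemma roof_mass_nonincreasing w t : Omega S w -> 0 <= t -> roof_mass (translate t w) <= roof_mass w.
Proof.
move=> Ow t0; rewrite -(MM_topsol t Ow) -[w in roof_mass w]translate0 -(MM_topsol 0 Ow).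
by apply: (MM_nonincreasing H Ow (topsolP Ow).1 t0) => s _; exact: topsol_touched.
Qed.

Definition under (L : R) : set (vfield R m * hist R m) := [set p | [/\ Omega S p.1,
  (forall t i, `|ext p.2 t ord0 i| <= r') /\ lip (ext p.2) L &
  forall t i, 0 <= t -> D S (back t p).2 ord0 i <= top (translate (- t) p.1) ord0 i]].

Lemma under_BU L : under L `<=` Omega S `*` @BU_ball R m r'.
Proof.
move=> p [Op [bp lp] _]; split=> //; rewrite -(seg_ext0 p.2); apply: seg_BU; [exact: r'_ge0| |].
  by split; [exact: lip_continuous lp|].
exact: lip_ucont lp.
Qed.

(** The highest values on the fibres are upper semicontinuous, so lying below
    them is a closed condition. *)
Lemma under_compact L : compact (under L).
Proof.
have c1 := compact_setX (@Omega_compact _ _ S hC2) (@lip_hist_compact R m r' L).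
apply: (subclosed_compact _ c1); last by move=> p [].
move=> p cp.
have [Op lp] : (Omega S `*` [set x : hist R m | (forall t i, `|ext x t ord0 i| <= r') /\ lip (ext x) L]) p.
  apply: (compact_closed (@state_hausdorff R m) c1) => A /cp[q [[Oq lq _] Aq]].
  by exists q.
split=> // t i t0; apply/ler_addgt0Pr => e e0; have e2 : 0 < e / 2 by lra.
have Bp : (Omega S `*` @BU_ball R m r') p.
  split=> //; rewrite -(seg_ext0 p.2); apply: seg_BU; [exact: r'_ge0| |].
    by split; [exact: lip_continuous lp.2|exact: lp.1].
  exact: lip_ucont lp.2.
have nD := cont_on_back H r'_ge0 t0 (D_cont H i r'_ge0) Bp e2.
have Ot := @OT (- t) _ Op.
have nT : \forall w \near translate (- t) p.1, forall q, K q -> q.1 = w ->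
    D S q.2 ord0 i < top (translate (- t) p.1) ord0 i + e / 2.
  apply: fibre_lt; [exact: vfield_hausdorff|exact: entire_compact| |].
    by apply: cont_on_sub (D_cont H i r0); exact: entire_sub.
  move=> [w x] Kx /= wt; subst w; have [_ _ [_ xP]] := top_max i Ot.
  by have := xP x Kx; lra.
have {}nT : \forall q \near p, forall q', K q' -> q'.1 = translate (- t) q.1 ->
    D S q'.2 ord0 i < top (translate (- t) p.1) ord0 i + e / 2.
  have := @translate_continuous R m (- t) p.1 _ nT.
  exact: (@cvg_fst _ _ (nbhs p.1) (nbhs p.2)).
have [q [uq [qD qT]]] := cp _ (filterI nD nT); have [Oq _ qP] := uq.
have := qD (under_BU uq); have := qP t i t0.
have [x Kx [xt _]] := top_max i (@OT (- t) _ Oq).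
have := qT _ Kx erefl; rewrite /= xt; move: (D S _ _ _) (D S _ _ _) => a b.
by rewrite ltr_norml => ? ? /andP[? ?]; lra.
Qed.

Lemma closed_under L : closed (under L).
Proof. exact: compact_closed (@state_hausdorff R m) (@under_compact L). Qed.

Lemma M_cont_under L : cont_on (under L) (fun p => M S p.1 p.2).
Proof. by apply: cont_on_sub (M_cont H r'_ge0); exact: under_BU. Qed.

Lemma roof_under w L : Omega S w -> lip (topsol w) L -> under L (w, roof w).
Proof.
move=> Ow lz; have [[cz bz] zP] := topsolP Ow.
split=> //=; first split.
- by move=> t i; rewrite /ext /roof /seg; exact: bz.
- move=> s t i; rewrite /ext /roof /seg !add0r; apply: le_trans (lz _ _ _) _.
  rewrite ler_wpM2l ?min_lip//.
  have := lz 0 1 i; rewrite subr0 normr1 mulr1; exact: le_trans.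
move=> t i t0; have := zP (- t) i; rewrite /DD => <-.
rewrite /roof -seg_ext ?oppr_le0// (_ : seg (ext _) _ = seg (topsol w) (- t))//.
by apply: eq_seg => s st; rewrite ext_seg ?add0r//; lra.
Qed.

Lemma under_le w x L t i : under L (w, x) -> t <= 0 -> DD (ext x) t i <= DD (topsol w) t i.
Proof.
move=> [/= Ow _ xP] t0; have [_ zP] := topsolP Ow; rewrite zP.
by have := xP (- t) i; rewrite opprK /DD seg_ext//; apply; rewrite oppr_ge0.
Qed.

Lemma under_mass w x L t : under L (w, x) -> t <= 0 ->
  MM w (ext x) t + \sum_i (DD (topsol w) t i - DD (ext x) t i) <= roof_mass (translate t w).
Proof.
move=> ux t0; have [Ow [bx lx] _] := ux; have [bz zP] := topsolP Ow.
rewrite -(MM_topsol t Ow).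
apply: (MM_le S_closed hC1 hC3 hC4 Ow _ bz) => [|s i st].
  by split; [exact: lip_continuous lx|exact: bx].
by apply: under_le ux _; lra.
Qed.

Lemma topsol_lip : exists L, forall w, Omega S w -> lip (topsol w) L.
Proof.
have [L L0 LP] := topsol_Dlip; exists (L / (1 - kap)) => w Ow.
by apply: (Dlip_lip H L0 (topsolP Ow).1); exact: LP.
Qed.

(** The mass under the roof decreases along the flow, and its superlevel sets
    are projections of compact sets, hence all of the minimal hull. *)
Lemma roof_mass_constant w w' : Omega S w -> Omega S w' -> roof_mass w = roof_mass w'.
Proof.
suff le v v' : Omega S v -> Omega S v' -> roof_mass v <= roof_mass v'.
  by move=> Ow Ow'; apply/le_anti/andP; split; exact: le.
move=> Ov; have [L LP] := topsol_lip.
(* Since the roof has the most mass among the histories below it, [A] is the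
   superlevel set of [roof_mass]. *)
pose A := fst @` (under L `&` [set p | roof_mass v <= M S p.1 p.2]).
have AP u : A u <-> Omega S u /\ roof_mass v <= roof_mass u.
  split=> [[[u' x] /= [ux fx] <-]|[Ou fu]]; last first.
    by exists (u, roof u) => //; split=> //; exact: roof_under (LP u Ou).
  have [Ou _ _] := ux; split; first exact: Ou.
  apply: (le_trans fx).
  have := under_mass ux (lexx 0); rewrite translate0 -M_ext.
  apply: le_trans; rewrite lerDl sumr_ge0// => i _.
  by rewrite subr_ge0; exact: under_le ux (lexx 0).
suff EA : A = Omega S.
  by rewrite -EA => /AP[_ h]; exact: h.
apply: (Omega_minimal hC2 (sg := -1)); first by right.
- by move=> u /AP[].
- apply: continuous_compact; first by move=> p; apply: continuous_subspaceT => q; exact: cvg_fst.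
  apply: subclosed_compact (@under_compact L) _; last by move=> p [].
  exact: (@closed_ge _ _ _ _ (roof_mass v) (@closed_under L) (@M_cont_under L)).
- by exists v; apply/AP.
move=> t u t0 /AP[Ou fu]; apply/AP; rewrite mulN1r; split; first exact: Omega_translate.
apply: le_trans fu _; have := roof_mass_nonincreasing (@OT (- t) _ Ou) t0.
by rewrite translateD addrN translate0.
Qed.

(** Since the mass under the roof is constant, the roof is cut out of a compact
    set by closed conditions: no history below it has as much mass at all past
    times. *)
Lemma roof_compact : compact (graph S roof).
Proof.
have [w0 Ow0] := Omega_nonempty hC2; have [L LP] := topsol_lip.
pose A := [set p | under L p /\ forall t, 0 <= t -> roof_mass w0 <= M S (back t p).1 (back t p).2].
have -> : graph S roof = A.
  apply/predeqP => -[w x]; split=> [[/= Ow ->]|[ux Mx]].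
    split=> [|t t0]; first exact: roof_under (LP w Ow).
    rewrite (roof_mass_constant Ow0 (@OT (- t) _ Ow)) -(MM_topsol (- t) Ow) (back_state _ t0).
    rewrite (@eq_state _ _ _ _ (topsol w)) => [|s st]; first exact: lexx.
    by rewrite /roof ext_seg ?add0r//; lra.
  have [/= Ow [bx lx] _] := ux; split=> //=; have [bz zP] := topsolP Ow.
  have bx' : BC (ext x) r' by split; [exact: lip_continuous lx|exact: bx].
  have eqD s i : s <= 0 -> DD (ext x) s i = DD (topsol w) s i.
    move=> s0; have s0' : 0 <= - s by rewrite oppr_ge0.
    have h1 : roof_mass w0 <= MM w (ext x) s.
      by have := Mx _ s0'; rewrite (back_state _ s0') opprK.
    have h2 := under_mass ux s0; rewrite -(roof_mass_constant Ow0 (@OT s _ Ow)) in h2.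
    have h3 : \sum_i (DD (topsol w) s i - DD (ext x) s i) <= 0.
      by move: h1 h2; move: (MM _ _ _) (roof_mass _) (\sum_i _) => a b c; lra.
    have ge0 j : 0 <= DD (topsol w) s j - DD (ext x) s j by rewrite subr_ge0; exact: under_le ux s0.
    have := sum_le0 i ge0 h3; have := ge0 i; move: (DD _ _ _) (DD _ _ _) => a b; lra.
  rewrite -(seg_ext0 x) /roof; apply: eq_seg => s s0.
  by apply: (DD_inj hC4 bx' bz (t := 0)) => // u i u0; exact: eqD.
apply: subclosed_compact (@under_compact L) _; last by move=> p [].
move=> p cp; have up : under L p by apply: closed_under => B /cp[q [[uq _] Bq]]; exists q.
split; first exact: up.
move=> t t0; have cM : cont_on (under L) (fun p => M S (back t p).1 (back t p).2).
  by apply: cont_on_sub (cont_on_back H r'_ge0 t0 (M_cont H r'_ge0)); exact: under_BU.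
have [|_ h] := @closed_ge _ _ _ _ (roof_mass w0) (@closed_under L) cM p; last exact: h.
by move=> B /cp[q [[uq Mq] Bq]]; exists q; split=> //; split=> //; exact: Mq.
Qed.

Lemma topsol_solves w : Omega S w -> solves w (topsol w) setT.
Proof.
move=> Ow; have [bz _] := topsolP Ow; have [L LP] := topsol_lip.
have uz := lip_ucont (LP w Ow).
apply: (touched_solves H Ow bz) => [t|i|s t]; first exact: topsol_touched.
  exact: (@FF_continuous _ _ S H r' w (topsol w) i r'_ge0 Ow bz uz).
by rewrite (MM_topsol s Ow) (MM_topsol t Ow) (roof_mass_constant (@OT s _ Ow) (@OT t _ Ow)).
Qed.

Lemma roof_ball : graph S roof `<=` Omega S `*` @BU_ball R m r'.
Proof.
move=> [w x] [/= Ow ->]; split=> //; have [L LP] := topsol_lip.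
exact: (seg_BU 0 r'_ge0 (topsolP Ow).1 (lip_ucont (LP w Ow))).
Qed.

Lemma D_roof w i : Omega S w -> D S (roof w) ord0 i = top w ord0 i.
Proof. by move=> Ow; have [_ zP] := topsolP Ow; have := zP 0 i; rewrite translate0. Qed.

(** The roof is touched by solutions and its mass is constant, so it consists of
    solutions. Its graph is compact, and a compact positively invariant part of it
    lies above all of the hull, which is minimal. *)
Lemma roof_minimal : minimal S (graph S roof).
Proof.
have fw w t q : Omega S w -> tau S t (w, roof w) q <-> q = (translate t w, roof (translate t w)).
  move=> Ow; have [_ [Bw _]] := @roof_ball (w, roof w) (conj Ow erefl).
  have sw : is_solution S w (roof w) (topsol w).
    apply/solutionP; split=> //; first exact: (topsolP Ow).1.1.
    by move=> s i _ e e0; have [d d0 dP] := topsol_solves Ow (t := s) i I e0; exists d => // k _; exact: dP.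
  split=> [[z /= sz ->]|->]; last by exists (topsol w) => //=; rewrite -/(state _ _ _) state_topsol.
  by rewrite -/(state _ _ _) (solution_unique H Ow Bw sz sw) state_topsol.
split.
- by move=> p /roof_ball[? []].
- by have [w Ow] := Omega_nonempty hC2; exists (w, roof w).
- exact: roof_compact.
- move=> [w x] t [/= Ow ->] t0; split=> [|q]; first by eexists; apply/fw.
  by move=> /fw -/(_ Ow) ->; split=> //=; exact: OT.
move=> A AG [p0 Ap0] cA iA; apply/predeqP => -[w x]; split=> [/AG//|[/= Ow ->]].
have EA : fst @` A = Omega S.
  apply: (Omega_minimal hC2 (sg := 1)); first by left.
  - by move=> _ [p /AG[Op _] <-].
  - apply: continuous_compact cA; apply: continuous_subspaceT => p; exact: cvg_fst.
  - by exists p0.1, p0.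
  - move=> t _ t0 [p Ap <-]; rewrite mul1r; have [Op px] := AG p Ap.
    exists (translate t p.1, roof (translate t p.1)) => //.
    by apply: (iA p t Ap t0).2; rewrite (surjective_pairing p) px; exact/fw.
have : (fst @` A) w by rewrite EA.
by move=> [[w' x'] Ax' /= ww']; subst w'; have [/= _ <-] := AG _ Ax'.
Qed.

End Roof.

(** * The order of the minimal sets *)

Section MinimalSets.
Variables (R : realType) (m : nat) (S : compartmental R m).
Hypothesis H : standing S.
Let S_closed := st_closed H.
Let hC1 := st_C1 H.
Let hC2 := st_C2 H.
Let hC3 := st_C3 H.
Let hC4 := st_C4 H.
Implicit Types (w : vfield R m) (s t e : R) (i j : 'I_m) (z h : R -> 'rV[R]_m) (x y b : vfield R m -> hist R m)
  (p q : vfield R m * hist R m) (K : set (vfield R m * hist R m)).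
Local Notation DD := (DD S).
Local Notation FF := (FF S).
Local Notation leftsol := (leftsol S).

Lemma entire_onto K r : entire S K r -> K !=set0 -> forall w, Omega S w -> exists u, K (w, u).
Proof.
move=> [KB cK KP] [p0 Kp0] w Ow; suff : (fst @` K) w by move=> [[w' u] Ku /= <-]; exists u.
suff -> : fst @` K = Omega S by [].
apply: (Omega_minimal hC2 (sg := 1)); first by left.
- by move=> _ [p /KB[Op _] <-].
- by apply: continuous_compact cK; apply: continuous_subspaceT => p; exact: cvg_fst.
- by exists p0.1, p0.
- move=> t _ t0 [p Kp <-]; rewrite mul1r; have [z [_ _ _ Kz]] := KP p Kp.
  by exists (state p.1 z t).
Qed.

Lemma entireU K1 K2 r1 r2 : entire S K1 r1 -> entire S K2 r2 -> entire S (K1 `|` K2) (Num.max r1 r2).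
Proof.
have sub K r r' : r <= r' -> entire S K r -> K `<=` Omega S `*` @BU_ball R m r' /\
    forall p, K p -> exists z, [/\ seg z 0 = p.2, BC z r', forall t, leftsol p.1 z t & forall t, K (state p.1 z t)].
  move=> rr [KB _ KP]; split=> [p /KB[Op [Bp pr]]|p /KP[z [z0 bz lz Kz]]].
    by split=> //; split=> // s; exact: le_trans (pr s) rr.
  by exists z; split=> //; exact: BC_le bz.
move=> e1 e2; have [|s1 o1] := @sub K1 r1 (Num.max r1 r2) _ e1; first by rewrite le_max lexx.
have [|s2 o2] := @sub K2 r2 (Num.max r1 r2) _ e2; first by rewrite le_max lexx orbT.
split; first by move=> p [/s1|/s2].
  by apply: compactU; [case: e1|case: e2].
move=> p [/o1|/o2] [z [z0 bz lz Kz]]; exists z; split=> // t; [left|right]; exact: Kz.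
Qed.

Lemma back0 p : back 0 p = p.
Proof. by rewrite (back_state p (lexx 0)) oppr0 /state translate0 seg_ext0 -surjective_pairing. Qed.

(** On [K] the semiflow undoes [back], by uniqueness of solutions. *)
Lemma tau_back K r p q t : 0 <= r -> entire S K r -> K p -> 0 <= t -> tau S t (back t p) q <-> q = p.
Proof.
move=> r0 eK Kp t0; have [KB _ KP] := eK; have [z [z0 bz lz Kz]] := KP p Kp.
have zp : state p.1 z 0 = p by rewrite /state translate0 z0 -surjective_pairing.
have bp : back t p = state p.1 z (- t) by rewrite -{1}zp state_back// sub0r.
have Kb : K (back t p) by rewrite bp.
pose h s := z (- t + s).
have bh : BC h r by exact: BC_shift.
have lh s : leftsol (back t p).1 h s by exact: leftsol_shift.
have Kh s : K (state (back t p).1 h s) by rewrite bp /= state_shift.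
have sh : is_solution S (back t p).1 (back t p).2 h.
  apply/solutionP; split; first exact: bh.1.
    by rewrite seg_shift addr0 bp.
  by move=> s i _ e e0; have [d d0 dP] := entire_solves H r0 eK bh lh Kh (t := s) i I e0; exists d => // k _; exact: dP.
have ht : state (back t p).1 h t = p by rewrite bp /= state_shift addNr.
have [Ob [Bb _]] := KB _ Kb.
split=> [[z' sz' ->]|->]; last by exists h.
by rewrite (solution_unique H Ob Bb sz' sh) -[RHS]ht.
Qed.

(** The points of [K] at which the [i]-th coordinate reaches its highest value
    on the fibre form a compact set, which is invariant for backward time:
    a gap between two ordered solutions never closes. The points whose whole
    future it contains then form a positively invariant set, which is nonempty by
    [nested_images]. *)
Lemma minimal_at_top K r : minimal S K -> 0 <= r -> entire S K r ->
  forall p i, K p -> D S p.2 ord0 i = top S K p.1 ord0 i.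
Proof.
move=> [KB K0 cK iK minK] r0 eK p1 i Kp1.
have onto := entire_onto eK K0.
have [KB' _ KP] := eK.
have topP w := @top_max _ _ S H K r r0 eK onto w i.
suff : top S K p1.1 ord0 i <= D S p1.2 ord0 i.
  move=> le1; apply/le_anti/andP; split; last exact: le1.
  have [u _ [_ uP]] := topP _ (KB _ Kp1).1; apply: uP; rewrite -surjective_pairing; exact: Kp1.
pose E := K `&` [set p | top S K p.1 ord0 i <= D S p.2 ord0 i].
have clK : closed K := compact_closed (@state_hausdorff R m) cK.
have cDK : cont_on K (fun p => D S p.2 ord0 i) by apply: cont_on_sub (D_cont H i r0); exact: KB'.
have cE : compact E.
  apply: (subclosed_compact _ cK); last by move=> p [].
  move=> p cp; have Kp : K p by apply: clK => A /cp[q [[Kq _] Aq]]; exists q.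
  split; first exact: Kp.
  apply/ler_addgt0Pr => e e0; have e2 : 0 < e / 2 by lra.
  have Op := (KB _ Kp).1.
  have nT : \forall w \near p.1, forall q, graph S (roof S K) q -> q.1 = w ->
      - D S q.2 ord0 i < - top S K p.1 ord0 i + e / 2.
    apply: fibre_lt; [exact: vfield_hausdorff|exact: (roof_compact H r0 eK onto)| |].
      apply: cont_onN; apply: cont_on_sub (D_cont H i (r'_ge0 H r0)).
      exact: (roof_ball H r0 eK onto).
    move=> [w u] [/= Ow ->] wp; subst w; rewrite (D_roof H r0 eK onto i Ow).
    by rewrite ltrDl.
  have {}nT : \forall q \near p, forall q', graph S (roof S K) q' -> q'.1 = q.1 ->
      - D S q'.2 ord0 i < - top S K p.1 ord0 i + e / 2.
    exact: (@cvg_fst _ _ (nbhs p.1) (nbhs p.2) _ _ nT).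
  have [q [[Kq /= qt] [/(_ Kq) qD /= qT]]] := cp _ (filterI (cDK p Kp _ e2) nT).
  have Oq := (KB _ Kq).1.
  have := qT (q.1, roof S K q.1) (conj Oq erefl) erefl; rewrite /= (D_roof H r0 eK onto i Oq).
  move: qt qD; move: (D S _ _ _) (D S _ _ _) (top S K _ _ _) (top S K _ _ _) => a b c d.
  by rewrite ltr_norml => ? /andP[? ?] ?; lra.
have E0 : E !=set0.
  have [w Ow] := Omega_nonempty hC2; have [u Ku [ut _]] := topP w Ow.
  by exists (w, u); split=> //=; rewrite ut.
have bE s p : 0 <= s -> E p -> E (back s p).
  move=> s0 [Kp tp]; have [z [z0 bz lz Kz]] := KP p Kp; have Op := (KB _ Kp).1.
  have zp : state p.1 z 0 = p by rewrite /state translate0 z0 -surjective_pairing.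
  have bp : back s p = state p.1 z (- s) by rewrite -{1}zp state_back// sub0r.
  split; first by rewrite bp.
  have [bh hP] := topsolP H r0 eK onto Op.
  set h := topsol S K p.1 in bh hP; set r1 := (_ / _) in bh.
  (* Were the highest value missed in the past, it would be missed now. *)
  rewrite bp /= leNgt; apply/negP => lt1.
  have [L1 L10 L1P] := entire_lip H r0; have [L2 L20 L2P] := topsol_Dlip H r0 eK onto.
  have DL z' L L' : Dlip S z' L -> L <= L' -> Dlip S z' L'.
    by move=> zL LL u v j; apply: le_trans (zL u v j) _; rewrite ler_wpM2r.
  have oz : orbit S K r p.1 z by split.
  have := @separation _ _ S H p.1 z h (Num.max r r1) (Num.max L1 L2) (- s) 0 i.
  have -> : DD z 0 i < DD h 0 i = false.
    apply/negbTE; rewrite -leNgt hP translate0; apply: le_trans tp _.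
    by rewrite /DD z0.
  move=> sep; have // : is_true false; apply: sep; rewrite ?le_max ?r0 ?L10 ?oppr_le0//.
  - by apply: BC_le bz; rewrite le_max lexx.
  - by apply: BC_le bh; rewrite le_max lexx orbT.
  - by apply: DL (L1P K p z eK bz lz Kz) _; rewrite le_max lexx.
  - by apply: DL (L2P _ Op) _; rewrite le_max lexx orbT.
  - by move=> t _; apply: (solves_leftsol (a := t - 1) (topsol_solves H r0 eK onto Op)) => //; lra.
  - by move=> t j; rewrite hP; exact: (orbit_le_top H r0 eK onto t j oz).
  - by rewrite hP; exact: lt1.
have [p2 p2P] : exists p, forall s, 0 <= s -> exists2 q, E q & back s q = p.
  apply: (nested_images (@state_hausdorff R m) _ _ cE E0 bE) => [s|s t p]; first exact: back_continuous.
  exact: backD.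
(* The points whose whole future is spent in [E]. *)
pose K' := [set p | forall s, 0 <= s -> (back s @` E) p].
have K'E : K' `<=` E by move=> p /(_ 0 (lexx 0))[q Eq <-]; rewrite back0.
suff EK : K' = K by move: Kp1; rewrite -EK => /K'E[]; rewrite EK.
apply: minK.
- by move=> p /K'E[].
- by exists p2 => s /p2P[q Eq qs]; exists q.
- apply: (subclosed_compact _ cE) => // p cp s s0.
  apply: (compact_closed (@state_hausdorff R m) (A := back s @` E)).
    by apply: continuous_compact cE; exact/continuous_subspaceT/back_continuous.
  by move=> A /cp[q [K'q Aq]]; exists q; split=> //; exact: K'q.
- move=> p t K'p t0; have [q Eq qp] := K'p t t0; have [Kq _] := Eq.
  have tq q' : tau S t p q' <-> q' = q by rewrite -qp; exact: tau_back r0 eK Kq t0.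
  split=> [|_ /tq ->]; first by exists q; exact/tq.
  move=> s s0; have [y Ey yp] := K'p _ (addr_ge0 t0 s0).
  have [Ky _] := bE s y s0 Ey.
  exists y => //; apply/tq; rewrite -yp backD//; exact/(tau_back _ r0 eK Ky t0).
Qed.

(** By the previous lemma all orbits of [K] have the same [D]-values as the
    roof, at all times. *)
Lemma minimal_roof K r : minimal S K -> 0 <= r -> entire S K r -> K = graph S (roof S K).
Proof.
move=> mK r0 eK; have [KB K0 cK iK minK] := mK.
have onto := entire_onto eK K0.
have [_ _ _ _] := roof_minimal H r0 eK onto; apply=> // p Kp.
have [KB' _ KP] := eK; have [z [z0 bz lz Kz]] := KP p Kp; have Op := (KB _ Kp).1.
split=> //; have [bh hP] := topsolP H r0 eK onto Op.
rewrite -z0 /roof; apply: eq_seg => s s0.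
have b1 := BC_le (_ : r <= Num.max r _) bz.
apply: (DD_inj hC4 bz bh (t := 0)) => // t i _; rewrite hP.
exact: (minimal_at_top mK r0 eK i (Kz t)).
Qed.

Lemma graph_shift x w s : minimal S (graph S x) -> Omega S w -> s <= 0 ->
  shift_hist (x w) (clamp s) = x (translate s w).
Proof.
move=> mx Ow s0; have [r r0 [_ _ /(_ (w, x w) (conj Ow erefl))[z [/= z0 _ _ Kz]]]] := minimal_entire H mx.
have [_ /= <-] := Kz s; rewrite -z0 -seg_ext//; apply: eq_seg => t ts.
by rewrite ext_seg ?add0r//; exact: le_trans ts s0.
Qed.

(** An inequality between [D]-values over the whole hull contains those at past
    times, since the graphs are invariant. *)
Lemma graph_leD x y : minimal S (graph S x) -> minimal S (graph S y) ->
  (forall w i, Omega S w -> D S (x w) ord0 i <= D S (y w) ord0 i) -> forall w, Omega S w -> leD S (x w) (y w).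
Proof.
move=> mx my xy w Ow s i; have s0 := past_le0 s; have := xy (translate (val s) w) i (Omega_translate hC2 Ow).
by rewrite -(graph_shift mx Ow s0) -(graph_shift my Ow s0) clamp_val.
Qed.

Lemma graph_BU x w : minimal S (graph S x) -> Omega S w -> BU (x w).
Proof. by move=> [xB _ _ _ _] Ow; have [] := xB (w, x w) (conj Ow erefl). Qed.

Lemma graph_eqD x y : minimal S (graph S x) -> minimal S (graph S y) ->
  (forall w i, Omega S w -> D S (x w) ord0 i = D S (y w) ord0 i) -> forall w, Omega S w -> x w = y w.
Proof.
move=> mx my xy w Ow; have [_ [r _ bx]] := BU_ext (graph_BU mx Ow); have [_ [r' _ by_]] := BU_ext (graph_BU my Ow).
rewrite -(seg_ext0 (x w)) -(seg_ext0 (y w)); apply: eq_seg => s s0.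
apply: (DD_inj hC4 bx by_ (t := 0)) => // t i t0.
by rewrite /DD !seg_ext// !graph_shift//; apply: xy; exact: Omega_translate.
Qed.

Lemma graph_mass x y w : minimal S (graph S x) -> minimal S (graph S y) ->
  (forall w i, Omega S w -> D S (x w) ord0 i <= D S (y w) ord0 i) -> Omega S w ->
  M S w (x w) + \sum_i (D S (y w) ord0 i - D S (x w) ord0 i) <= M S w (y w).
Proof.
move=> mx my xy Ow; have [_ [r r0 bx]] := BU_ext (graph_BU mx Ow); have [_ [r' r'0 by_]] := BU_ext (graph_BU my Ow).
rewrite !M_ext; under eq_bigr do rewrite !D_ext.
apply: (MM_le S_closed hC1 hC3 hC4 Ow (r := Num.max r r')).
- by apply: BC_le bx; rewrite le_max lexx.
- by apply: BC_le by_; rewrite le_max lexx orbT.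
- by move=> s i s0; rewrite /DD !seg_ext// !graph_shift//; apply: xy; exact: Omega_translate.
Qed.

(** The roof of the union of the two graphs. *)
Lemma graph_sup x y : minimal S (graph S x) -> minimal S (graph S y) -> exists b, minimal S (graph S b) /\
  forall w i, Omega S w -> [/\ D S (x w) ord0 i <= D S (b w) ord0 i, D S (y w) ord0 i <= D S (b w) ord0 i &
    D S (b w) ord0 i = D S (x w) ord0 i \/ D S (b w) ord0 i = D S (y w) ord0 i].
Proof.
move=> mx my; have [r1 r10 e1] := minimal_entire H mx; have [r2 r20 e2] := minimal_entire H my.
have eU := entireU e1 e2; set K := (_ `|` _) in eU; set r := Num.max _ _ in eU.
have r0 : 0 <= r by rewrite le_max r10.
have onto : forall w, Omega S w -> exists u, K (w, u) by move=> w Ow; exists (x w); left.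
exists (roof S K); split; first exact: (roof_minimal H r0 eU onto).
move=> w i Ow; rewrite (D_roof H r0 eU onto i Ow).
have [u Ku [ut uP]] := top_max H r0 eU onto i Ow; split.
- by apply: uP; left.
- by apply: uP; right.
- by rewrite -ut; case: Ku => -[_ /= ->]; [left|right].
Qed.

Definition zero_hist : hist R m := fun _ => 0.

Lemma ext_zero : ext zero_hist = fun=> 0.
Proof. by []. Qed.

Lemma DD_zero t i : DD (fun=> 0) t i = 0.
Proof.
have -> : (fun=> 0) = (fun=> const_mx 0) :> (R -> 'rV[R]_m) by apply/funext => s; apply/rowP => j; rewrite !mxE.
by rewrite DD_const mul0r.
Qed.

Lemma D_zero i : D S zero_hist ord0 i = 0.
Proof. by rewrite D_ext DD_zero. Qed.

Lemma FF_zero w t i : Omega S w -> FF w (fun=> 0) t i = 0.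
Proof.
move=> Ow; rewrite FFE// [X in _ - X]big1 ?subr0 => [|j _]; last by rewrite /rate mxE (G_zero hC1).
rewrite big1// => j _; under eq_Rintegral do rewrite /rate mxE (G_zero hC1)//.
by rewrite int_cst mul0r.
Qed.

Lemma BC_zero : BC (fun=> 0 : 'rV[R]_m) 0.
Proof. by split=> [|t i]; [exact: cst_continuous|rewrite mxE normr0]. Qed.

(** The zero solution is its own roof. *)
Lemma zero_minimal : minimal S (graph S (fun=> zero_hist)).
Proof.
have eK : entire S (graph S (fun=> zero_hist)) 0.
  have zB : BU_ball 0 zero_hist.
    rewrite -(seg_ext0 zero_hist); apply: seg_BU => //; first exact: BC_zero.
    by move=> e e0; exists 1 => // s t _; rewrite subrr normr0.
  split.
  - by move=> [w u] [/= Ow ->].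
  - have -> : graph S (fun=> zero_hist) = Omega S `*` [set zero_hist].
      by apply/predeqP => -[w u]; split.
    by apply: compact_setX; [exact: Omega_compact|exact: compact_set1].
  - move=> [w u] [/= Ow ->]; exists (fun=> 0); split=> //; first exact: BC_zero.
      move=> t i eta eta0; exists 1 => // e e0 _.
      by rewrite !DD_zero FF_zero// mulr0 subr0 addr0 normr0 mulr_ge0// ltW.
    by move=> t; split=> //=; exact: Omega_translate.
have onto : forall w, Omega S w -> exists u, graph S (fun=> zero_hist) (w, u) by move=> w Ow; exists zero_hist.
have -> : graph S (fun=> zero_hist) = graph S (roof S (graph S (fun=> zero_hist))).
  apply/predeqP => -[w u]; suff E : Omega S w -> roof S (graph S (fun=> zero_hist)) w = zero_hist.
    by split=> -[/= Ow uE]; split=> //=; rewrite uE E.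
  move=> Ow; have [bh hP] := topsolP H (lexx 0) eK onto Ow.
  rewrite -(seg_ext0 zero_hist) ext_zero /roof; apply: eq_seg => s s0.
  apply: (DD_inj hC4 bh BC_zero (t := 0)) => // t i _; rewrite hP DD_zero.
  have [v [_ /= ->] [<- _]] := top_max H (lexx 0) eK onto i (Omega_translate (t := t) hC2 Ow).
  exact: D_zero.
exact: (roof_minimal H (lexx 0) eK onto).
Qed.

Lemma M_zero w : Omega S w -> M S w zero_hist = 0.
Proof.
move=> Ow; rewrite M_ext MME big1 ?add0r => [|i _]; last exact: DD_zero.
rewrite /content big1// => i _; rewrite big1// => j _; rewrite /pipe_mass.
have -> : (rate w (ext zero_hist) j i) = fun=> 0 by apply/funext => t; rewrite /rate mxE (G_zero hC1).
have E0 s : \int[lebesgue_measure]_(r in `[s, 0]) (0 : R) = 0 by rewrite Rintegral_cst// mul0r.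
by under eq_Rintegral do rewrite E0; rewrite int_cst mul0r.
Qed.

Hypothesis hC7 : C7 S.

(** The join [b] of the zero solution and [x] lies above 0. If they had a
    coordinate of [D] in common somewhere, strong monotonicity would give
    [b = 0], so [x] would lie below 0 and have no positive mass. Hence every
    coordinate of [D] is positive on [b], where it can only come from [x]. *)
Lemma minimal_positive x c : minimal S (graph S x) -> 0 < c -> (forall w, Omega S w -> M S w (x w) = c) ->
  graph S x `<=` Omega S `*` BUD S.
Proof.
move=> mx c0 xc; have [b [mb bP]] := graph_sup zero_minimal mx.
have b0 w : Omega S w -> BUD S (b w).
  move=> Ow; split; first exact: graph_BU.
  move=> s i; have s0 := past_le0 s; rewrite -(clamp_val s) graph_shift//.
  by have [h _ _] := bP (translate (val s) w) i (Omega_translate hC2 Ow); move: h; rewrite D_zero.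
have pos w i : Omega S w -> D S (b w) ord0 i <> 0.
  move=> Ow Di; have E : forall w, Omega S w -> zero_hist = b w.
    apply: (hC7 zero_minimal mb).
    - move=> [v u] [/= Ov ->]; split=> //; split; first exact: (graph_BU zero_minimal Ov).
      move=> s j; have -> : shift_hist zero_hist s = zero_hist by [].
      by rewrite D_zero.
    - by move=> [v u] [/= Ov ->]; split=> //; exact: b0.
    - by apply: (graph_leD zero_minimal mb) => v j Ov; have [] := bP v j Ov.
    - by exists w, i; rewrite D_zero Di.
  have := graph_mass mx zero_minimal _ Ow; rewrite xc// M_zero//.
  have xz v j : Omega S v -> D S (x v) ord0 j <= D S zero_hist ord0 j.
    by move=> Ov; have [_ h _] := bP v j Ov; rewrite (E v Ov).
  move=> /(_ xz); have : 0 <= \sum_i (D S zero_hist ord0 i - D S (x w) ord0 i).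
    by apply: sumr_ge0 => j _; rewrite subr_ge0; exact: xz.
  by move: (\sum_i _) => a; lra.
move=> [w u] [/= Ow ->]; split=> //; split; first exact: graph_BU.
move=> s i; have s0 := past_le0 s; rewrite -(clamp_val s) graph_shift//.
have Os := Omega_translate (t := val s) hC2 Ow.
have [h0 _ [h|<-]] := bP _ i Os; last by move: h0; rewrite D_zero.
by case: (pos _ i Os); rewrite h D_zero.
Qed.

(** The join of [x] and [y] agrees with one of them in some coordinate of [D],
    hence everywhere by strong monotonicity. If it is [y], the claim follows; if
    it is [x], then [y] lies below [x] and has at least as much mass, so the two
    agree. *)
Lemma minimal_ordered x y c d : minimal S (graph S x) -> minimal S (graph S y) -> 0 < c -> c <= d ->
  (forall w, Omega S w -> M S w (x w) = c) -> (forall w, Omega S w -> M S w (y w) = d) ->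
  forall w i, Omega S w -> D S (x w) ord0 i <= D S (y w) ord0 i.
Proof.
move=> mx my c0 cd xc yd; have [b [mb bP]] := graph_sup mx my.
have Px := minimal_positive mx c0 xc.
have Py := minimal_positive my (lt_le_trans c0 cd) yd.
have xb v j : Omega S v -> D S (x v) ord0 j <= D S (b v) ord0 j by move=> Ov; have [] := bP v j Ov.
have yb v j : Omega S v -> D S (y v) ord0 j <= D S (b v) ord0 j by move=> Ov; have [] := bP v j Ov.
have Pb : graph S b `<=` Omega S `*` BUD S.
  move=> [v u] [/= Ov ->]; split=> //; split; first exact: graph_BU.
  move=> s i; have [_ [_ /(_ s i) h]] := Px (v, x v) (conj Ov erefl).
  by apply: le_trans h _; exact: graph_leD.
have [w0 Ow0] := Omega_nonempty hC2.
have [_ _ hb] := bP w0 (Ordinal (st_pos H)) Ow0.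
have [E|E] : (forall w, Omega S w -> x w = b w) \/ (forall w, Omega S w -> y w = b w).
  case: hb => hb; [left; apply: (hC7 mx mb Px Pb)|right; apply: (hC7 my mb Py Pb)] => //.
  - exact: graph_leD.
  - by exists w0, (Ordinal (st_pos H)).
  - exact: graph_leD.
  - by exists w0, (Ordinal (st_pos H)).
- move=> w i Ow; have yx v j : Omega S v -> D S (y v) ord0 j <= D S (x v) ord0 j.
    by move=> Ov; rewrite (E v Ov); exact: yb.
  have := graph_mass my mx yx Ow; rewrite xc// yd// => h1.
  have h2 : \sum_i (D S (x w) ord0 i - D S (y w) ord0 i) <= 0.
    by move: h1; move: (\sum_i _) => a; lra.
  have ge0 j : 0 <= D S (x w) ord0 j - D S (y w) ord0 j by rewrite subr_ge0; exact: yx.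
  by have := sum_le0 i ge0 h2; rewrite subr_le0.
- by move=> w i Ow; rewrite (E w Ow); exact: xb.
Qed.

Lemma minimal_is_graph K : minimal S K -> exists2 x, K = graph S x & minimal S (graph S x).
Proof.
move=> mK; have [r r0 eK] := minimal_entire H mK.
by have E := minimal_roof mK r0 eK; exists (roof S K) => //; rewrite -E.
Qed.

Lemma minimal_unique K1 K2 c : minimal S K1 -> minimal S K2 -> 0 < c ->
  (forall p, K1 p -> M S p.1 p.2 = c) -> (forall p, K2 p -> M S p.1 p.2 = c) -> K1 = K2.
Proof.
move=> /minimal_is_graph[x -> mx] /minimal_is_graph[y -> my] c0 xc yc.
have {}xc w (Ow : Omega S w) : M S w (x w) = c by exact: (xc (w, x w)).
have {}yc w (Ow : Omega S w) : M S w (y w) = c by exact: (yc (w, y w)).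
have E : forall w, Omega S w -> x w = y w.
  apply: graph_eqD => // w i Ow; apply/le_anti/andP; split.
    exact: (minimal_ordered mx my c0 (lexx c) xc yc).
  exact: (minimal_ordered my mx c0 (lexx c) yc xc).
by apply/predeqP => -[w u]; split=> -[/= Ow ->]; rewrite ?E//; split=> //=; rewrite E.
Qed.

Lemma minimal_ltK K1 K2 c1 c2 : 0 < c1 -> c1 < c2 -> minimal S K1 -> minimal S K2 ->
  (forall p, K1 p -> M S p.1 p.2 = c1) -> (forall p, K2 p -> M S p.1 p.2 = c2) -> ltK S K1 K2.
Proof.
move=> c0 cc /minimal_is_graph[x -> mx] /minimal_is_graph[y -> my] xc yc.
have {}xc w (Ow : Omega S w) : M S w (x w) = c1 by exact: (xc (w, x w)).
have {}yc w (Ow : Omega S w) : M S w (y w) = c2 by exact: (yc (w, y w)).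
exists x, y; split=> // w Ow; split.
  by apply: graph_leD => //; exact: (minimal_ordered mx my c0 (ltW cc) xc yc).
by move=> xy; have := xc w Ow; rewrite xy yc// => E; move: cc; rewrite E ltxx.
Qed.

End MinimalSets.

(** * Existence of solutions *)

Lemma window (R : realType) (s t k h d : R) :
  t - `|k| - h <= s -> s <= t + `|k| -> `|k| < d / 2 -> h < d / 2 -> 0 < h -> `|s - t| < d.
Proof. by rewrite ltr_distl; have := normr_ge0 k; move: `|k| => a *; apply/andP; split; lra. Qed.

Section Existence.
Variables (R : realType) (m : nat) (S : compartmental R m).
Hypothesis H : standing S.
Let S_closed := st_closed H.
Let hC1 := st_C1 H.
Let hC2 := st_C2 H.
Let hC3 := st_C3 H.
Let hC4 := st_C4 H.
Let hC5 := st_C5 H.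
Implicit Types (w : vfield R m) (s t e T h : R) (i j : 'I_m) (z y : R -> 'rV[R]_m) (x : hist R m).
Local Notation DD := (DD S).
Local Notation FF := (FF S).
Local Notation MM := (MM S).
Local Notation kap := (kap S).
Local Notation Dinv := (Dinv S).
Local Notation leftsol := (leftsol S).
Local Notation solves := (solves S).

Variables (w : vfield R m) (c C : R).
Let r := (c + 1) / (1 - kap).
Hypotheses (Ow : Omega S w) (c0 : 0 <= c) (C0 : 0 <= C).
Hypothesis HC : forall w z t i, Omega S w -> BU_ball r (seg z t) -> `|FF w z t i| <= C.

Definition clip (v : R) := Num.max 0 (Num.min v (c + 1)).

Lemma clip_dist (u v : R) : `|clip u - clip v| <= `|u - v|.
Proof.
apply: max_dist; first by rewrite subrr normr0.
by rewrite ![Num.min _ (c + 1)]minC; rewrite ![Num.min (c + 1) _]minC; exact: min_lip.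
Qed.

Lemma clip_id (v : R) : 0 <= v -> v <= c + 1 -> clip v = v.
Proof. by move=> v0 v1; rewrite /clip min_l// max_r. Qed.

Lemma clip_range (v : R) : 0 <= clip v <= c + 1.
Proof. by rewrite /clip le_max lexx ge_max ge_min lexx orbT addr_ge0. Qed.

(** Clipping the [D]-values keeps the field bounded, whatever [y] does. *)
Definition unD y := Dinv (fun t => \row_i clip (y t ord0 i)).
Definition Phi y t i := FF w (unD y) t i.

Lemma r_ge0 : 0 <= r.
Proof. by apply: divr_ge0; [exact: addr_ge0|exact/ltW/(kap1 hC4)]. Qed.

Lemma unDP y : lip y C -> BC (unD y) r /\ forall t i, DD (unD y) t i = clip (y t ord0 i).
Proof.
move=> ly; have bz : BC (fun t => \row_i clip (y t ord0 i) : 'rV[R]_m) (c + 1).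
  split=> [|t i]; last first.
    by rewrite mxE; have /andP[? ?] := clip_range (y t ord0 i); rewrite ger0_norm.
  apply: (@lip_continuous _ _ _ C) => s t i; rewrite !mxE.
  exact: le_trans (clip_dist _ _) (ly s t i).
by have [b1 b2] := DinvP hC4 bz; split=> // t i; rewrite b2 mxE.
Qed.

Lemma unD_BU y t : lip y C -> BU_ball r (seg (unD y) t).
Proof.
move=> ly; have [bz zP] := unDP ly; apply: seg_BU => //; first exact: r_ge0.
apply: lip_ucont; apply: (Dlip_lip H C0 bz) => s u i.
by rewrite !zP; exact: le_trans (clip_dist _ _) (ly s u i).
Qed.

Lemma Phi_bound y t i : lip y C -> `|Phi y t i| <= C.
Proof. by move=> ly; apply: HC => //; exact: unD_BU. Qed.

Lemma eq_unD y y' t : lip y C -> lip y' C -> (forall s, s <= t -> y s = y' s) ->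
  forall s, s <= t -> unD y s = unD y' s.
Proof.
move=> ly ly' yy; have [bz zP] := unDP ly; have [bz' zP'] := unDP ly'.
by apply: (DD_inj hC4 bz bz') => s i st; rewrite zP zP' yy.
Qed.

Lemma eq_Phi y y' t i : lip y C -> lip y' C -> (forall s, s <= t -> y s = y' s) -> Phi y t i = Phi y' t i.
Proof. by move=> ly ly' yy; apply: eq_FF; exact: eq_unD yy. Qed.

(** An integrated form of the differential equation with delay at most [h]: it
    is preserved by concatenation of Euler steps, and by locally uniform limits
    in which [h] tends to 0. *)
Definition chases y T h := forall a b i (v eta : R), 0 <= a -> a <= b -> b <= T ->
  (forall s, 0 <= s -> a - h <= s -> s <= b -> `|Phi y s i - v| <= eta) ->
  `|y b ord0 i - y a ord0 i - (b - a) * v| <= eta * (b - a).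

Lemma euler_step y T h : 0 <= T -> 0 < h -> lip y C -> chases y T h ->
  exists y', [/\ lip y' C, forall s, s <= T -> y' s = y s & chases y' (T + h) h].
Proof.
move=> T0 h0 ly cy.
pose y' t := if t <= T then y t else y T + (t - T) *: \row_i Phi y T i.
have lo s : s <= T -> y' s = y s by rewrite /y' => ->.
have hi s i : T <= s -> y' s ord0 i = y T ord0 i + (s - T) * Phi y T i.
  rewrite /y'; case: (leP s T) => [sT Ts|_ _]; last by rewrite !mxE.
  have -> : s = T by apply/le_anti/andP.
  by rewrite subrr mul0r addr0.
have ly' : lip y' C.
  have le s t i : s <= t -> `|y' t ord0 i - y' s ord0 i| <= C * (t - s).
    move=> st; have PT := Phi_bound T i ly; have [tT|Tt] := leP t T.
      rewrite (lo t tT) (lo s (le_trans st tT)).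
      by have := ly s t i; rewrite (ger0_norm (_ : 0 <= t - s)) ?subr_ge0.
    have lin u : T <= u -> u <= t -> `|y' t ord0 i - y' u ord0 i| <= C * (t - u).
      move=> Tu ut; rewrite !hi ?(ltW Tt)//.
      rewrite (_ : _ - _ = Phi y T i * (t - u)); last by ring.
      by rewrite normrM (ger0_norm (_ : 0 <= t - u)) ?subr_ge0// ler_wpM2r// subr_ge0.
    have [sT|Ts] := leP s T; last by apply: lin => //; exact: ltW.
    have h1 := lin T (lexx T) (ltW Tt); have h2 := ly s T i.
    rewrite (ger0_norm (_ : 0 <= T - s)) ?subr_ge0// in h2.
    rewrite [y' s]lo//; rewrite [y' T]lo// in h1; apply: le_trans (ler_distD (y T ord0 i) _ _) _.
    by apply: le_trans (lerD h1 h2) _; rewrite -mulrDr subrKA.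
  move=> s t i; have [st|st] := leP s t; first by rewrite (ger0_norm (_ : 0 <= t - s)) ?subr_ge0//; exact: le.
  by rewrite distrC [`|t - s|]distrC (ger0_norm (_ : 0 <= s - t)) ?subr_ge0; [exact/le/ltW|exact: ltW].
exists y'; split=> // a b i v eta a0 ab bT Pv.
have PE s : s <= T -> Phi y' s i = Phi y s i.
  by move=> sT; apply: eq_Phi => // u us; apply: lo; exact: le_trans sT.
have lin u : T <= u -> u <= b -> a - h <= T -> `|y' b ord0 i - y' u ord0 i - (b - u) * v| <= eta * (b - u).
  move=> Tu ub aT; rewrite !hi//; last exact: le_trans ub.
  rewrite (_ : _ - _ - _ = (Phi y T i - v) * (b - u)); last by ring.
  rewrite normrM (ger0_norm (_ : 0 <= b - u)) ?subr_ge0// ler_wpM2r ?subr_ge0//.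
  by rewrite -PE//; apply: Pv => //; exact: le_trans ub.
have old b' : a <= b' -> b' <= b -> b' <= T -> `|y' b' ord0 i - y' a ord0 i - (b' - a) * v| <= eta * (b' - a).
  move=> ab' bb bT'; rewrite !lo//; last exact: le_trans bT'.
  apply: cy => // s s0 as_ sb; rewrite -PE; last exact: le_trans bT'.
  by apply: Pv => //; exact: le_trans bb.
have [bT'|Tb] := leP b T; first exact: old.
have [aT|Ta] := leP a T; last by apply: lin; lra.
have h1 := old T aT (ltW Tb) (lexx T); have h2 := lin T (lexx T) (ltW Tb) _.
have {}h2 := h2 (_ : _); rewrite (_ : _ - _ - _ = (y' T ord0 i - y' a ord0 i - (T - a) * v) +
  (y' b ord0 i - y' T ord0 i - (b - T) * v)); last by ring.
apply: le_trans (ler_normD _ _) _; rewrite (_ : eta * (b - a) = eta * (T - a) + eta * (b - T)); last by ring.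
by apply: lerD => //; apply: h2; lra.
Qed.

Lemma euler y0 h n : 0 < h -> lip y0 C ->
  exists y, [/\ lip y C, forall s, s <= 0 -> y s = y0 s & chases y (n%:R * h) h].
Proof.
move=> h0 ly0; elim: n => [|n [y [ly yy cy]]].
  exists y0; split=> // a b i v eta a0 ab; rewrite mul0r => b0 _.
  have -> : b = a by lra.
  by rewrite !subrr mul0r mulr0 subr0 normr0.
have T0 : 0 <= n%:R * h by rewrite mulr_ge0// ltW.
have [y' [ly' yy' cy']] := euler_step T0 h0 ly cy.
exists y'; split=> // [s s0|]; first by rewrite yy' ?yy//; exact: le_trans T0.
by rewrite -natr1 mulrDl mul1r.
Qed.

(** The Euler polygons are uniformly Lipschitz; a cluster point, which exists by
    Ascoli, follows the clipped field without delay. *)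
Lemma clipped_solution y0 B T : 0 < T -> lip y0 C -> (forall s i, s <= 0 -> `|y0 s ord0 i| <= B) ->
  exists y, [/\ lip y C, forall s, s <= 0 -> y s = y0 s & forall t i eta, 0 <= t <= T -> 0 < eta ->
    exists2 d, 0 < d & forall k, 0 <= t + k <= T -> `|k| < d ->
      `|y (t + k) ord0 i - y t ord0 i - k * Phi y t i| <= eta * `|k|].
Proof.
move=> T0 ly0 y0B.
have /choice[Y YP] : forall n : nat, exists y, [/\ lip y C, forall s, s <= 0 -> y s = y0 s & chases y T (T / n.+1%:R)].
  move=> n; have hn : 0 < T / n.+1%:R by rewrite divr_gt0.
  by have := @euler y0 _ n.+1 hn ly0; rewrite mulrC divfK.
(* Shifted so that the horizon becomes time 0, the polygons are histories. *)
pose X n : hist R m := seg (Y n) T.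
have extX n s : ext (X n) s = Y n (T + Num.min s 0) by [].
have XK n : [set x : hist R m | (forall t i, `|ext x t ord0 i| <= B + C * T) /\ lip (ext x) C] (X n).
  have [lY Y0 _] := YP n; split=> [t i|s t i]; rewrite !extX.
    set u := T + _; have uT : u <= T by rewrite /u gerDl ge_min lexx orbT.
    have [u0|u0] := leP u 0.
      by rewrite Y0//; apply: le_trans (y0B u i u0) _; rewrite lerDl mulr_ge0// ltW.
    have h1 := lY 0 u i; have h2 := y0B 0 i (lexx 0); rewrite -(Y0 0 (lexx 0)) in h2.
    rewrite -(subrK (Y n 0 ord0 i) (Y n u ord0 i)) addrC; apply: le_trans (ler_normD _ _) _.
    apply: lerD => //; apply: le_trans h1 _; rewrite subr0 (gtr0_norm u0); exact: ler_wpM2l.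
  apply: le_trans (lY _ _ _) _; rewrite ler_wpM2l//.
  by rewrite (_ : _ - _ = Num.min t 0 - Num.min s 0) ?min_lip//; ring.
have [|x [[xB xl] xc]] := @lip_hist_compact R m (B + C * T) C (X @ \oo) _ _.
  by exists 0%N => // n _; exact: XK.
pose y t := ext x (t - T).
have ly : lip y C by move=> s t i; apply: le_trans (xl _ _ _) _; rewrite (_ : _ - _ = t - s) ?ler_wpM2l//; ring.
have near_y (T1 e : R) (N : nat) : 0 <= T1 -> 0 < e -> exists2 n, (N <= n)%N &
    forall s i, T - T1 <= s -> s <= T -> `|Y n s ord0 i - y s ord0 i| < e.
  move=> T10 e0; have [|_ [[n Nn <-] nx]] := xc (X @` [set n | (N <= n)%N]) _ _ (xnear_nbhs x T1 e0).
    by exists N => // n Nn; exists n.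
  exists n => // s i s1 sT; have := @xnear_ext _ _ x (X n) T1 e (s - T) i T10 nx.
  rewrite extX min_l ?subr_le0//; have -> : T + (s - T) = s by ring.
  by apply; lra.
have yy0 s : s <= 0 -> y s = y0 s.
  move=> s0; apply/rowP => i; apply/eqP; rewrite -subr_eq0 -normr_le0; apply/ler_addgt0Pr => e e0.
  have T10 : 0 <= T - s by lra.
  have [n _ /(_ s i)] := near_y _ e 0%N T10 e0; have [_ Y0 _] := YP n.
  by rewrite Y0// distrC add0r => h; apply/ltW/h; lra.
exists y; split=> // t i eta /andP[t0 tT] eta0.
have [bz zP] := unDP ly.
have uz : ucont (unD y).
  apply: lip_ucont; apply: (Dlip_lip H C0 bz) => s u j.
  by rewrite !zP; exact: le_trans (clip_dist _ _) (ly s u j).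
have [T' [d [T'0 d0 FP]]] := FF_near H t r_ge0 Ow bz uz eta0.
have d2 : 0 < d / 2 by lra.
exists (d / 2) => // k /andP[k0 kT] kd; apply/ler_addgt0Pr => ze ze0.
have k1 := kap1 hC4.
(* Inverting [D] enlarges distances by at most [(1 - kap)^-1]. *)
pose e := Num.min (ze / 2) (d * (1 - kap)).
have e0 : 0 < e by rewrite lt_min; apply/andP; split; [lra|exact: mulr_gt0].
have [N NP] : exists N : nat, forall n, (N <= n)%N -> T / n.+1%:R < d / 2.
  exists (Num.truncn (T / (d / 2))) => n Nn.
  rewrite ltr_pdivrMr// mulrC -ltr_pdivrMr//.
  apply: lt_le_trans (truncnS_gt _) _; rewrite ler_nat ltnS//.
have [n Nn nP] := near_y T e N (ltW T0) e0; have [lY Y0 cY] := YP n.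
pose Yf s := Y n (Num.min s T).
have lYf : lip Yf C by move=> s u j; apply: le_trans (lY _ _ _) _; rewrite ler_wpM2l ?min_lip.
have close s j : `|Yf s ord0 j - y s ord0 j| <= e.
  have -> : y s = y (Num.min s T).
    have E : Num.min s T - T = Num.min (s - T) 0.
      have [sT|Ts] := leP s T; first by rewrite min_l// subr_le0.
      by rewrite subrr min_r// subr_ge0 ltW.
    by rewrite /y E ext_clamp.
  rewrite /Yf; set u := Num.min s T; have uT : u <= T by rewrite ge_min lexx orbT.
  have [u0|u0] := leP u 0; first by rewrite Y0// yy0// subrr normr0 ltW.
  by apply/ltW/nP => //; lra.
have [bf fP] := unDP lYf.
have closeD s j : `|unD Yf s ord0 j - unD y s ord0 j| <= d.
  have := DD_bound hC4 (BCB bf bz) (ltW e0) (t := s) _ j (lexx s).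
  rewrite !mxE; move=> /(_ _)/le_trans; apply.
    by move=> u j' _; rewrite (@DDB _ _ S _ _ _ _ u j' bf bz) fP zP; apply: le_trans (clip_dist _ _) (close u j').
  by rewrite ler_pdivrMr// ge_min lexx orbT.
have FPn s : s <= T -> `|s - t| < d -> `|Phi (Y n) s i - Phi y t i| <= eta.
  move=> sT st; rewrite (_ : Phi (Y n) s i = Phi Yf s i); last first.
    by apply: eq_Phi => // u us; rewrite /Yf min_l//; exact: le_trans sT.
  apply/ltW/FP => //; [exact: unD_BU|exact: near_on_refl].
have ze2 : e <= ze / 2 by rewrite ge_min lexx.
have cl s j : 0 <= s -> s <= T -> `|Y n s ord0 j - y s ord0 j| <= ze / 2.
  by move=> s0 sT; have := close s j; rewrite /Yf min_l// => /le_trans; apply.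
apply: dist3 (cl _ i k0 kT) (cl _ i t0 tT).
have hn := NP n Nn; have hn0 : 0 < T / n.+1%:R by rewrite divr_gt0.
have [kp|kn] := leP 0 k.
  have := cY t (t + k) i (Phi y t i) eta t0 _ kT; rewrite (_ : t + k - t = k) ?(ger0_norm kp); [apply|by ring].
    by rewrite lerDl.
  move=> s s0 s1 s2; apply: FPn; first exact: le_trans kT.
  by apply: window kd hn hn0; rewrite (ger0_norm kp)//; apply: le_trans s1; rewrite lerD2r gerBl.
have := cY (t + k) t i (Phi y t i) eta k0 _ tT; rewrite (_ : t - (t + k) = - k); last by ring.
rewrite (ltr0_norm kn) => h.
have flip (p q g : R) : `|p - q - k * g| = `|q - p - - k * g|.
  by rewrite -normrN; congr `|_|; rewrite mulNr; ring.
rewrite flip.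
apply: h; first by rewrite gerDl ltW.
move=> s s0 s1 s2; apply: FPn; first exact: le_trans tT.
apply: window kd hn hn0; rewrite (ltr0_norm kn); first by rewrite opprK.
by apply: le_trans s2 _; rewrite lerDl oppr_ge0 ltW.
Qed.
(** The mass in the pipes of a nonnegative solution is nonnegative. *)
Lemma DD_le_MM z B t i : BC z B -> (forall s j, s <= t -> 0 <= DD z s j) -> DD z t i <= MM w z t.
Proof.
move=> bz z0; have B0 : 0 <= `|B| by [].
have bz' : BC z `|B| by apply: BC_le bz; exact: ler_norm.
have b0 : BC (fun=> 0 : 'rV[R]_m) `|B| by apply: BC_le (BC_zero R m).
have := MM_le S_closed hC1 hC3 hC4 Ow b0 bz' (t := t).
have -> : MM w (fun=> 0) t = 0 by exact: (M_zero H (@Omega_translate R m S hC2 t w Ow)).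
rewrite add0r; under eq_bigr do rewrite DD_zero subr0.
move=> h; have {}h : \sum_j DD z t j <= MM w z t.
  by apply: h => s j st; rewrite DD_zero; exact: z0.
by apply: le_trans h; rewrite (bigD1 i)//= lerDl sumr_ge0// => j _; exact: z0.
Qed.

(** These conditions are preserved by the semiflow and define a compact set. *)
Definition start w x := [/\ BU x, forall t i, t <= 0 -> 0 <= DD (ext x) t i <= c,
  forall s t i, s <= 0 -> t <= 0 -> `|DD (ext x) t i - DD (ext x) s i| <= C * `|t - s| & M S w x = c].

(** The clipped solution never meets the bounds: coordinates at zero cannot
    decrease by quasi-monotonicity, and the conserved mass bounds the solution by
    [c] as long as it has not passed [c + 1]. *)
Lemma solution_on_horizon x T : start w x -> 0 < T -> exists z, [/\ BC z r, Dlip S z C,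
  forall s, s <= 0 -> z s = ext x s, solves w z [set t | 0 <= t <= T] & forall s i, s <= T -> 0 <= DD z s i <= c].
Proof.
move=> [Bx xc xl xM] T0.
have [_ [rx rx0 bx]] := BU_ext Bx.
pose y0 t : 'rV[R]_m := \row_i DD (ext x) (Num.min t 0) i.
have y0E s i : s <= 0 -> y0 s ord0 i = DD (ext x) s i by move=> s0; rewrite mxE min_l.
have ly0 : lip y0 C.
  move=> s t i; rewrite !mxE; apply: le_trans (xl _ _ _ _ _) _; rewrite ?ge_min ?lexx ?orbT//.
  by rewrite ler_wpM2l ?min_lip.
have y0B s i : s <= 0 -> `|y0 s ord0 i| <= c.
  by move=> s0; rewrite y0E//; have /andP[? ?] := xc s i s0; rewrite ger0_norm.
have [y [ly yy0 yP]] := clipped_solution T0 ly0 y0B.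
have [bz zP] := unDP ly; set z := unD y in bz zP.
have z0 s : s <= 0 -> z s = ext x s.
  apply: (DD_inj hC4 bz bx) => u i u0; rewrite zP yy0// y0E//; have /andP[h1 h2] := xc u i u0.
  by rewrite clip_id//; lra.
have cy i : continuous (fun t => y t ord0 i) by move: i; apply/continuous_rowP; exact: lip_continuous ly.
(* Where [y] is negative, the clipped solution vanishes and the field points up. *)
have y_ge0 t i : t <= T -> 0 <= y t ord0 i.
  move=> tT; have [t0|t0] := leP t 0; first by rewrite yy0// y0E//; have /andP[] := xc t i t0.
  pose u s := Num.min (y s ord0 i) 0.
  suff : u 0 <= u t.
    rewrite /u yy0// y0E// min_r; last by have /andP[] := xc 0 i (lexx 0).
    by rewrite le_min => /andP[].
  apply: (dini_ge (ltW t0)) => [s|s /andP[s0 st] eta eta0].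
    by apply: continuous_min; [exact: cy|exact: cvg_cst].
  have [ys|ys] := leP 0 (y s ord0 i).
    exists 1 => // e e0 _; rewrite /u (min_r ys) subr0; apply: le_trans (_ : 0 <= _).
      by rewrite ge_min lexx orbT.
    by rewrite mulr_ge0// ltW.
  have P0 : 0 <= Phi y s i.
    have br : BC (fun=> 0 : 'rV[R]_m) r by apply: BC_le (BC_zero R m); exact: r_ge0.
    have := quasi_monotone S_closed hC1 hC2 hC3 hC4 hC5 Ow br bz (t := s) (i := i).
    rewrite FF_zero//; apply => [u' j _|]; rewrite DD_zero zP; first by have /andP[] := clip_range (y u' ord0 j).
    by rewrite /clip max_l// ge_min (ltW ys).
  have [|d d0 dP] := yP s i eta _ eta0; first by rewrite (ltW s0) (le_trans st).
  exists (Num.min d s) => [|e e0]; first by rewrite lt_min d0.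
  rewrite lt_min => /andP[ed es].
  have := dP (- e); rewrite normrN (gtr0_norm e0) => /(_ _ ed) h.
  have {}h : `|y (s - e) ord0 i - y s ord0 i - - e * Phi y s i| <= eta * e by apply: h; lra.
  have ep : 0 <= e * Phi y s i by rewrite mulr_ge0// ltW.
  rewrite /u (min_l (ltW ys)); have : Num.min (y (s - e) ord0 i) 0 <= y (s - e) ord0 i by rewrite ge_min lexx.
  by move: h; rewrite mulNr opprK ler_norml => /andP[? ?] ?; lra.
have z_ge0 s i : 0 <= DD z s i by rewrite zP; have /andP[] := clip_range (y s ord0 i).
have unclip s : s <= T -> (forall u i, u <= s -> y u ord0 i <= c + 1) -> forall i, y s ord0 i <= c.
  move=> sT ys i; have [s0|s0] := leP s 0; first by rewrite yy0// y0E//; have /andP[] := xc s i s0.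
  have zy u j : u <= s -> DD z u j = y u ord0 j.
    by move=> us; rewrite zP clip_id ?ys// y_ge0//; exact: le_trans sT.
  have lz t : 0 < t <= s -> leftsol w z t.
    move=> /andP[t0 ts] j eta eta0; have [|d d0 dP] := yP t j eta _ eta0.
      by rewrite (ltW t0) (le_trans ts).
    exists (Num.min d t) => [|e e0]; first by rewrite lt_min d0.
    rewrite lt_min => /andP[ed et]; have := dP (- e); rewrite normrN (gtr0_norm e0) => /(_ _ ed) h.
    have {}h : `|y (t - e) ord0 j - y t ord0 j - - e * Phi y t j| <= eta * e by apply: h; lra.
    by rewrite !zy ?ts//; [move: h; rewrite mulNr opprK|lra].
  rewrite -zy//; apply: le_trans (DD_le_MM i bz (fun s j _ => z_ge0 s j)) _.
  rewrite (MM_conserved H Ow bz (ltW s0) lz) (eq_MM S w z0) -M_ext xM.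
  exact: lexx.
(* In time [(C + 1)^-1] the function [y] cannot climb from [c] to [c + 1]. *)
have upper s i : s <= T -> y s ord0 i <= c + 1.
  move=> sT; pose k := (C + 1)^-1; have C1 : 0 < C + 1 := ltr_wpDl C0 ltr01.
  have k0 : 0 < k by rewrite invr_gt0.
  suff steps n : forall u j, u <= n%:R * k -> u <= T -> y u ord0 j <= c + 1.
    apply: (steps (Num.truncn (s / k)).+1) => //; rewrite -ler_pdivrMr//.
    exact/ltW/truncnS_gt.
  elim: n => [|n IH] u j un uT.
    by rewrite mul0r in un; rewrite yy0// y0E//; have /andP[_] := xc u j un; lra.
  have [un'|un'] := leP u (n%:R * k); first exact: IH.
  have nT : n%:R * k <= T by apply: le_trans uT; exact: ltW.
  have h1 : y (n%:R * k) ord0 j <= c.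
    by apply: unclip => // v l vn; apply: IH => //; exact: le_trans nT.
  have h2 := ly (n%:R * k) u j; have h3 := ler_norm (y u ord0 j - y (n%:R * k) ord0 j).
  have h4 : C * `|u - n%:R * k| <= 1.
    rewrite gtr0_norm ?subr_gt0//; apply: le_trans (_ : C * k <= 1).
      by apply: ler_wpM2l => //; move: un; rewrite -natr1 mulrDl mul1r; lra.
    by rewrite ler_pdivrMr// mul1r; lra.
  lra.
have zy s i : s <= T -> DD z s i = y s ord0 i by move=> sT; rewrite zP clip_id ?upper// y_ge0.
exists z; split=> //.
- by move=> s t i; rewrite !zP; apply: le_trans (clip_dist _ _) (ly s t i).
- move=> t i tT eta eta0; have [d d0 dP] := yP t i eta tT eta0; exists d => // k kT kd.
  by rewrite !zy; [exact: dP|case/andP: tT|case/andP: kT].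
- move=> s i sT; rewrite z_ge0 zy//=; apply: unclip => // u j us; apply: upper; exact: le_trans sT.
Qed.

(** Solutions on longer and longer horizons agree, by uniqueness. *)
Lemma global_solution x : start w x -> exists z, [/\ BC z r, Dlip S z C,
  is_solution S w x z & forall s i, 0 <= DD z s i <= c].
Proof.
move=> sx; have Bx : BU x by case: sx.
have /choice[Z ZP] : forall n : nat, exists z, [/\ BC z r, Dlip S z C,
    forall s, s <= 0 -> z s = ext x s, solves w z [set t | 0 <= t <= n.+1%:R] & forall s i, s <= n.+1%:R -> 0 <= DD z s i <= c].
  by move=> n; apply: solution_on_horizon sx _.
have lZ n t : 0 < t <= n.+1%:R -> leftsol w (Z n) t.
  move=> /andP[t0 tn]; have [_ _ _ sZ _] := ZP n; apply: (solves_leftsol sZ t0) => s /andP[s0 st] /=.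
  by rewrite s0 (le_trans st).
have agree n k s : (n <= k)%N -> s <= n.+1%:R -> Z n s = Z k s.
  move=> nk; have [b1 _ e1 _ _] := ZP n; have [b2 _ e2 _ _] := ZP k.
  have nk' : n.+1%:R <= k.+1%:R :> R by rewrite ler_nat.
  apply: (uniqueness H Ow b1 b2 (ler0n _ _) (lZ n)) => [t /andP[t0 tn]|t t0]; last by rewrite e1// e2.
  by apply: lZ; rewrite t0 (le_trans tn).
(* Any horizon beyond [t] would do. *)
pose z t := Z (Num.truncn `|t|) t.
have tr t : t <= (Num.truncn `|t|).+1%:R by apply: le_trans (ler_norm t) _; exact/ltW/truncnS_gt.
have zE n s : s <= n.+1%:R -> z s = Z n s.
  move=> sn; rewrite /z; have [kn|nk] := leqP (Num.truncn `|s|) n; first exact: agree.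
  by apply/esym/agree => //; exact: ltnW.
have zD n s i : s <= n.+1%:R -> DD z s i = DD (Z n) s i.
  by move=> sn; apply: eq_DD => u us; apply: zE; exact: le_trans sn.
have z_ext s : s <= 0 -> z s = ext x s.
  by move=> s0; rewrite (zE 0%N) ?(le_trans s0)//; have [_ _ -> ] := ZP 0%N.
have far t : t + 1 <= (Num.truncn `|t|).+2%:R by rewrite -[in leRHS]natr1 lerD2r.
have bz : BC z r.
  split=> [t|t i]; last by have [[_ bn] _ _ _ _] := ZP (Num.truncn `|t|); exact: bn.
  apply/cont_epsP => e e0; have [[cn _] _ _ _ _] := ZP (Num.truncn `|t|).+1.
  have /cont_epsP/(_ e e0)[d d0 dP] := cn t.
  exists (Num.min d 1) => [|u]; first by rewrite lt_min d0 ltr01.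
  rewrite lt_min => /andP[ud u1]; have ut : u <= t + 1 by move: u1; rewrite ltr_distl => /andP[]; lra.
  rewrite !(zE (Num.truncn `|t|).+1); first exact: dP.
    by apply: le_trans (far t); rewrite lerDl.
  exact: le_trans (far t).
exists z; split=> //.
- move=> s t i; pose n := Num.truncn (Num.max `|s| `|t|).
  have hn u : `|u| <= Num.max `|s| `|t| -> u <= n.+1%:R.
    by move=> um; apply: le_trans (ler_norm u) _; apply: le_trans um _; exact/ltW/truncnS_gt.
  rewrite !(zD n); [by have [_ Zl _ _ _] := ZP n; exact: Zl|apply: hn|apply: hn]; rewrite le_max lexx ?orbT//.
- apply/solutionP; split; first exact: bz.1.
    by rewrite (@eq_seg _ _ z (ext x)) ?seg_ext0.
  move=> t i /= t0 eta eta0; pose n := (Num.truncn `|t|).+1.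
  have tn : t <= n.+1%:R by apply: le_trans (far t); rewrite lerDl.
  have [_ _ _ sZ _] := ZP n; have [|d d0 dP] := sZ t i _ eta eta0; first by rewrite /= t0.
  exists (Num.min d 1) => [|k tk]; first by rewrite lt_min d0 ltr01.
  rewrite lt_min => /andP[kd k1].
  have tkn : t + k <= n.+1%:R by apply: le_trans (far t); rewrite lerD2l; apply: le_trans (ler_norm k) (ltW k1).
  have zZ s : s <= t -> z s = Z n s by move=> st; apply: zE; exact: le_trans tn.
  rewrite !(zD n)// (eq_FF S w i zZ).
  by apply: dP => //=; rewrite tk.
- move=> s i; have [_ _ _ _ h] := ZP (Num.truncn `|s|).
  by rewrite (zD (Num.truncn `|s|)) ?h.
Qed.
End Existence.

(** * Minimal sets of prescribed mass *)

(** A chain of nonempty compact sets has a common point: a cluster point of the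
    filter that it generates. *)
Lemma compact_chain (X : topologicalType) (A : set (set X)) : hausdorff_space X -> A !=set0 ->
  total_on A subset -> (forall K, A K -> compact K /\ K !=set0) -> exists p, forall K, A K -> K p.
Proof.
move=> hX [K0 AK0] tA Ac.
have fF : ProperFilter (filter_from A id).
  apply: filter_from_proper; last by move=> K /Ac[].
  apply: filter_from_filter; first by exists K0.
  move=> K K' AK AK'; have [KK|KK] := tA _ _ AK AK'; [exists K|exists K'] => // x Kx; split=> //; exact: KK.
have [|p [_ cp]] := (Ac _ AK0).1 _ fF; first by exists K0.
exists p => K AK; apply: (compact_closed hX (Ac _ AK).1) => B nB.
by apply: cp => //; exists K.
Qed.

Section Continuum.
Variables (R : realType) (m : nat) (S : compartmental R m).
Hypothesis H : standing S.
Let hC2 := st_C2 H.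
Let hC4 := st_C4 H.
Implicit Types (w : vfield R m) (s t e : R) (i j : 'I_m) (z : R -> 'rV[R]_m) (x : hist R m)
  (p q : vfield R m * hist R m) (K Q : set (vfield R m * hist R m)).
Local Notation DD := (DD S).
Local Notation FF := (FF S).
Local Notation MM := (MM S).
Local Notation kap := (kap S).

(** Zorn's lemma for the nonempty compact positively invariant subsets, ordered
    by reverse inclusion. *)
Lemma minimal_subset Q : Q `<=` Omega S `*` @BU R m -> Q !=set0 -> compact Q -> positively_invariant S Q ->
  exists2 K, K `<=` Q & minimal S K.
Proof.
move=> QB Q0 cQ iQ.
pose good K := [/\ K `<=` Q, K !=set0, compact K & positively_invariant S K].
pose gQ : {K | good K} := exist good Q (And4 (fun _ => id) Q0 cQ iQ).
pose below (k k' : {K | good K}) := `[< sval k' `<=` sval k >].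
have [|k1 k2 k3 /asboolP h1 /asboolP h2|A tA|[K [KQ K0 cK iK]] Kmax] := @ZL_preorder _ gQ below.
- by move=> k; exact/asboolP.
- by apply/asboolP => p /h2/h1.
- have [[k0 Ak0]|A0] := pselect (A !=set0); last by exists gQ => k Ak; case: A0; exists k.
  pose F := [set sval k | k in A].
  have Fgood K : F K -> good K by move=> [k _ <-]; exact: svalP k.
  have tF : total_on F subset.
    by move=> _ _ [k Ak <-] [k' Ak' <-]; case: (tA _ _ Ak Ak') => /asboolP; [right|left].
  have [||p pP] := @compact_chain _ F (@state_hausdorff R m) _ tF.
  + by exists (sval k0), k0.
  + by move=> K /Fgood[].
  pose N := [set p | forall K, F K -> K p].
  have NK K : F K -> N `<=` K by move=> FK q; exact.
  have Fk0 : F (sval k0) by exists k0.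
  have gN : good N.
    have [kQ k00 ck0 ik0] := Fgood _ Fk0; split.
    * by move=> q /(_ _ Fk0)/kQ.
    * by exists p.
    * apply: (subclosed_compact _ ck0); last exact: NK.
      move=> q cq K FK; have [_ _ cK _] := Fgood _ FK.
      apply: (compact_closed (@state_hausdorff R m) cK) => B /cq[q' [Nq' Bq']].
      by exists q'; split=> //; exact: Nq'.
    * move=> q t Nq t0; split; first by have [] := ik0 q t (Nq _ Fk0) t0.
      move=> q' tq K FK; have [_ _ _ iK] := Fgood _ FK.
      exact: (iK q t (Nq _ FK) t0).2.
  exists (exist good N gN) => k Ak; apply/asboolP; apply: NK; by exists k.
exists K => //; split=> //; first by move=> p /KQ/QB.
move=> K' K'K K'0 cK' iK'; apply/seteqP; split=> //.
have gK' : good K' by split=> // p /K'K/KQ.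
by have := Kmax (exist good K' gK'); rewrite /below /= => h; apply/asboolP/h/asboolP.
Qed.

Lemma closure_ge Q (B : set (vfield R m * hist R m)) (f : vfield R m * hist R m -> R) (k : R) p :
  Q `<=` B -> closed B -> cont_on B f -> (forall q, Q q -> k <= f q) -> closure Q p -> k <= f p.
Proof.
move=> QB cB cf Qf cp; have [|_ h] := @closed_ge _ _ B f k cB cf p; last exact: h.
by move=> A /cp[q [Qq Aq]]; exists q; split=> //; split; [exact: QB|exact: Qf].
Qed.

Lemma cont_DD r t i : 0 <= r -> t <= 0 ->
  cont_on (Omega S `*` @BU_ball R m r) (fun p => DD (ext p.2) t i).
Proof.
move=> r0 t0; have t0' : 0 <= - t by rewrite oppr_ge0.
have -> : (fun p : vfield R m * hist R m => DD (ext p.2) t i) = fun p => D S (back (- t) p).2 ord0 i.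
  by apply/funext => p; rewrite (back_state p t0') opprK.
exact: (cont_on_back H r0 t0' (D_cont H i r0)).
Qed.

Variables c C : R.
Hypotheses (c0 : 0 < c) (C0 : 0 <= C).
Hypothesis HC : forall w z t i, Omega S w -> BU_ball ((c + 1) / (1 - kap)) (seg z t) -> `|FF w z t i| <= C.
Let r := c / (1 - kap).

Definition starts : set (vfield R m * hist R m) := [set p | Omega S p.1 /\ start S c C p.1 p.2].

Let c0' : 0 <= c := ltW c0.

Let r_ge0 : 0 <= r := divr_ge0 c0' (ltW (kap1 hC4)).

Let box : set (vfield R m * hist R m) :=
  Omega S `*` [set x | (forall t i, `|ext x t ord0 i| <= r) /\ lip (ext x) (C / (1 - kap))].

Lemma box_ball : box `<=` Omega S `*` @BU_ball R m r.
Proof.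
move=> p [Op [bp lp]]; split=> //; rewrite -(seg_ext0 p.2); apply: seg_BU => //; last exact: lip_ucont lp.
by split=> //; exact: lip_continuous lp.
Qed.

Lemma starts_box : starts `<=` box.
Proof.
move=> p [Op [Bp pc pl _]]; split=> //; have [_ [B B0 bp]] := BU_ext Bp.
have cl t : Num.min t 0 <= 0 by rewrite ge_min lexx orbT.
split=> [t i|s t i].
  rewrite -ext_clamp; apply: (DD_bound hC4 bp c0' (t := 0)) => // s j s0.
  by have /andP[? ?] := pc s j s0; rewrite ger0_norm.
rewrite -(ext_clamp p.2 t) -(ext_clamp p.2 s).
apply: le_trans (DD_lip hC4 bp C0 (t := 0) _ i (cl t) (cl s)) _.
  by move=> u v j u0 v0; exact: pl.
by rewrite ler_wpM2l ?min_lip// divr_ge0// ltW// (kap1 hC4).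
Qed.

(** The conditions are closed, and those on [D] bound the histories and their
    Lipschitz constants. *)
Lemma starts_compact : compact starts.
Proof.
have cbox : compact box := compact_setX (Omega_compact hC2) (@lip_hist_compact R m r (C / (1 - kap))).
apply: (subclosed_compact _ cbox); last exact: starts_box.
move=> p cp; have clbox := compact_closed (@state_hausdorff R m) cbox.
have ge (f : vfield R m * hist R m -> R) (k : R) : cont_on (Omega S `*` @BU_ball R m r) f -> (forall q, starts q -> k <= f q) -> k <= f p.
  move=> cf Qf; apply: (closure_ge starts_box clbox _ Qf cp).
  by apply: cont_on_sub cf; exact: box_ball.
have bp : box p by apply: clbox => A /cp[q [/starts_box bq Aq]]; exists q.
have [Op [Bp _]] := box_ball bp.
have cD := cont_DD _ r_ge0.
split=> //; split=> //.
- move=> t i t0; apply/andP; split.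
    by apply: (ge (fun p => DD (ext p.2) t i)); [exact: cD|move=> q [_ [_ /(_ t i t0)/andP[]]]].
  rewrite -lerN2; apply: (ge (fun p => - DD (ext p.2) t i)); first exact/cont_onN/cD.
  by move=> q [_ [_ /(_ t i t0)/andP[]]]; rewrite lerN2.
- have lo s t i : s <= 0 -> t <= 0 -> - (C * `|t - s|) <= DD (ext p.2) t i - DD (ext p.2) s i.
    move=> s0 t0; apply: (ge (fun p => DD (ext p.2) t i - DD (ext p.2) s i)).
      by apply: cont_onD; [exact: cD|exact/cont_onN/cD].
    by move=> q [_ [_ _ /(_ s t i s0 t0)]]; rewrite ler_norml => /andP[].
  move=> s t i s0 t0; rewrite ler_norml lo//=; have := lo t s i t0 s0.
  by rewrite [`|s - t|]distrC; lra.
- apply/le_anti/andP; split; last by apply: (ge (fun p => M S p.1 p.2)); [exact: M_cont|move=> q [_ [_ _ _ ->]]].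
  rewrite -lerN2; apply: (ge (fun p => - M S p.1 p.2)); first exact/cont_onN/M_cont.
  by move=> q [_ [_ _ _ ->]].
Qed.

Lemma starts_invariant : positively_invariant S starts.
Proof.
move=> [w x] t [/= Ow sx] t0.
have [z [bz lz sz zc]] := global_solution H Ow c0' C0 HC sx.
have [Bx _ _ xM] := sx; split=> [|_ [z' sz' ->]]; first by exists (state w z t), z.
rewrite (solution_unique H Ow Bx sz' sz); split=> /=; first exact: Omega_translate.
have [/= cz z0 sz0] := (solutionP _ _ _ _).1 sz.
have DDE s i : s <= 0 -> DD (ext (seg z t)) s i = DD z (t + s) i.
  by move=> s0; rewrite -DD_shift; apply: eq_DD => u us; rewrite ext_seg//; exact: le_trans s0.
split.
- have r10 : 0 <= (c + 1) / (1 - kap) by apply: divr_ge0; [exact: addr_ge0|exact/ltW/(kap1 hC4)].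
  by have [] := seg_BU t r10 bz (lip_ucont (Dlip_lip H C0 bz lz)).
- by move=> s i s0; rewrite DDE.
- move=> s u i s0 u0; rewrite !DDE//; apply: le_trans (lz _ _ _) _.
  by rewrite (_ : t + u - (t + s) = u - s)//; ring.
- have lsol u : 0 < u <= t -> leftsol S w z u.
    by move=> /andP[u0 _]; apply: (solves_leftsol sz0 u0) => s /andP[].
  have := MM_conserved H Ow bz t0 lsol; rewrite /MM translate0 z0 => ->.
  exact: xM.
Qed.

(** Constant histories: their mass is a continuous function of the constant that
    vanishes at 0 and is at least [c] at [r], so that it takes the value [c]. *)
Lemma starts_nonempty : starts !=set0.
Proof.
have [w Ow] := Omega_nonempty hC2; pose i0 := Ordinal (st_pos H).
have k1 := kap1 hC4.
pose x k : hist R m := fun=> const_mx k.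
have ext_x k : ext (x k) = fun=> const_mx k by [].
have Bx k : 0 <= k -> k <= r -> BU_ball r (x k).
  move=> k0 kr; rewrite -(seg_ext0 (x k)); apply: seg_BU => //.
    by apply: BC_le (BC_const m k); rewrite ger0_norm.
  by move=> e e0; exists 1 => // s t _; rewrite subrr normr0.
have Dx k t i : DD (ext (x k)) t i = k * (1 - nu_mass S i) by rewrite ext_x DD_const.
have nu1 i : 1 - kap <= 1 - nu_mass S i by rewrite lerD2l lerN2 nu_mass_le.
have Dx0 k t i : 0 <= k -> 0 <= DD (ext (x k)) t i.
  by move=> k0; rewrite Dx mulr_ge0//; exact: le_trans (ltW k1) (nu1 i).
have DM k t i : 0 <= k -> DD (ext (x k)) t i <= M S w (x k).
  move=> k0; rewrite M_ext (_ : DD _ t i = DD (ext (x k)) 0 i) ?Dx//.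
  rewrite -(Dx k 0); apply: (DD_le_MM H Ow i (BC_const m k)) => s j _; exact: Dx0.
have [k kr kc] : exists2 k, k \in `[0, r] & M S w (x k) = c.
  apply: IVT => //.
    apply/subspace_continuousP => k /=; rewrite in_itv /= => /andP[k0 kr]; apply/cvgrPdist_lt => e e0.
    have /pnear_basis[T [d [_ d0 Td]]] := M_cont H r_ge0 (conj Ow (Bx k k0 kr) : (Omega S `*` @BU_ball R m r) (w, x k)) e0.
    exists d => //= k' /= kd; rewrite in_itv /= => /andP[k'0 k'r].
    rewrite distrC; apply: (Td (w, x k')); last by split=> //; exact: Bx.
    split; first exact: near_on_refl.
    move=> s _; apply: row_norm_lt => // i; rewrite !mxE distrC.
    exact: kd.
  have e0 : const_mx 0 = 0 :> 'rV[R]_m by apply/rowP => j; rewrite !mxE.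
  have -> : M S w (x 0) = 0 by rewrite /x e0; exact: (M_zero H Ow).
  apply/andP; split; first by rewrite ge_min c0'.
  rewrite le_max; apply/orP; right; apply: le_trans (DM r 0 i0 r_ge0).
  by rewrite Dx -[c in c <= _](divfK (lt0r_neq0 k1)) ler_wpM2l.
move: kr; rewrite in_itv /= => /andP[k0 kr].
exists (w, x k); split=> //; split=> //=; first by have [] := Bx k k0 kr.
- by move=> t i _; rewrite Dx0// -kc DM.
- by move=> s t i _ _; rewrite !Dx subrr normr0 mulr_ge0.
Qed.

End Continuum.

Lemma minimal_exists (R : realType) (m : nat) (S : compartmental R m) (c : R) : standing S -> 0 < c ->
  exists K, minimal S K /\ forall p, K p -> M S p.1 p.2 = c.
Proof.
move=> H c0; have r0 : 0 <= (c + 1) / (1 - kap S).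
  by apply: divr_ge0; [lra|exact/ltW/(kap1 (st_C4 H))].
have [C C0 HC] := FF_bound H r0.
have [||||K KQ mK] := @minimal_subset _ _ S (starts S c C).
- by move=> p [Op []].
- exact: (starts_nonempty H c0 C0).
- exact: (starts_compact H c0 C0).
- exact: (starts_invariant H c0 C0 HC).
by exists K; split=> // p /KQ[_ []].
Qed.

Theorem theorem6p9 (R : realType) (m : nat) (S : compartmental R m)
    (m_gt0 : (0 < m)%N)
    (S_closed : closed_system S)
    (F_reg : F_regular S)
    (hC1 : C1 S) (hC2 : C2 S) (hC3 : C3 S) (hC4 : C4 S) (hC5 : C5 S)
    (hC6 : C6star S) (hC7 : C7 S) :
  [/\ forall c : R, 0 < c ->
        exists! K : set (vfield R m * hist R m),
          minimal S K /\ (forall p, K p -> M S p.1 p.2 = c),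
      forall (c : R) (K : set (vfield R m * hist R m)), 0 < c ->
        minimal S K -> (forall p, K p -> M S p.1 p.2 = c) ->
        K `<=` Omega S `*` BUD S &
      forall (c1 c2 : R) (K1 K2 : set (vfield R m * hist R m)),
        0 < c1 -> c1 < c2 ->
        minimal S K1 -> (forall p, K1 p -> M S p.1 p.2 = c1) ->
        minimal S K2 -> (forall p, K2 p -> M S p.1 p.2 = c2) ->
        ltK S K1 K2].
Proof.
have H : standing S by split.
split.
- move=> c c0; have [K [mK Kc]] := minimal_exists H c0; exists K; split=> // K' [mK' K'c].
  exact: (minimal_unique H hC7 mK mK' c0 Kc K'c).
- move=> c K c0 /(minimal_is_graph H)[x -> mx] xc.
  by apply: (minimal_positive H hC7 mx c0) => w Ow; exact: (xc (w, x w)).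
- by move=> c1 c2 K1 K2 c0 cc m1 h1 m2 h2; exact: (minimal_ltK H hC7 c0 cc m1 m2 h1 h2).
Qed.
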